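(* Let $N>1$ and let $T=\{T_\omega\}_{\omega\in\Omega}$ be a random Saussol map on a compact set $C\subset\mathbb{R}^N$ over $\sigma:\Omega\to\Omega$, with constants $\alpha\in(0,1]$, $S>0$ and parameter $\varepsilon_0>0$ small enough, with transfer operators $\mathcal{L}_\omega$ on $V_\alpha$, and suppose the constant function $1$ on $C$ belongs to $V_\alpha$. Assume $\int_\Omega\log^+\|\mathcal{L}_\omega\|_\alpha\,d\mathbb{P}(\omega)<\infty$. Let $V_\alpha=Y_1(\omega)\oplus\dots\oplus Y_l(\omega)\oplus V(\omega)$ be the Oseledets splitting for the random dynamical system $(\Omega,\mathcal{F},\mathbb{P},\sigma,V_\alpha,\mathcal{L})$, with $\lambda_1=\lambda^*=0$. For $\mathbb{P}$-a.e. $\omega$ let $h_\omega\in V_\alpha$ be the $L^1$-limit $$h_\omega=\lim_{s\to\infty}\frac1s\sum_{k=1}^s(\mathcal{L}_{\sigma^{-1}\omega}\circ\dots\circ\mathcal{L}_{\sigma^{-k}\omega})1 .$$ Then for $\mathbb{P}$-a.e. $\omega\in\Omega$, $h_\omega\in Y_1(\omega)$. Moreover, the number $r$ of ergodic skew product ACIPs $\mu_1,\dots,\mu_r$ of $T$ is finite and $$r\le d_1=\dim(Y_1(\omega)).$$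
   Context: **Notation.** $N>1$ throughout; $m$ is Lebesgue measure on $\mathbb{R}^N$, $d$ the Euclidean metric, $B_\varepsilon(x)$ the open ball of radius $\varepsilon$ about $x$, and $B_\varepsilon(K)=\{x: d(x,K)<\varepsilon\}$ for a set $K$. **Space of bounded oscillation.** For a Borel set $K\subset\mathbb{R}^N$ and $f\in L^1(\mathbb{R}^N)$, $\mathrm{osc}(f,K)=\operatorname{ess\,sup}_K f-\operatorname{ess\,inf}_K f$. For $0<\alpha\le1$ and $\tilde\varepsilon_0>0$, $|f|_\alpha=\sup_{0<\varepsilon\le\tilde\varepsilon_0}\varepsilon^{-\alpha}\int_{\mathbb{R}^N}\mathrm{osc}(f,B_\varepsilon(x))\,dx$. For $C\subset\mathbb{R}^N$ Borel, $f\in L^1(C)$ is identified with its extension by zero to $\mathbb{R}^N$; $V_\alpha$ is the set of $f\in L^1(C)$ with $|f|_\alpha<\infty$, with norm $\|f\|_\alpha=\|f\|_{L^1}+|f|_\alpha$. The set $V_\alpha$ does not depend on $\tilde\varepsilon_0$, and different choices of $\tilde\varepsilon_0$ (here $\tilde\varepsilon_0=S\varepsilon_0$) give equivalent norms. $V_\alpha$ is a Banach space compactly embedded in $L^1(C)$. **Random Saussol map.** Let $(\Omega,\mathcal{F},\mathbb{P})$ be a probability space ($\Omega$ a topological space and $\mathbb{P}$ Borel), and $\sigma:\Omega\to\Omega$ invertible, ergodic and $\mathbb{P}$-preserving. Let $C\subset\mathbb{R}^N$ be compact with $\mathrm{clos}(\mathrm{int}(C))\ne\emptyset$. A random Saussol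 map $T$ over $\sigma$ is a family of maps $T_\omega:C\to C$ ($\omega\in\Omega$) such that there are an at most countable family (possibly depending on $\omega$) of disjoint open sets $U_i\subset C$ and open sets $V_i\supset\mathrm{clos}(U_i)$, $i\in\mathcal{I}$, and maps $T_{\omega,i}:V_i\to\mathbb{R}^N$ satisfying, for some $0<\alpha\le1$ and all small enough $\varepsilon_0>0$: (PE1) There is $S>0$ such that for $\mathbb{P}$-a.e. $\omega$ one has $0<s(\omega)<S$ and, for all $i\in\mathcal{I}$ and $u,v\in T_{\omega,i}V_i$ with $d(u,v)\le\varepsilon_0$, $d(T_{\omega,i}^{-1}u,T_{\omega,i}^{-1}v)\le s(\omega)d(u,v)$; moreover $\int_\Omega\log(s(\omega))\,d\mathbb{P}(\omega)<0$. (PE2) For $\mathbb{P}$-a.e. $\omega$ and all $i$: $T_\omega|_{U_i}=T_{\omega,i}|_{U_i}$ and $T_{\omega,i}(V_i)\supset B_{\varepsilon_0}(T_{\omega,i}(U_i))$. (PE3) For $\mathbb{P}$-a.e. $\omega$ and all $i$: $T_{\omega,i}\in C^1(V_i)$ is injective and $T_{\omega,i}^{-1}\in C^1(T_{\omega,i}V_i)$; moreover there is $c>0$ such that for $\mathbb{P}$-a.e. $\omega$, all $i$, $\varepsilon\le\varepsilon_0$, $z\in T_{\omega,i}V_i$ and $x,y\in B_\varepsilon(z)\cap T_{\omega,i}V_i$, $|\det DT_{\omega,i}^{-1}x-\det DT_{\omega,i}^{-1}y|\le c\,|\det DT_{\omega,i}^{-1}z|\,\varepsilon^\alpha$. (PE4)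 For $\mathbb{P}$-a.e. $\omega$, $m(C\setminus\bigcup_{i\in\mathcal{I}}U_i)=0$. (PE5) Let $G_{\omega,\varepsilon_0}(\varepsilon)=\sup_{x\in C}\sum_{i\in\mathcal{I}}\dfrac{m\big(T_{\omega,i}^{-1}B_\varepsilon(\partial T_\omega U_i)\cap B_{(S-s(\omega))\varepsilon_0}(x)\big)}{m(B_{(S-s(\omega))\varepsilon_0}(x))}$ and $\zeta_{\varepsilon_0}(\omega)=s(\omega)^\alpha+2\sup_{0<\varepsilon\le\varepsilon_0}\dfrac{G_{\omega,\varepsilon_0}(\varepsilon)}{\varepsilon^\alpha}(S\varepsilon_0)^\alpha$. Then $\int_\Omega\log(\zeta_{\varepsilon_0}(\omega))\,d\mathbb{P}(\omega)<0$. The transfer operator is $\mathcal{L}_\omega f=\sum_{i\in\mathcal{I}}\big((g_\omega f)\circ T_{\omega,i}^{-1}\big)1_{T_\omega U_i}$ with $g_\omega=1/|\det DT_\omega|$. It is also assumed that $\omega\mapsto\mathcal{L}_\omega$ (into the bounded operators on $V_\alpha$) is $\mathbb{P}$-continuous: $\Omega$ is a countable union of Borel sets on each of which the restriction of the map is continuous. ''$\varepsilon_0$ small enough'' in the claim means: $\varepsilon_0\in(0,\varepsilon_* )$ for some $\varepsilon_*>0$. **Oseledets splitting.** Put $\mathcal{L}_\omega^{(k)}=\mathcal{L}_{\sigma^{k-1}\omega}\circ\dots\circ\mathcal{L}_\omega$; let $\lambda^*$ be the $\mathbb{P}$-a.e. constant value of $\lim_k\frac1k\log\|\mathcal{L}_\omega^{(k)}\|$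 and $\mathcal{K}^*$ that of $\lim_k\frac1k\log\|\mathcal{L}^{(k)}_\omega\|_{ic}$, where $\|A\|_{ic}$ is the infimum of $r>0$ such that the image under $A$ of the unit ball is covered by finitely many balls of radius $r$. For random Saussol maps (with $\varepsilon_0$ small enough) $\mathcal{K}^*<\lambda^*=0$. An Oseledets splitting for a random dynamical system on a Banach space $\mathcal{X}$ consists of exponents $\infty>\lambda^*=\lambda_1>\lambda_2>\dots>\lambda_l>\mathcal{K}^*\ge-\infty$ ($l\ge1$ finite or countably infinite) and $\omega$-dependent splittings $\mathcal{X}=Y_1(\omega)\oplus\dots\oplus Y_l(\omega)\oplus V(\omega)$ with $d_j=\dim Y_j(\omega)<\infty$ and $V(\omega)$ in the Grassmannian of $\mathcal{X}$ (closed complemented subspaces), such that for $\mathbb{P}$-a.e. $\omega$ and all $j$: $\mathcal{L}_\omega Y_j(\omega)=Y_j(\sigma\omega)$, $\mathcal{L}_\omega V(\omega)\subseteq V(\sigma\omega)$, $\lim_{s\to\infty}\frac1s\log\|\mathcal{L}_\omega^{(s)}y\|=\lambda_j$ for all $y\in Y_j(\omega)\setminus\{0\}$, and $\lim_{s\to\infty}\frac1s\log\|\mathcal{L}_\omega^{(s)}v\|\le\mathcal{K}^*$ for all $v\in V(\omega)$. **Skew product ACIPs.** The skew product is $F(\omega,x)=(\sigma\omega,T_\omega(x))$ on $\Omega\times C$ (taken to be measurable). A skew product ACIP is an $F$-invariant probability measure of the form $\mu(A)=\int_\Omega\mu_\omega(A_\omega)\,d\mathbb{P}(\omega)$, with $A_\omega=\{x:(\omega,x)\in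 A\}$ and $\mu_\omega$ probability measures on $C$ absolutely continuous with respect to $m$ (equivalently, $\mu$ is absolutely continuous with respect to $\mathbb{P}\times m$); it is ergodic if it is ergodic for $F$.
   Formalization: The Oseledets splitting is also required to be P-continuous in ω (as the multiplicative ergodic theorem provides); without regularity in ω, non-measurable equivariant choices of Y_1(ω) satisfy all the listed conditions but do not contain h_ω. *)

(* Defs.v *)
From HB Require Import structures.
From mathcomp Require Import all_boot all_order all_algebra.
From mathcomp Require Import all_classical all_reals all_analysis.
From mathcomp Require Import measurable_realfun.

Set Implicit Arguments.
Unset Strict Implicit.
Unset Printing Implicit Defensive.

Import Order.TTheory GRing.Theory Num.Theory.
Import numFieldNormedType.Exports.

Local Open Scope classical_set_scope.
Local Open Scope ring_scope.

Section rV_borel.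
Context (R : realType) (n : nat).

HB.instance Definition _ := @isMeasurable.Build
  (sigma_display (@open 'rV[R]_n)) 'rV[R]_n <<s @open 'rV[R]_n >>
  (@sigma_algebra0 _ setT _) (@sigma_algebraC _ _)
  (@sigma_algebra_bigcup _ setT _).

Lemma open_measurable_rV (A : set 'rV[R]_n) : open A -> measurable A.
Proof. exact: sub_sigma_algebra. Qed.

End rV_borel.

(* N-dimensional Lebesgue measure, by iterated products: it is the image of
   (1-dimensional Lebesgue measure) \x (n-dimensional Lebesgue measure) under
   the identification of R * R^n with R^n.+1. *)
Section lebesgue_rV.
Context (R : realType).

Definition cons_rV n (p : measurableTypeR R * 'rV[R]_n) : 'rV[R]_n.+1 :=
  \row_i (if unlift ord0 i is Some j then p.2 ord0 j else (p.1 : R)).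

Definition uncons_rV n (v : 'rV[R]_n.+1) : measurableTypeR R * 'rV[R]_n :=
  (v ord0 ord0, \row_j v ord0 (lift ord0 j)).

Lemma cons_rVK n : cancel (@cons_rV n) (@uncons_rV n).
Proof.
case=> x v; rewrite /uncons_rV /cons_rV mxE unlift_none/=; congr pair.
by apply/rowP => j; rewrite !mxE liftK.
Qed.

Lemma uncons_rVK n : cancel (@uncons_rV n) (@cons_rV n).
Proof.
move=> v; apply/rowP => i; rewrite mxE.
by case: unliftP => [j ->|->] //=; rewrite mxE.
Qed.

Lemma measurable_coord n (i : 'I_n) (U : set R) :
  open U -> measurable [set v : 'rV[R]_n | U (v ord0 i)].
Proof.
move=> oU; apply: open_measurable_rV.
by move: U oU; apply/continuousP; exact: coord_continuous.
Qed.

Lemma measurable_cons_rV n : measurable_fun setT (@cons_rV n).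
Proof.
apply: (@measurability _ _ _ _ _ _ (@open 'rV[R]_n.+1)) => //.
move=> _ [U oU <-]; rewrite setTI.
pose c (q : 'rV[rat]_n.+1) : 'rV[R]_n.+1 := map_mx ratr q.
pose F (x : 'rV[rat]_n.+1 * nat) : set (measurableTypeR R * 'rV[R]_n) :=
  if pselect (ball (c x.1) x.2.+1%:R^-1 `<=` U) then
  @cons_rV n @^-1` (ball (c x.1) x.2.+1%:R^-1) else set0.
have -> : @cons_rV n @^-1` U = \bigcup_x F x.
  apply/seteqP; split=> [p Up|p [[q k] _]]; last first.
    by rewrite /F/=; case: pselect => //= sU /sU.
  have /nbhs_ballP[e /= e0 eU] : nbhs (cons_rV p) U by exact: open_nbhs_nbhs.
  have [k ke] : exists k, k.+1%:R^-1 < e / 2.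
    have e20 : 0 < e / 2 by rewrite divr_gt0.
    have [k] := near_infty_natSinv_lt (PosNum e20).
    by move=> _ /(_ _ (leqnn _)) ?; exists k.
  have [q Hq] : {q : 'I_n.+1 -> rat &
      forall i, `|cons_rV p ord0 i - ratr (q i)| < k.+1%:R^-1}.
    apply: (@choice _ _ (fun i q => `|cons_rV p ord0 i - ratr q| < k.+1%:R^-1)).
    move=> i; have k0 : 0 < k.+1%:R^-1 :> R by rewrite invr_gt0.
    have [y [by_ [q _ qy]]] := @dense_rat R (ball (cons_rV p ord0 i) k.+1%:R^-1)
      (ex_intro _ _ (ballxx (cons_rV p ord0 i) k0)) (ball_open (cons_rV p ord0 i) _).
    by exists q; rewrite qy; exact: by_.
  exists (\row_i q i, k) => //; rewrite /F/=.
  have cq j : c (\row_i q i) ord0 j = ratr (q j) by rewrite !mxE.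
  case: pselect => [sU|[]].
    split; first by rewrite invr_gt0.
    by move=> i j; rewrite ord1 cq /ball/= distrC; exact: Hq.
  move=> z [_ zb]; apply: eU; split => // i j.
  have := zb i j; rewrite /ball/= !ord1 cq => zq.
  rewrite (splitr e) (le_lt_trans (ler_distD (ratr (q j)) _ _))// ltrD//.
  - exact: lt_trans (Hq _) ke.
  - exact: lt_trans ke.
apply: countable_bigcupT_measurable => [|x]; first exact: countableP.
rewrite /F; case: pselect => //= _.
have k0 : 0 < x.2.+1%:R^-1 :> R by rewrite invr_gt0.
have -> : @cons_rV n @^-1` ball (c x.1) x.2.+1%:R^-1 =
    \bigcap_(i in [set: 'I_n.+1])
      [set p | ball (c x.1 ord0 i) x.2.+1%:R^-1 (cons_rV p ord0 i)].
  apply/seteqP; split=> p /=; first by move=> [_ pb] i _ /=; exact: pb.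
  by move=> pb; split => // i j; rewrite ord1; exact: pb.
apply: fin_bigcap_measurable => // i _.
have -> : [set p | ball (c x.1 ord0 i) x.2.+1%:R^-1 (cons_rV p ord0 i)] =
    if unlift ord0 i is Some j then
      snd @^-1` [set v : 'rV[R]_n | ball (c x.1 ord0 i) x.2.+1%:R^-1 (v ord0 j)]
    else fst @^-1` (ball (c x.1 ord0 i) x.2.+1%:R^-1 : set (measurableTypeR R)).
  by rewrite /cons_rV; apply/seteqP; split=> p; rewrite /= mxE; case: unlift.
case: unlift => [j|]; rewrite -[X in measurable X]setTI.
- apply: measurable_snd => //; apply: measurable_coord; exact: ball_open.
- apply: measurable_fst => //; apply: open_measurable; exact: ball_open.
Qed.

Lemma measurable_uncons_rV n : measurable_fun setT (@uncons_rV n).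
Proof.
apply/measurable_fun_pairP; split => [|].
  apply: (measurability _ (RGenOpens.measurableE R)) => //.
  move=> _ [_ [x [y ->]] <-]; rewrite setTI.
  by apply: (measurable_coord ord0); exact: interval_open.
apply: (@measurability _ _ _ _ _ _ (@open 'rV[R]_n)) => //.
move=> _ [U oU <-]; rewrite setTI; apply: open_measurable_rV.
move: U oU; apply/continuousP => v.
move=> W /nbhs_ballP[e e0 eW]; apply/nbhs_ballP; exists e => // w [_ vw].
by apply: eW; split=> // i j; rewrite !mxE; exact: vw.
Qed.

Section step.
Context (n : nat) (mu : {sigma_finite_measure set 'rV[R]_n -> \bar R}).

Definition lebesgue_rVS : set 'rV[R]_n.+1 -> \bar R :=
  pushforward (lebesgue_measure \x mu)%E (@cons_rV n).

Let preimage_cons_rV A : measurable A -> measurable (@cons_rV n @^-1` A).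
Proof. by move=> ?; rewrite -[X in measurable X]setTI; exact: measurable_cons_rV. Qed.

Let lebesgue_rVS0 : lebesgue_rVS set0 = 0%E.
Proof. by rewrite /lebesgue_rVS /pushforward preimage_set0 measure0. Qed.

Let lebesgue_rVS_ge0 A : (0 <= lebesgue_rVS A)%E.
Proof. by rewrite /lebesgue_rVS /pushforward measure_ge0. Qed.

Let lebesgue_rVS_sigma_additive : semi_sigma_additive lebesgue_rVS.
Proof.
move=> F mF tF mUF; rewrite /lebesgue_rVS /pushforward preimage_bigcup.
apply: measure_semi_sigma_additive.
- by move=> k; exact: preimage_cons_rV.
- apply/trivIsetP => /= i j _ _ ij; rewrite -preimage_setI.
  by move/trivIsetP : tF => /(_ _ _ _ _ ij) ->//; rewrite preimage_set0.
- by rewrite -preimage_bigcup; exact: preimage_cons_rV.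
Qed.

HB.instance Definition _ := isMeasure.Build _ _ _ lebesgue_rVS
  lebesgue_rVS0 lebesgue_rVS_ge0 lebesgue_rVS_sigma_additive.

Let lebesgue_rVS_sigma_finite : sigma_finite setT lebesgue_rVS.
Proof.
have /sigma_finiteP[F [FT ndF Foo]] := sigma_finiteT (@lebesgue_measure R).
have /sigma_finiteP[G [GT ndG Goo]] := sigma_finiteT mu.
exists (fun k => @uncons_rV n @^-1` (F k `*` G k)) => [|k].
  apply/seteqP; split=> // v _.
  have [i _ Fi] : (\bigcup_i F i) (v ord0 ord0) by rewrite -FT.
  have [j _ Gj] : (\bigcup_j G j) (uncons_rV v).2 by rewrite -GT.
  exists (maxn i j) => //; split.
  - by move: Fi; exact/subsetPset/ndF/leq_maxl.
  - by move: Gj; exact/subsetPset/ndG/leq_maxr.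
have [mF Fk] := Foo k; have [mG Gk] := Goo k; split.
  rewrite -[X in measurable X]setTI; apply: measurable_uncons_rV => //.
  exact: measurableX.
rewrite /lebesgue_rVS /pushforward -comp_preimage.
rewrite (_ : _ \o _ = id) ?preimage_id; last by apply/funext => ?; exact: cons_rVK.
by rewrite product_measure1E// lte_mul_pinfty// ge0_fin_numE.
Qed.

HB.instance Definition _ := Measure_isSigmaFinite.Build _ _ _ lebesgue_rVS
  lebesgue_rVS_sigma_finite.
End step.

Fixpoint lebesgue_rV n : {sigma_finite_measure set 'rV[R]_n -> \bar R} :=
  match n with
  | 0 => dirac (0 : 'rV[R]_0)
  | n'.+1 => lebesgue_rVS (lebesgue_rV n')
  end.

End lebesgue_rV.

Section euclidean.
Context (R : realType) (N : nat).
Implicit Types (x y : 'rV[R]_N) (K : set 'rV[R]_N) (e : R).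

(* The norm that the library puts on row vectors is the sup norm; it induces
   the same topology, but the balls of the theory are Euclidean. *)
Definition eucl_dist x y : R :=
  Num.sqrt (\sum_(i < N) (x ord0 i - y ord0 i) ^+ 2).

Definition eucl_ball e x : set 'rV[R]_N := [set y | eucl_dist x y < e].

Definition dist_set x K : \bar R := ereal_inf [set (eucl_dist x y)%:E | y in K].

Definition nbhd_set e K : set 'rV[R]_N := [set x | (dist_set x K < e%:E)%E].

Definition boundary K : set 'rV[R]_N := closure K `\` interior K.

(* Only meaningful for open A: 'J f is the two-sided Jacobian. *)
Definition C1_on (A : set 'rV[R]_N) (f : 'rV[R]_N -> 'rV[R]_N) : Prop :=
  (forall x, A x -> differentiable f x) /\
  (forall x, A x -> {for x, continuous (fun z => 'J f z)}).

End euclidean.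

(* Functions of bounded oscillation. Elements of L^1 are represented by
   functions, extended by zero; two functions that agree almost everywhere are
   the same element, and the norms below do not distinguish them. *)
Section quasi_holder.
Context (R : realType) (N : nat).
Local Notation m := (lebesgue_rV R N).
Implicit Types (f : 'rV[R]_N -> R) (K C : set 'rV[R]_N) (alpha : R).

Definition ess_sup_on f K : \bar R :=
  ereal_inf [set y | {ae m, forall x, K x -> ((f x)%:E <= y)%E}].

Definition ess_inf_on f K : \bar R :=
  ereal_sup [set y | {ae m, forall x, K x -> (y <= (f x)%:E)%E}].

Definition osc f K : \bar R := (ess_sup_on f K - ess_inf_on f K)%E.

Definition osc_seminorm (alpha e0 : R) f : \bar R :=
  ereal_sup [set ((e `^ (- alpha))%:E * \int[m]_x osc f (eucl_ball e x))%E
            | e in [set e | 0 < e <= e0]].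

Definition L1norm f : \bar R := 'N[m]_1[EFin \o f]%E.

Definition L1 C : set ('rV[R]_N -> R) :=
  [set f | m.-integrable setT (EFin \o f) /\ forall x, ~ C x -> f x = 0].

Definition Valpha C (alpha e0 : R) : set ('rV[R]_N -> R) :=
  [set f | L1 C f /\ (osc_seminorm alpha e0 f < +oo)%E].

Definition Vnorm (alpha e0 : R) f : \bar R := (L1norm f + osc_seminorm alpha e0 f)%E.

End quasi_holder.

Notation borel Om := (g_sigma_algebraType (@open Om)).

Section base.
Context (R : realType) (Om : ptopologicalType) (P : probability (borel Om) R).

Record ergodic_base (sigma sigmai : borel Om -> borel Om) : Prop := {
  base_can : cancel sigma sigmai ;
  base_cani : cancel sigmai sigma ;
  base_meas : measurable_fun setT sigma ;
  base_measi : measurable_fun setT sigmai ;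
  base_preserving : forall A, measurable A -> P (sigma @^-1` A) = P A ;
  base_ergodic : forall A, measurable A -> sigma @^-1` A = A ->
    P A = 0%E \/ P A = 1%E }.

(* The integral of f exists in [-oo, +oo[ and is negative; f need only be defined
   and measurable up to a null set. *)
Definition integral_lt0 (f : borel Om -> \bar R) : Prop :=
  exists g, [/\ measurable_fun setT g, {ae P, forall w, f w = g w},
    (\int[P]_w (g ^\+ w) < +oo)%E & (\int[P]_w g w < 0)%E].

End base.

(* A normed space given by representatives: the elements of the space are those
   of D, f and g being the same element if nrm (f - g) = 0. *)
Section normed.
Context (R : realType) (X : lmodType R) (D : set X) (nrm : X -> \bar R).
Implicit Types (Y Z : set X) (A : X -> X) (f g : X).

Definition unit_ball Y : set X := [set f | Y f /\ (nrm f <= 1)%E].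

Definition opnorm A : \bar R := ereal_sup [set nrm (A f) | f in unit_ball D].

Definition bounded_operator A : Prop :=
  [/\ (forall f, D f -> D (A f)),
      (forall (a : R) f g, D f -> D g ->
         nrm (A (a *: f + g) - (a *: A f + A g)) = 0%E) &
      (opnorm A < +oo)%E].

Definition icnorm A : \bar R :=
  ereal_inf [set r%:E | r in [set r : R | 0 < r /\
    exists n (c : 'I_n -> X), (forall i, D (c i)) /\
      forall f, unit_ball D f -> exists i, (nrm (A f - c i) < r%:E)%E]].

Definition subspace Y : Prop :=
  [/\ Y `<=` D, Y 0, (forall (a : R) f g, Y f -> Y g -> Y (a *: f + g)) &
      (forall f g, Y f -> D g -> nrm (g - f) = 0%E -> Y g)].

Definition nclosure Y : set X :=
  [set f | D f /\ forall e : R, 0 < e -> exists2 g, Y g & (nrm (f - g) < e%:E)%E].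

Definition direct_sum Y Z : Prop :=
  (forall f, Y f -> Z f -> nrm f = 0%E) /\
  (forall f, D f -> exists y z, [/\ Y y, Z z & nrm (f - (y + z)) = 0%E]).

Definition closed_subspace Y : Prop := subspace Y /\ nclosure Y `<=` Y.

Definition grassmannian Y : Prop :=
  closed_subspace Y /\ exists2 Z, closed_subspace Z & direct_sum Y Z.

Definition has_dim Y (d : nat) : Prop :=
  exists b : 'I_d -> X, [/\ forall i, Y (b i),
    (forall a : 'I_d -> R, nrm (\sum_i a i *: b i) = 0%E -> forall i, a i = 0) &
    (forall f, Y f -> exists a : 'I_d -> R, nrm (f - \sum_i a i *: b i) = 0%E)].

(* The metric of the Grassmannian: Hausdorff distance between unit balls. *)
Definition excess Y Z : \bar R :=
  ereal_sup [set ereal_inf [set nrm (f - g) | g in unit_ball Z]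
            | f in unit_ball Y].

Definition gap Y Z : \bar R := maxe (excess Y Z) (excess Z Y).

(* Lyapunov spectra have length l, where l = None stands for "countably
   infinite"; indices start at 0. *)
Definition below (l : option nat) (j : nat) : Prop :=
  if l is Some n then (j < n)%N else True.

Definition finite_sums l (Y : nat -> set X) : set X :=
  [set f | exists n (y : nat -> X),
     (forall j, (j < n)%N -> below l j /\ Y j (y j)) /\
     f = \sum_(j < n) y j].

Definition independent l (Y : nat -> set X) : Prop :=
  forall n (y : nat -> X), (forall j, (j < n)%N -> below l j /\ Y j (y j)) ->
    nrm (\sum_(j < n) y j) = 0%E -> forall j, (j < n)%N -> nrm (y j) = 0%E.

(* Y_1 (+) ... (+) Y_l, understood as a closed span if l is infinite. *)
Definition sum_spaces l (Y : nat -> set X) : set X :=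
  if l is Some _ then finite_sums l Y else nclosure (finite_sums l Y).

End normed.

Section cocycles.
Context (R : realType) (Om : ptopologicalType) (P : probability (borel Om) R).
Context (X : lmodType R) (D : set X) (nrm : X -> \bar R).
Context (sigma : borel Om -> borel Om) (L : borel Om -> X -> X).

(* cocycle k w = L (sigma^(k-1) w) \o ... \o L w *)
Fixpoint cocycle (k : nat) (w : borel Om) (f : X) : X :=
  if k is k'.+1 then L (iter k' sigma w) (cocycle k' w f) else f.

(* dist w w' is the distance between the values at w and w' of a map defined
   on A; the map is P-continuous if A is a countable union of Borel sets on each
   of which the restriction of the map is continuous. *)
Definition P_continuous_on (A : set (borel Om))
    (dist : borel Om -> borel Om -> \bar R) : Prop :=
  exists E : nat -> set (borel Om), [/\ forall n, measurable (E n),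
    \bigcup_n E n = A &
    forall n (w : Om), E n w -> forall e : R, 0 < e ->
      \forall w' \near within (E n) (nbhs w), (dist w w' < e%:E)%E].

Definition P_continuous_cocycle : Prop :=
  (forall w, bounded_operator D nrm (L w)) /\
  P_continuous_on setT
    (fun w w' => opnorm D nrm (fun f => L w' f - L w f)).

Definition P_continuous_family (Y : borel Om -> set X) : Prop :=
  exists2 A, P (~` A) = 0%E & P_continuous_on A (fun w w' => gap nrm (Y w) (Y w')).

Definition log_rate (u : nat -> \bar R) (k : nat) : \bar R :=
  ((k%:R^-1)%:E * lne (u k))%E.

(* (lam 0, d 0, Y 0) stands for (lambda_1, d_1, Y_1). The splitting meant is the
   one of the multiplicative ergodic theorem, which is P-continuous; without
   such regularity in w the conditions do not determine Y_1 (w). The rate on V is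
   stated with a limsup, as the limit need not exist. *)
Record oseledets_splitting (lstar : R) (kstar : \bar R) (l : option nat)
    (lam : nat -> R) (d : nat -> nat) (Y : nat -> borel Om -> set X)
    (V : borel Om -> set X) : Prop := {
  os_lstar : {ae P, forall w,
    log_rate (fun k => opnorm D nrm (cocycle k w)) @ \oo --> lstar%:E} ;
  os_kstar : {ae P, forall w,
    log_rate (fun k => icnorm D nrm (cocycle k w)) @ \oo --> kstar} ;
  os_length : below l 0 ;
  os_top : lam 0 = lstar ;
  os_decreasing : forall i j, (i < j)%N -> below l j -> lam j < lam i ;
  os_gt_kstar : forall j, below l j -> (kstar < (lam j)%:E)%E ;
  os_finite_dim : {ae P, forall w, forall j, below l j ->
    subspace D nrm (Y j w) /\ has_dim nrm (Y j w) (d j)} ;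
  os_grassmannian : {ae P, forall w, grassmannian D nrm (V w)} ;
  os_independent : {ae P, forall w, independent nrm l (fun j => Y j w)} ;
  os_direct_sum : {ae P, forall w,
    direct_sum D nrm (sum_spaces D nrm l (fun j => Y j w)) (V w)} ;
  os_equivariant : {ae P, forall w, forall j, below l j ->
    (forall y, Y j w y -> Y j (sigma w) (L w y)) /\
    (forall z, Y j (sigma w) z -> exists2 y, Y j w y & nrm (z - L w y) = 0%E)} ;
  os_invariant : {ae P, forall w, forall v, V w v -> V (sigma w) (L w v)} ;
  os_rate : {ae P, forall w, forall j, below l j ->
    forall y, Y j w y -> nrm y <> 0%E ->
      log_rate (fun k => nrm (cocycle k w y)) @ \oo --> (lam j)%:E} ;
  os_rate_slow : {ae P, forall w, forall v, V w v ->
    (limn_esup (log_rate (fun k => nrm (cocycle k w v))) <= kstar)%E} ;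
  os_P_continuousY : forall j, below l j -> P_continuous_family (Y j) ;
  os_P_continuousV : P_continuous_family V }.

End cocycles.

Section saussol.
Context (R : realType) (N : nat) (Om : ptopologicalType).
Context (P : probability (borel Om) R).
Local Notation E := 'rV[R]_N.
Local Notation m := (lebesgue_rV R N).

(* The branches T_{w,i} : V_i -> R^N, for i in an at most countable set. The
   values of br_map w i outside br_V w i are irrelevant. *)
Record branches := Branches {
  br_idx : borel Om -> set nat ;
  br_U : borel Om -> nat -> set E ;
  br_V : borel Om -> nat -> set E ;
  br_map : borel Om -> nat -> E -> E }.

Context (C : set E) (T : borel Om -> E -> E) (B : branches).
Local Notation I := (br_idx B).
Local Notation U := (br_U B).
Local Notation V := (br_V B).
Local Notation Tb := (br_map B).

Definition br_inv (w : borel Om) (i : nat) : E -> E := pinv (V w i) (Tb w i).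

Record branches_wf : Prop := {
  wf_U_open : forall w i, I w i -> open (U w i) ;
  wf_U_sub : forall w i, I w i -> U w i `<=` C ;
  wf_U_disjoint : forall w, trivIset (I w) (U w) ;
  wf_V_open : forall w i, I w i -> open (V w i) ;
  wf_V_closure : forall w i, I w i -> closure (U w i) `<=` V w i }.

Section conditions.
Variables (alpha S : R) (s : borel Om -> R) (e0 : R).

Definition PE1 : Prop :=
  {ae P, forall w, 0 < s w < S /\
    forall i, I w i -> forall u v, (Tb w i @` V w i) u -> (Tb w i @` V w i) v ->
      eucl_dist u v <= e0 ->
      eucl_dist (br_inv w i u) (br_inv w i v) <= s w * eucl_dist u v} /\
  integral_lt0 P (fun w => (ln (s w))%:E).

Definition PE2 : Prop :=
  {ae P, forall w, forall i, I w i ->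
    {in U w i, T w =1 Tb w i} /\
    nbhd_set e0 (Tb w i @` U w i) `<=` Tb w i @` V w i}.

Definition PE3 : Prop :=
  {ae P, forall w, forall i, I w i ->
    [/\ C1_on (V w i) (Tb w i), {in V w i &, injective (Tb w i)} &
        C1_on (Tb w i @` V w i) (br_inv w i)]} /\
  exists2 c : R, 0 < c &
    {ae P, forall w, forall i, I w i -> forall e, 0 < e <= e0 ->
      forall x y z, (Tb w i @` V w i) z ->
        (eucl_ball e z `&` Tb w i @` V w i) x ->
        (eucl_ball e z `&` Tb w i @` V w i) y ->
        `|\det ('J (br_inv w i) x) - \det ('J (br_inv w i) y)|
          <= c * `|\det ('J (br_inv w i) z)| * e `^ alpha}.

Definition PE4 : Prop :=
  {ae P, forall w, m (C `\` \bigcup_(i in I w) U w i) = 0%E}.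

Definition PE5_G (w : borel Om) (e : R) : \bar R :=
  let b x := eucl_ball ((S - s w) * e0) x in
  ereal_sup [set (\esum_(i in I w)
      (m ((V w i `&` Tb w i @^-1` nbhd_set e (boundary (T w @` U w i))) `&` b x)
       / m (b x)))%E
    | x in C].

Definition PE5_zeta (w : borel Om) : \bar R :=
  ((s w `^ alpha)%:E +
   2%:E * ereal_sup [set PE5_G w e * (e `^ (- alpha))%:E
                    | e in [set e : R | (0 < e <= e0)%R]]
   * ((S * e0) `^ alpha)%:E)%E.

Definition PE5 : Prop := integral_lt0 P (fun w => lne (PE5_zeta w)).

End conditions.

Record random_saussol (alpha S : R) (s : borel Om -> R) : Prop := {
  rs_maps : forall w, T w @` C `<=` C ;
  rs_branches : branches_wf ;
  rs_alpha : 0 < alpha <= 1 ;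
  rs_S : 0 < S ;
  rs_small : exists2 e1 : R, 0 < e1 & forall e0, 0 < e0 < e1 ->
    [/\ PE1 S s e0, PE2 e0, PE3 alpha e0, PE4 & PE5 alpha S s e0] }.

(* For f in L^1 the series converges absolutely at almost every x, so the order
   of summation is irrelevant. *)
Definition transfer (w : borel Om) (f : E -> R) : E -> R := fun x =>
  limn (fun n => \sum_(0 <= i < n | `[< I w i >])
    (let y := br_inv w i x in
     f y / `|\det ('J (T w) y)| * \1_(T w @` U w i) x)).

(* Measures on Om * C are represented by measures on Om * R^N
   that give no mass to the complement of Om * C. *)
Definition skew_map (sigma : borel Om -> borel Om) (p : borel Om * E) : borel Om * E :=
  (sigma p.1, T p.1 p.2).

Definition skew_acip (sigma : borel Om -> borel Om)
    (mu : probability (borel Om * E)%type R) : Prop :=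
  (forall A, measurable A ->
    mu ((setT `*` C) `&` skew_map sigma @^-1` A) = mu A) /\
  exists k : R.-pker (borel Om) ~> E,
    (forall w, k w C = 1%E /\ k w `<< m) /\
    (forall A, measurable A -> mu A = \int[P]_w k w (xsection A w))%E.

Definition skew_ergodic (sigma : borel Om -> borel Om)
    (mu : probability (borel Om * E)%type R) : Prop :=
  forall A, measurable A -> A `<=` setT `*` C ->
    (setT `*` C) `&` skew_map sigma @^-1` A = A -> mu A = 0%E \/ mu A = 1%E.

End saussol.

(* Main.v *)
Require Import Defs.
From HB Require Import structures.
From mathcomp Require Import all_boot all_order all_algebra.
From mathcomp Require Import all_classical all_reals all_analysis.
From mathcomp Require Import measurable_realfun.
From mathcomp Require Import perm lra zify.

Set Implicit Arguments.
Unset Strict Implicit.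
Unset Printing Implicit Defensive.

Import Order.TTheory GRing.Theory Num.Theory.
Import numFieldNormedType.Exports.

Local Open Scope classical_set_scope.
Local Open Scope ring_scope.

(* Duality: for a.e. w and every f in V_alpha, the integral of L_w f over D is
   the integral of f over the preimage of D under T_w. Hence all the integrals
   of the iterates of f are integrals of f itself over the sets pulled back by
   the skew product; they are bounded by the norm of f, so the part of f in
   Y_2 + ... + V contributes 0 in the limit, its exponents being negative.

   Bound on r: distinct ergodic measures are carried by disjoint invariant sets
   A_i, obtained from Hahn decompositions. By invariance of A_i the functional
   "integral over the fiber (A_i)_w" vanishes on Y_2 + ... + V, so if r > dim Y_1
   some combination of the r functionals vanishes on V_alpha. As V_alpha contains
   the Lipschitz functions on C, this is a relation between the indicators of
   the fibers that holds a.e., which the i-th measure turns into c_i = 0.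

   h_w in Y_1(w): for finitely many cubes, let e_k(w) be the distance from the
   vector of integrals of the k-th term of the average at w to the vectors coming
   from Y_1(w). It is measurable because Y_1 is P-continuous, and composed with
   sigma^k it tends to 0 pointwise, so its integral tends to 0; then so do the
   integrals of the Cesaro means of the e_k, and these means bound the distance
   for h_w. As the cubes separate functions and Y_1(w) has finite dimension, h_w
   is in Y_1(w). *)

(** * Lebesgue measure and dyadic cubes *)

(** The obstacle is that the estimates known at w run forward: the parts outside Y_1 decay along the
    orbit that starts at w, without uniformity in w, whereas the averages defining h_w start at
    sigma^-k w. Shifting time by the P-preserving sigma trades this for convergence in mean, which
    requires measurability in w. Therefore functions are seen only through integrals over sets:
    those of the iterates of 1 are volumes of fibers of pulled-back sets, measurable by Fubini,
    whereas the norm involves integrals of oscillations whose measurability is never established.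
    The same functionals cope with an infinite splitting: an element of the closed span is replaced
    by a finite sum, and the error stays small after any number of pull-backs. Duality rests on the
    change of variables for C^1 diffeomorphisms in dimension N: uniqueness of translation invariant
    measures and a matrix factorization settle linear maps, and dyadic cubes carry this over to
    nonlinear ones. *)

Section boxes.
Context (R : realType).

Lemma measurable_coord_rV n (i : 'I_n) :
  measurable_fun setT (fun v : 'rV[R]_n => v ord0 i : measurableTypeR R).
Proof.
apply: (measurability _ (RGenOpens.measurableE R)) => //.
move=> _ [_ [x [y ->]] <-]; rewrite setTI.
by apply: (measurable_coord i); exact: interval_open.
Qed.

Definition rbox n (A : 'I_n -> set R) : set 'rV[R]_n :=
  [set v | forall i, A i (v ord0 i)].

Lemma measurable_rbox n (A : 'I_n -> set (measurableTypeR R)) :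
  (forall i, measurable (A i)) -> measurable (rbox A).
Proof.
move=> mA; have -> : rbox A = \bigcap_(i in [set: 'I_n])
    ([set: 'rV[R]_n] `&` (fun v => v ord0 i : measurableTypeR R) @^-1` A i).
  by apply/seteqP; split=> v /= Av i; [|have [] := Av i I].
apply: fin_bigcap_measurable => // i _; exact: measurable_coord_rV.
Qed.

Lemma lebesgue_rV_rbox n (A : 'I_n -> set (measurableTypeR R)) :
  (forall i, measurable (A i)) ->
  lebesgue_rV R n (rbox A) = (\prod_(i < n) lebesgue_measure (A i))%E.
Proof.
elim: n A => [|n IH] A mA.
  rewrite big_ord0 /= diracE (_ : _ \in _ = true) //.
  by apply/mem_set => -[].
rewrite big_ord_recl -IH; last by move=> i; exact: mA.
rewrite -product_measure1E//; last exact: measurable_rbox.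
rewrite /= /lebesgue_rVS /pushforward; congr (_ _).
apply/seteqP; split=> -[x v] /=.
  move=> Av; split=> [|i] /=.
    by have := Av ord0; rewrite /cons_rV mxE unlift_none.
  by have := Av (lift ord0 i); rewrite /cons_rV mxE liftK.
move=> [/= A0 Av] i; rewrite /cons_rV mxE.
by case: unliftP => [j ->|->] //=; exact: Av.
Qed.

Definition dcube n (l : nat) (k : 'rV[int]_n) : set 'rV[R]_n :=
  [set v | forall i, Num.floor (2 ^+ l * v ord0 i) = k ord0 i].

Lemma dcubeE n l (k : 'rV[int]_n) : dcube l k =
  rbox (fun i => [set` `[(k ord0 i)%:~R / 2 ^+ l,
                        (k ord0 i + 1)%:~R / 2 ^+ l[%R]).
Proof.
have l0 : 0 < 2 ^+ l :> R by exact: exprn_gt0.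
apply/seteqP; split => v kv i; have := kv i => /=; rewrite in_itv/=
  ler_pdivrMr// ltr_pdivlMr// mulrC -floor_eq ; first by move=> ->.
by move/eqP.
Qed.

Lemma measurable_dcube n l (k : 'rV[int]_n) : measurable (dcube l k).
Proof. by rewrite dcubeE; apply: measurable_rbox => i; exact: measurable_itv. Qed.

Lemma lebesgue_rV_box n (a b : 'I_n -> R) : (forall i, a i <= b i) ->
  lebesgue_rV R n (rbox (fun i => [set` `[a i, b i[%R])) =
  (\prod_(i < n) (b i - a i))%:E.
Proof.
move=> ab; rewrite lebesgue_rV_rbox; last by move=> i; exact: measurable_itv.
rewrite -prodEFin; apply: eq_bigr => i _; rewrite lebesgue_measure_itv/= lte_fin.
by case: ltP => [//|ba]; rewrite (@le_anti _ _ (a i) (b i)) ?subrr ?ab.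
Qed.

Lemma lebesgue_dcube n l (k : 'rV[int]_n) :
  lebesgue_rV R n (dcube l k) = ((2 ^- l) ^+ n)%:E.
Proof.
have l0 : 0 < 2 ^+ l :> R by exact: exprn_gt0.
rewrite dcubeE lebesgue_rV_box => [|i].
  under eq_bigr do rewrite -mulrBl -intrB addrAC subrr add0r mul1r.
  by rewrite prodr_const card_ord.
by rewrite ler_pM2r ?invr_gt0// ler_int lerDl.
Qed.

Definition dcube_idx n l (v : 'rV[R]_n) : 'rV[int]_n :=
  \row_i Num.floor (2 ^+ l * v ord0 i).

Lemma dcube_idxP n l (v : 'rV[R]_n) : dcube l (dcube_idx l v) v.
Proof. by move=> i; rewrite mxE. Qed.

Lemma dcube_eq n l k (v : 'rV[R]_n) : dcube l k v -> k = dcube_idx l v.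
Proof. by move=> kv; apply/rowP => i; rewrite mxE kv. Qed.

(** Index, one level finer, of the child of cube k that is the upper half in the coordinates where b
    is true and the lower half in the others. *)
Definition halfidx n (k : 'rV[int]_n) (b : {ffun 'I_n -> bool}) : 'rV[int]_n :=
  \row_i (k ord0 i * 2 + (b i)%:Z).

Lemma floor_half (x : R) : exists b : bool,
  Num.floor (2 * x) = Num.floor x * 2 + b%:Z.
Proof.
have /andP[x1 x2] := floor_itv x.
have e1 : (1 : int)%:~R = 1 :> R by [].
rewrite intrD e1 in x2.
exists ((Num.floor x)%:~R + 1 <= 2 * x - (Num.floor x)%:~R); apply: floor_def.
rewrite !intrD intrM e1 (_ : 2%:~R = 2 :> R)//.
case: (leP ((Num.floor x)%:~R + 1) (2 * x - (Num.floor x)%:~R)) => h.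
  by rewrite (_ : (Posz true)%:~R = 1 :> R)//; apply/andP; split; lra.
by rewrite (_ : (Posz false)%:~R = 0 :> R)//; apply/andP; split; lra.
Qed.

Lemma dcube_split n l (k : 'rV[int]_n) :
  dcube l k = \bigcup_(b in [set: {ffun 'I_n -> bool}]) dcube l.+1 (halfidx k b).
Proof.
apply/seteqP; split=> [v kv|v [b _ kv] i].
  have [b Hb] := choice (fun i : 'I_n => floor_half (2 ^+ l * v ord0 i)).
  by exists [ffun i => b i] => // i; rewrite mxE ffunE exprS -mulrA Hb kv.
have [c hc] := floor_half (2 ^+ l * v ord0 i).
have := kv i; rewrite mxE exprS -mulrA hc.
by move: (Num.floor _) (k ord0 i) => p q; case: (b i); case: c {hc} => /=; lia.
Qed.

Lemma trivIset_halfidx n l (k : 'rV[int]_n) :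
  trivIset [set: {ffun 'I_n -> bool}] (fun b => dcube l.+1 (halfidx k b)).
Proof.
move=> b c _ _ [v [bv cv]]; apply/ffunP => i; have := bv i; rewrite cv !mxE.
by case: (b i) (c i) => -[]/=; lia.
Qed.

(** The levels are linked by refining one step at a time, each time through the cube that contains
    the common point v. *)
Lemma dcube_nested n l l' k k' : (l <= l')%N -> 
  dcube l' k' `&` @dcube n l k !=set0 -> dcube l' k' `<=` dcube l k.
Proof.
move=> /subnKC <-; move: (l' - l)%N => d {l'} [v []].
elim: d k' => [|d IH] k'.
  by rewrite addn0 => /dcube_eq -> /dcube_eq ->.
rewrite addnS => k'v kv; set k1 := dcube_idx (l + d) v.
apply: subset_trans (IH k1 (dcube_idxP _ _) kv).
have : dcube (l + d) k1 v := dcube_idxP _ _.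
rewrite dcube_split => -[b _ bv].
by rewrite (dcube_eq k'v) -(dcube_eq bv); exact: (@bigcup_sup _ _ b).
Qed.

(** The empty set is added to make the family closed under intersections: two cubes are nested or
    disjoint. *)
Definition dcubes n : set (set 'rV[R]_n) :=
  [set A | A = set0 \/ exists l k, A = dcube l k].

Lemma dcubes_setI n : setI_closed (@dcubes n).
Proof.
move=> A B [->|[l [k ->]]]; first by left; rewrite set0I.
move=> [->|[l' [k' ->]]]; first by left; rewrite setI0.
have [->|/set0P h] := eqVneq (dcube l k `&` dcube l' k') set0; first by left.
right; have [ll'|ll'] := leqP l l'.
  exists l', k'; apply/setIidPr; apply: dcube_nested => //.
  by rewrite setIC.
by exists l, k; apply/setIidPl; apply: dcube_nested => //; exact: ltnW.
Qed.

Lemma dcube_small n (U : set 'rV[R]_n) (v : 'rV[R]_n) : nbhs v U ->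
  exists l, forall k : 'rV[int]_n,
   (forall i, `|v ord0 i * 2 ^+ l - (k ord0 i)%:~R| <= 1) ->
   forall w : 'rV[R]_n, (forall i, `|w ord0 i * 2 ^+ l - (k ord0 i)%:~R| <= 1) -> U w.
Proof.
move=> /nbhs_ballP[e /= e0 eU].
(* v and w are both within one side of the corner k / 2^l, hence the factor 2. *)
have [l le] : exists l, 2 ^- l * 2 < e.
  exists (Num.bound (2 / e)); have l0 : 0 < 2 ^+ (Num.bound (2 / e)) :> R by exact: exprn_gt0.
  rewrite mulrC ltr_pdivrMr//.
  have : 2 / e < (Num.bound (2 / e))%:R by apply: archi_boundP; rewrite ltW// divr_gt0.
  have : (Num.bound (2 / e))%:R < 2 ^+ (Num.bound (2 / e)) :> R.
    by rewrite -natrX ltr_nat ltn_expl.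
  by move=> h1 h2; have := lt_trans h2 h1; rewrite ltr_pdivrMr// mulrC.
exists l => k vk w wk; apply: eU; split => // i j; rewrite ord1 /ball/=.
have l0 : 0 < 2 ^+ l :> R by exact: exprn_gt0.
apply: le_lt_trans le; rewrite mulrC ler_pdivlMr// -{1}(gtr0_norm l0) -normrM mulrBl.
have := vk j; have := wk j; rewrite !ler_norml => /andP[? ?] /andP[? ?].
by apply/andP; split; lra.
Qed.

Lemma dcube_mem n l k (v : 'rV[R]_n) : dcube l k v ->
  forall i, `|v ord0 i * 2 ^+ l - (k ord0 i)%:~R| <= 1.
Proof.
move=> kv i; have /andP[v1] := floor_itv (2 ^+ l * v ord0 i).
rewrite kv in v1 *; rewrite intrD ler_norml => v2.
by apply/andP; split; lra.
Qed.

(** An open set is the union of the dyadic cubes inside it, and these are countably many. *)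
Lemma measurable_dcubes n :
  @measurable _ 'rV[R]_n = <<s @dcubes n >>.
Proof.
apply/seteqP; split; last first.
  apply: smallest_sub; first exact: sigma_algebra_measurable.
  by move=> _ [->|[l [k ->]]]; [exact: measurable0|exact: measurable_dcube].
apply: smallest_sub; first exact: smallest_sigma_algebra.
move=> U oU; pose F (x : nat * 'rV[int]_n) :=
  if pselect (dcube x.1 x.2 `<=` U) then dcube x.1 x.2 else set0.
have -> : U = \bigcup_x F x.
  apply/seteqP; split=> [v Uv|v [[l k] _]]; last first.
    by rewrite /F/=; case: pselect => // h /h.
  have [l Hl] := dcube_small (open_nbhs_nbhs (conj oU Uv)).
  exists (l, dcube_idx l v) => //; rewrite /F/=; case: pselect => [s|h].
    exact: dcube_idxP.
  case: h.
  move=> w /dcube_mem wl; apply: Hl wl; exact: dcube_mem (dcube_idxP _ _).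
pose GT : measurableType (sigma_display (@dcubes n)) := g_sigma_algebraType (@dcubes n).
apply: (@countable_bigcupT_measurable _ GT) => [|x]; first exact: countableP.
rewrite /F; case: pselect => h; last exact: (@measurable0 _ GT).
by apply: sub_sigma_algebra; right; exists x.1, x.2.
Qed.

Lemma dcubes_cover n l : exists g : nat -> set 'rV[R]_n,
  (forall i, dcubes (g i)) /\ (forall i, g i = set0 \/ exists k, g i = dcube l k) /\
  \bigcup_i g i = setT.
Proof.
exists (fun i => if unpickle i is Some k then dcube l k else set0).
split=> [i|]; last split=> [i|].
- by case: unpickle => [k|]; [right; exists l, k|left].
- by case: unpickle => [k|]; [right; exists k|left].
- apply/seteqP; split=> // v _; exists (pickle (dcube_idx l v)) => //.
  by rewrite pickleK; exact: dcube_idxP.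
Qed.

(** Uniqueness of measures on a pi-system: the cubes are stable under intersection, and those of
    level 0 cover the space with finite measure. *)
Lemma eq_measure_dcube n (m1 m2 : {measure set 'rV[R]_n -> \bar R}) :
  (forall l k, m1 (dcube l k) = m2 (dcube l k)) ->
  (forall k, m1 (dcube 0 k) < +oo)%E ->
  forall A, measurable A -> m1 A = m2 A.
Proof.
move=> m12 m1oo; have [g [Gg [g0 gT]]] := dcubes_cover n 0.
apply: (measure_unique (@dcubes n) g) => //.
- exact: measurable_dcubes.
- exact: dcubes_setI.
- by move=> A [->|[l [k ->]]]; rewrite ?measure0.
- by move=> i; case: (g0 i) => [->|[k ->]]; rewrite ?measure0.
Qed.

End boxes.

(** The instance depends on the proof [mf], so it is applied by hand to obtain a bundled measure. *)
Definition pushforward_measure d1 d2 (T1 : measurableType d1)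
    (T2 : measurableType d2) (R : realType) (m : {measure set T1 -> \bar R})
    (f : T1 -> T2) (mf : measurable_fun setT f) : {measure set T2 -> \bar R} :=
  measure_function_pushforward__canonical__measure_function_Measure m mf.

(** * Lebesgue measure under translations and linear maps *)

Section linear_change.
Context (R : realType).
Local Notation m := (lebesgue_rV R).

Lemma measurable_fun_rV d (T : measurableType d) n (D : set T)
    (f : T -> 'rV[R]_n) : measurable D ->
  (forall i, measurable_fun D (fun x => f x ord0 i : measurableTypeR R)) ->
  measurable_fun D f.
Proof.
move=> mD mf; apply: (measurability (@dcubes R n)).
  exact: measurable_dcubes.
move=> _ [_ [->|[l [k ->]]] <-]; first by rewrite preimage_set0 setI0.
have -> : D `&` f @^-1` dcube l k = D `&` \bigcap_(i in [set: 'I_n])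
    (D `&` (fun x => f x ord0 i : measurableTypeR R) @^-1`
      [set` `[(k ord0 i)%:~R / 2 ^+ l, (k ord0 i + 1)%:~R / 2 ^+ l[%R]).
  rewrite dcubeE; apply/seteqP; split=> x /= [Dx fx]; split => // i.
    by move=> _; split => //; exact: fx.
  by have [] := fx i I.
apply: measurableI => //; apply: fin_bigcap_measurable => // i _.
by apply: mf => //; exact: measurable_itv.
Qed.

Lemma measurable_translate n (t : 'rV[R]_n) :
  measurable_fun setT (fun v : 'rV[R]_n => v + t).
Proof.
apply: measurable_fun_rV => // i; under eq_fun do rewrite mxE.
by apply: measurable_funD => //; exact: measurable_coord_rV.
Qed.

Lemma measurable_mulmxr n p (M : 'M[R]_(n, p)) :
  measurable_fun setT (fun v : 'rV[R]_n => v *m M).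
Proof.
apply: measurable_fun_rV => // i; under eq_fun do rewrite mxE.
apply: measurable_sum => j; apply: measurable_funM => //.
exact: measurable_coord_rV.
Qed.

Lemma lebesgue_dcube_translate n (t : 'rV[R]_n) l k :
  m n ((fun v => v + t) @^-1` dcube l k) = m n (dcube l k).
Proof.
rewrite dcubeE; pose a (i : 'I_n) : R := (k ord0 i)%:~R / 2 ^+ l.
pose b (i : 'I_n) : R := (k ord0 i + 1)%:~R / 2 ^+ l.
rewrite -[rbox _]/(rbox (fun i => [set` `[a i, b i[%R])).
have ab i : a i <= b i.
  by rewrite /a /b ler_pM2r ?invr_gt0 ?exprn_gt0// ler_int lerDl.
have -> : (fun v => v + t) @^-1` rbox (fun i => [set` `[a i, b i[%R]) =
    rbox (fun i => [set` `[a i - t ord0 i, b i - t ord0 i[%R]).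
  apply/seteqP; split=> v /= vab i; have := vab i;
    by rewrite /= !in_itv/= mxE lerBlDr ltrBrDr.
rewrite !lebesgue_rV_box// => [|i]; last by rewrite lerD2r.
by congr EFin; apply: eq_bigr => i _; rewrite opprD opprK addrACA addNr addr0.
Qed.

Lemma lebesgue_rV_translate n (t : 'rV[R]_n) A : measurable A ->
  m n ((fun v => v + t) @^-1` A) = m n A.
Proof.
move: A; apply: (@eq_measure_dcube R n
  (pushforward_measure (m n) (@measurable_translate n t)) (m n)) => [l k|k].
  exact: lebesgue_dcube_translate.
rewrite /= /pushforward lebesgue_dcube_translate lebesgue_dcube.
exact: ltry.
Qed.

Lemma dcube_translate n l (k k' : 'rV[int]_n) : @dcube R n l k =
  (fun v => v + \row_i ((k' ord0 i - k ord0 i)%:~R / 2 ^+ l)) @^-1` dcube l k'.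
Proof.
have l0 : 2 ^+ l != 0 :> R by rewrite expf_neq0.
have E (v : 'rV[R]_n) i : Num.floor (2 ^+ l *
    (v + \row_i ((k' ord0 i - k ord0 i)%:~R / 2 ^+ l)) ord0 i) =
    Num.floor (2 ^+ l * v ord0 i) + (k' ord0 i - k ord0 i).
  rewrite !mxE mulrDr mulrC -[in X in _ + X]mulrC mulfVK// mulrC addrC.
  by rewrite floorDzr ?intr_int// intrKfloor addrC.
apply/seteqP; split=> v kv i; have := kv i; rewrite E.
  by move=> ->; rewrite addrC subrK.
by move=> /(canRL (addrK _)) ->; rewrite opprB addrC subrK.
Qed.

Lemma measure_dcube_split n (mu : {measure set 'rV[R]_n -> \bar R}) l k :
  mu (dcube l k) =
  (\sum_(b : {ffun 'I_n -> bool}) mu (dcube l.+1 (halfidx k b)))%E.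
Proof.
rewrite dcube_split measure_fin_bigcup//=.
- rewrite fsbig_finite//= -big_enum/=; apply: perm_big; apply: uniq_perm => //.
  + exact: finmap.fset_uniq.
  + exact: enum_uniq.
  + move=> b; apply/idP/idP => _; first by rewrite mem_enum.
    by rewrite in_fset_set; [exact: mem_set|exact: finite_finset].
- exact: trivIset_halfidx.
- by move=> b _; exact: measurable_dcube.
Qed.

(** Cubes of one level are translates of each other and so have equal mass; each of the 2^n children
    thus carries the 2^n-th part of its parent, and cubes determine the measure. *)
Lemma translation_invariant_measure n (mu : {measure set 'rV[R]_n -> \bar R})
    (c : {nonneg R}) :
  (forall (t : 'rV[R]_n) A, measurable A ->
    mu ((fun v : 'rV[R]_n => v + t) @^-1` A) = mu A) ->
  mu (dcube 0 0) = (c%:num)%:E ->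
  forall A, measurable A -> mu A = ((c%:num)%:E * m n A)%E.
Proof.
move=> mut mu1.
have mueq l k k' : mu (dcube l k) = mu (dcube l k').
  by rewrite (dcube_translate _ k k') mut//; exact: measurable_dcube.
have muE l : forall k, mu (dcube l k) = (c%:num * (2 ^- l) ^+ n)%:E.
  elim: l => [|l IH] k.
    by rewrite expr0 invr1 expr1n mulr1 (mueq _ _ 0).
  (* Finiteness allows the relation between the masses of parent and children to be solved in R. *)
  have mufin : mu (dcube l.+1 k) \is a fin_num.
    rewrite ge0_fin_numE// (@le_lt_trans _ _ (mu (dcube l 0)))//; last by rewrite IH ltry.
    rewrite (mueq _ _ (halfidx 0 [ffun=> false])) le_measure ?inE//;
      [exact: measurable_dcube|exact: measurable_dcube|].
    by rewrite (@dcube_split R n l); exact: (@bigcup_sup _ _ [ffun=> false]).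
  have := IH 0; rewrite measure_dcube_split.
  under eq_bigr do rewrite (mueq _ _ k).
  rewrite -(fineK mufin).
  rewrite sumEFin sumr_const card_ffun card_bool card_ord => -[] /= h; congr EFin.
  have n0 : (2 ^ n)%:R != 0 :> R by rewrite pnatr_eq0 expn_eq0.
  apply: (mulfI n0); rewrite mulr_natl h mulrCA; congr (_ * _).
  by rewrite exprSr invfM exprMn natrX mulrCA -exprMn mulfV// expr1n mulr1.
move: mu mut mu1 mueq muE => mu _ _ _ muE.
apply: (@eq_measure_dcube R n mu (mscale c (m n))) => [l k|k].
  by rewrite muE /= /mscale /= lebesgue_dcube.
by rewrite muE ltry.
Qed.

(** The factor by which preimages under an invertible M scale volume, read off from the unit cube;
    [dilat_det] identifies it as the inverse of |det M|. *)
Definition dilat n (M : 'M[R]_n) : R :=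
  fine (m n ((fun v => v *m M) @^-1` dcube 0 0)).

Lemma dilat_ge0 n (M : 'M[R]_n) : 0 <= dilat M.
Proof. by rewrite /dilat fine_ge0. Qed.

Lemma dcube00 n (v : 'rV[R]_n) :
  dcube 0 0 v <-> forall i, 0 <= v ord0 i < 1.
Proof.
split=> h i; have := h i; rewrite expr0 mul1r mxE.
  by move=> /eqP; rewrite floor_eq addrC addr0.
by move=> ?; apply/eqP; rewrite floor_eq addrC addr0.
Qed.

Lemma measurable_preimage_mulmxr n p (M : 'M[R]_(n, p)) A : measurable A ->
  measurable ((fun v => v *m M) @^-1` A).
Proof. by move=> mA; rewrite -[X in measurable X]setTI; exact: measurable_mulmxr. Qed.

(** Translating by t pulls back under M to translating by t M^-1, so the pushforward of Lebesgue
    measure by M is again translation invariant. *)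
Lemma dilatE n (M : 'M[R]_n) A : M \in unitmx -> measurable A ->
  m n ((fun v => v *m M) @^-1` A) = ((dilat M)%:E * m n A)%E.
Proof.
move=> Mu; move: A.
apply: (@translation_invariant_measure n
  (pushforward_measure (m n) (@measurable_mulmxr n n M)) (NngNum (dilat_ge0 M))).
  move=> t A mA; rewrite /= /pushforward.
  rewrite -[RHS](lebesgue_rV_translate (t *m invmx M)).
    congr (m n _); apply/funext => v /=.
    by rewrite mulmxDl mulmxKV.
  exact: measurable_preimage_mulmxr.
rewrite /= /pushforward /dilat fineK// ge0_fin_numE//.
(* Recovering v from v M in the unit cube through M^-1 bounds its coordinates by K, so the preimage
   lies in a bounded box. *)
pose K : R := \sum_i \sum_j `|invmx M i j|.
have K0 : 0 <= K by apply: sumr_ge0 => i _; apply: sumr_ge0.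
apply: (@le_lt_trans _ _ (m n (rbox (fun i => [set` `[- K, K + 1[%R])))).
  apply: le_measure; rewrite ?inE.
  - by apply: measurable_preimage_mulmxr; exact: measurable_dcube.
  - by apply: measurable_rbox => i; exact: measurable_itv.
  move=> v /= /dcube00 vM i; rewrite /= in_itv/=.
  have : `|v ord0 i| <= K.
    rewrite -(mulmxK Mu v) mxE (le_trans (ler_norm_sum _ _ _))//.
    apply: ler_sum => j _; rewrite normrM.
    have /andP[v0 v1] := vM j.
    rewrite (@le_trans _ _ `|invmx M j i|)//.
      by rewrite ler_piMl// ger0_norm// ltW.
    by rewrite (bigD1 i)//= lerDl sumr_ge0.
  by rewrite ler_norml => /andP[? ?]; apply/andP; split; lra.
by rewrite lebesgue_rV_box ?ltry// => i; lra.
Qed.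

Lemma dilat_fin n (M : 'M[R]_n) : M \in unitmx ->
  m n ((fun v => v *m M) @^-1` dcube 0 0) = (dilat M)%:E.
Proof.
move=> Mu; rewrite dilatE//; last exact: measurable_dcube.
by rewrite lebesgue_dcube expr0 invr1 expr1n mule1.
Qed.

Lemma dilatM n (M M' : 'M[R]_n) : M \in unitmx -> M' \in unitmx ->
  dilat (M *m M') = dilat M * dilat M'.
Proof.
move=> Mu M'u; rewrite {1}/dilat.
have -> : (fun v => v *m (M *m M')) @^-1` (@dcube R n 0 0) =
    (fun v => v *m M) @^-1` ((fun v => v *m M') @^-1` dcube 0 0).
  by apply/funext => v /=; rewrite mulmxA.
rewrite dilatE//; last by apply: measurable_preimage_mulmxr; exact: measurable_dcube.
by rewrite dilat_fin.
Qed.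

Lemma dilat1 n : dilat (1%:M : 'M[R]_n) = 1.
Proof.
rewrite /dilat (_ : _ @^-1` _ = dcube 0 0).
  by rewrite lebesgue_dcube expr0 invr1 expr1n.
by apply/funext => v /=; rewrite mulmx1.
Qed.

Lemma dilatV n (M : 'M[R]_n) : M \in unitmx -> dilat M * dilat (invmx M) = 1.
Proof. by move=> Mu; rewrite -dilatM ?unitmx_inv// mulmxV// dilat1. Qed.

Lemma dilat_gt0 n (M : 'M[R]_n) : M \in unitmx -> 0 < dilat M.
Proof.
move=> Mu; rewrite lt_neqAle dilat_ge0 andbT eq_sym; apply/eqP => M0.
by have := dilatV Mu; rewrite M0 mul0r => /esym/eqP; rewrite oner_eq0.
Qed.

Lemma dilat_perm n (s : 'S_n) : dilat (perm_mx s) = 1 :> R.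
Proof.
rewrite /dilat (_ : _ @^-1` _ = dcube 0 0).
  by rewrite lebesgue_dcube expr0 invr1 expr1n.
have E (v : 'rV[R]_n) i : (v *m perm_mx s) ord0 i = v ord0 (s^-1%g i).
  by have := col_permE s^-1%g v; rewrite invgK => <-; rewrite mxE.
apply/funext => v; apply/propext; rewrite /preimage /=; split=> /dcube00 h; apply/dcube00 => i.
  by have := h (s i); rewrite E permK.
by rewrite E.
Qed.

Lemma dilat_diag n (d : 'rV[R]_n) : (forall i, d ord0 i != 0) ->
  dilat (diag_mx d) = \prod_i `|d ord0 i|^-1.
Proof.
move=> d0; rewrite /dilat.
(* A negative entry reverses the interval, so the closed end becomes the right one. *)
pose A i : set R := if 0 < d ord0 i then [set` `[0, (d ord0 i)^-1[%R]
                    else [set` `](d ord0 i)^-1, 0]%R].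
have -> : (fun v => v *m diag_mx d) @^-1` dcube 0 0 = rbox A.
  have P (x : R) i : 0 <= x * d ord0 i < 1 <-> A i x.
    rewrite /A; case: ifPn => [di|]; rewrite /= in_itv/=.
      by rewrite pmulr_lge0// -ltr_pdivlMr// mul1r.
    move=> dn; have di : d ord0 i < 0 by rewrite lt_neqAle d0 leNgt.
    by rewrite nmulr_lge0// -ltr_ndivrMr// mul1r andbC.
  have E (v : 'rV[R]_n) i : (v *m diag_mx d) ord0 i = v ord0 i * d ord0 i.
    by rewrite mul_mx_diag mxE.
  apply/funext => v; apply/propext; split.
    by move=> /dcube00 h i; have := h i; rewrite E => /P.
  by move=> h; apply/dcube00 => i; rewrite E; apply/P/h.
rewrite lebesgue_rV_rbox; last by move=> i; rewrite /A; case: ifP => _; exact: measurable_itv.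
rewrite (eq_bigr (fun i => (`|d ord0 i|^-1)%:E)) ?prodEFin// => i _.
rewrite /A; case: ifPn => [di|].
  by rewrite lebesgue_measure_itv/= lte_fin invr_gt0 di gtr0_norm// sube0.
move=> dn; have di : d ord0 i < 0 by rewrite lt_neqAle d0 leNgt.
by rewrite lebesgue_measure_itv/= lte_fin invr_lt0 di ltr0_norm// add0e invrN.
Qed.

(** The convex function (1 + y)^n lies below its chord on [0, 1], whose slope is 2^n - 1. *)
Lemma ler_bernoulli n (y : R) : 0 <= y <= 1 -> (1 + y) ^+ n <= 1 + 2 ^+ n * y.
Proof.
move=> /andP[y0 y1].
suff : (1 + y) ^+ n <= 1 + (2 ^+ n - 1) * y by move=> /le_trans; apply; lra.
elim: n => [|n IH]; first by rewrite !expr0; lra.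
rewrite exprS (le_trans (ler_wpM2l _ IH))//; first by lra.
have p1 : 1 <= 2 ^+ n :> R by rewrite exprn_ege1// ler1n.
rewrite exprS; set p := 2 ^+ n in p1 *.
have : (p - 1) * (y * y) <= (p - 1) * y.
  by rewrite ler_wpM2l ?subr_ge0//; nra.
by lra.
Qed.

Definition near1mx n (e : R) (M : 'M[R]_n) :=
  forall i j, `|M i j - (i == j)%:R| <= e.

Lemma near1mx_mul n e (M : 'M[R]_n) (v : 'rV[R]_n) (K : R) : near1mx e M ->
  (forall i, `|v ord0 i| <= K) ->
  forall i, `|(v *m M) ord0 i - v ord0 i| <= n%:R * (K * e).
Proof.
move=> Me vK i.
have -> : (v *m M) ord0 i - v ord0 i = (v *m (M - 1%:M)) ord0 i.
  by rewrite mulmxBr mulmx1 !mxE.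
rewrite mxE (le_trans (ler_norm_sum _ _ _))//.
rewrite (@le_trans _ _ (\sum_(j < n) K * e))//; last first.
  by rewrite sumr_const card_ord mulr_natl.
apply: ler_sum => j _; rewrite normrM ler_pM//.
by rewrite !mxE; exact: Me.
Qed.

Lemma rowmax n (v : 'rV[R]_n) : exists K : R, [/\ 0 <= K,
  forall i, `|v ord0 i| <= K & K = 0 \/ exists i, `|v ord0 i| = K].
Proof.
case: n v => [|n] v; first by exists 0; split=> //; [case|left].
have [i _ Hi] := @arg_maxP _ _ _ ord0 xpredT (fun i => `|v ord0 i|) isT.
by exists `|v ord0 i|; split=> // [j|]; [exact: Hi|right; exists i].
Qed.

(** The points that M or its inverse sends into the unit cube are moved by at most d, so they lie in
    the cube enlarged by d on every side. *)
Lemma dilat_near1mx n e (M : 'M[R]_n) : 0 <= e -> n%:R * e <= 8^-1 ->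
  M \in unitmx -> near1mx e M ->
  dilat M <= 1 + 2 ^+ n * (4 * (n%:R * e)) /\
  dilat (invmx M) <= 1 + 2 ^+ n * (4 * (n%:R * e)).
Proof.
move=> e0 ne Mu Me; set d := 2 * (n%:R * e).
have ne0 : 0 <= n%:R * e by rewrite mulr_ge0.
suff key (M' : 'M[R]_n) : M' \in unitmx ->
    (forall v : 'rV[R]_n, dcube 0 0 (v *m M') ->
      forall i, `|(v *m M') ord0 i - v ord0 i| <= d) ->
    dilat M' <= 1 + 2 ^+ n * (4 * (n%:R * e)).
  split; apply: key; rewrite ?unitmx_inv// => v /dcube00 vM i.
    have [K [K0 vK KE]] := rowmax v.
    have h := near1mx_mul Me vK.
    rewrite (le_trans (h i))// /d.
    (* v is not bounded beforehand, but its largest coordinate satisfies K <= 1 + K / 8. *)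
    suff : K <= 2.
      move=> K2; rewrite mulrCA ler_wpM2r//.
    case: KE => [->//|[j jK]].
    have /andP[u0 u1] := vM j.
    have := h j; rewrite ler_norml => /andP[h1 h2].
    have : K <= 1 + n%:R * (K * e).
      by rewrite -{1}jK ler_norml; apply/andP; split; lra.
    by nra.
  have vM1 j : `|(v *m invmx M) ord0 j| <= 1.
    by have /andP[? ?] := vM j; rewrite ger0_norm// ltW.
  have := near1mx_mul Me vM1 i; rewrite mulmxKV// mul1r distrC => h.
  by rewrite (le_trans h)// /d; lra.
move=> M'u h; rewrite -lee_fin -dilat_fin//.
apply: (@le_trans _ _ (m n (rbox (fun i => [set` `[- d, 1 + d[%R])))).
  apply: le_measure; rewrite ?inE.
  - by apply: measurable_preimage_mulmxr; exact: measurable_dcube.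
  - by apply: measurable_rbox => i; exact: measurable_itv.
  move=> v vM i; have := h v vM i; rewrite /= in_itv/= ler_norml => /andP[h1 h2].
  move/dcube00 : vM => /(_ i)/andP[? ?]; apply/andP; split; lra.
rewrite lebesgue_rV_box => [|i]; last by rewrite /d; lra.
rewrite lee_fin prodr_const card_ord (_ : 1 + d - - d = 1 + 4 * (n%:R * e)).
  by apply: ler_bernoulli; apply/andP; split; lra.
by rewrite /d; lra.
Qed.

Lemma ler1_small (x a t0 : R) : 0 < t0 ->
  (forall t : R, 0 < t < t0 -> x <= 1 + a * t) -> x <= 1.
Proof.
move=> t00 h; rewrite leNgt; apply/negP => x1.
pose t := Num.min (t0 / 2) ((x - 1) / (2 * (`|a| + 1))).
have a0 : 0 < 2 * (`|a| + 1) by rewrite mulr_gt0// ltr_wpDl.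
have tp : 0 < t by rewrite lt_min !divr_gt0// subr_gt0.
have tt0 : t < t0 by rewrite gt_min ltr_pdivrMr// ltr_pMr// ltr1n.
have := h t; rewrite tp tt0 => /(_ isT).
have : t <= (x - 1) / (2 * (`|a| + 1)) by rewrite ge_min lexx orbT.
rewrite ler_pdivlMr// => h1.
have : a * t <= `|a| * t by rewrite ler_wpM2r// ?ler_norm// ltW.
by nra.
Qed.

(* Conjugation by diag(t^w) makes the off-diagonal entries arbitrarily small. *)
Lemma dilat_unitriangular n (w : 'I_n -> nat) (M : 'M[R]_n) :
  M \in unitmx -> (forall i, M i i = 1) ->
  (forall i j, i != j -> M i j != 0 -> (w j < w i)%N) -> dilat M = 1.
Proof.
move=> Mu M1 Mw.
pose K : R := \sum_i \sum_j `|M i j|.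
have MK i j : `|M i j| <= K.
  rewrite /K (bigD1 i)//= (bigD1 j)//= -addrA lerDl addr_ge0 ?sumr_ge0// => l _.
  by rewrite sumr_ge0.
have K0 : 0 <= K by apply: sumr_ge0 => i _; apply: sumr_ge0.
(* For t < t0 the conjugated matrix is within K t of the identity and [n%:R * (K * t) <= 8^-1], as
   [dilat_near1mx] requires. *)
pose t0 : R := Num.min 1 (8 * (n%:R * K + 1))^-1.
have t00 : 0 < t0.
  by rewrite lt_min ltr01 invr_gt0 mulr_gt0// ltr_wpDl// mulr_ge0.
(* Letting t tend to 0 gives a factor of at most 1 for M and for its inverse; since the product is
   1, both equal 1. *)
suff h (t : R) : 0 < t < t0 -> dilat M <= 1 + (2 ^+ n * (4 * (n%:R * K))) * t /\
     dilat (invmx M) <= 1 + (2 ^+ n * (4 * (n%:R * K))) * t.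
  have le1 : dilat M <= 1.
    by apply: (@ler1_small _ (2 ^+ n * (4 * (n%:R * K))) t0) => // t /h[].
  have le2 : dilat (invmx M) <= 1.
    by apply: (@ler1_small _ (2 ^+ n * (4 * (n%:R * K))) t0) => // t /h[].
  apply/eqP; rewrite eq_le le1/= -(dilatV Mu) ler_piMr// ltW//; exact: dilat_gt0.
move=> /andP[tp]; rewrite lt_min => /andP[t1 tt].
pose D : 'M[R]_n := diag_mx (\row_i t ^+ w i).
have Du : D \in unitmx.
  rewrite unitmxE det_diag unitfE prodf_seq_neq0; apply/allP => i _ /=.
  by rewrite mxE expf_neq0// gt_eqF.
have DM : near1mx (K * t) (D *m M *m invmx D).
  have -> : invmx D = diag_mx (\row_i (t ^+ w i)^-1).
    rewrite -[RHS]mul1mx -(mulVmx Du) -mulmxA mulmx_diag.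
    rewrite (_ : \row_ _ _ = const_mx 1) ?diag_const_mx ?mulmx1//.
    by apply/rowP => i; rewrite !mxE mulfV// expf_neq0// gt_eqF.
  move=> i j; rewrite mul_mx_diag mxE mul_diag_mx !mxE.
  have [->|ij] := eqVneq i j.
    rewrite M1 mulr1 mulfV ?expf_neq0 ?gt_eqF// subrr normr0.
    by rewrite mulr_ge0// ltW.
  rewrite subr0; have [->|Mij] := eqVneq (M i j) 0.
    by rewrite mulr0 mul0r normr0 mulr_ge0// ltW.
  have /subnK wE := Mw _ _ ij Mij.
  have p0 : t ^+ w j != 0 by rewrite expf_neq0// gt_eqF.
  have -> : t ^+ w i * M i j / t ^+ w j = M i j * t ^+ (w i - (w j).+1).+1.
    have -> : t ^+ w i = t ^+ (w i - (w j).+1).+1 * t ^+ w j.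
      by rewrite -exprD addSnnS wE.
    by rewrite mulrAC mulfK// mulrC.
  rewrite normrM ler_pM// ger0_norm; last by rewrite exprn_ge0// ltW.
  by rewrite exprS ler_piMr//; [exact: ltW|rewrite exprn_ile1// ltW].
have conj : forall A : 'M[R]_n, A \in unitmx ->
    dilat (D *m A *m invmx D) = dilat A.
  move=> A Au; rewrite dilatM ?unitmx_mul ?Du ?unitmx_inv// dilatM//.
  by rewrite mulrAC dilatV// mul1r.
have Mu' : D *m M *m invmx D \in unitmx by rewrite !unitmx_mul Du Mu unitmx_inv.
have := dilat_near1mx (mulr_ge0 K0 (ltW tp)) _ Mu' DM.
have -> : invmx (D *m M *m invmx D) = D *m invmx M *m invmx D.
  have AB : (D *m M *m invmx D) *m (D *m invmx M *m invmx D) = 1%:M.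
    by rewrite !mulmxA mulmxKV// mulmxK// mulmxV.
  by rewrite -[RHS](mulKmx Mu') AB mulmx1.
rewrite !conj ?unitmx_inv// !mulrA; apply.
have : t * (8 * (n%:R * K + 1)) < 1.
  by rewrite -ltr_pdivlMr ?mul1r// mulr_gt0// ltr_wpDl// mulr_ge0.
have : 0 <= n%:R * K by rewrite mulr_ge0.
by nra.
Qed.

(* LU factorization reduces to permutation, diagonal and unitriangular matrices. *)
Lemma dilat_det n (M : 'M[R]_n.+1) : M \in unitmx -> dilat M = `|\det M|^-1.
Proof.
move=> Mu; have := cormen_lup_correct M; have := cormen_lup_perm M.
have := cormen_lup_detL M; have := @cormen_lup_lower _ _ M.
have := @cormen_lup_upper _ _ M.
case: cormen_lup => [[P L] U] /= Uu Ll Ldet /is_perm_mxP[s ->] PM.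
have Lu : L \in unitmx by rewrite unitmxE Ldet unitr1.
have Pu : (perm_mx s : 'M[R]_n.+1) \in unitmx by rewrite unitmxE det_perm unitrX// unitrN1.
have Uu' : U \in unitmx.
  have : L *m U \in unitmx by rewrite -[L *m U]PM unitmx_mul Pu Mu.
  by rewrite unitmx_mul => /andP[].
have detU : \det U = \prod_i U i i.
  rewrite -det_tr det_trig; first by apply: eq_bigr => i _; rewrite mxE.
  by apply/is_trig_mxP => i j ij; rewrite mxE; exact: Uu.
have U0 i : U i i != 0.
  by move: Uu'; rewrite unitmxE detU unitfE prodf_seq_neq0 => /allP/(_ i); apply; rewrite mem_index_enum.
pose d : 'rV[R]_n.+1 := \row_i U i i.
have d0 i : d ord0 i != 0 by rewrite mxE.
have Du : diag_mx d \in unitmx.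
  by rewrite unitmxE det_diag unitfE prodf_seq_neq0; apply/allP => i _ /=.
(* Dividing each row of U by its diagonal entry leaves a unitriangular factor. *)
pose V : 'M[R]_n.+1 := \matrix_(i, j) ((U i i)^-1 * U i j).
have UV : U = diag_mx d *m V.
  by apply/matrixP => i j; rewrite mul_diag_mx !mxE mulVKf.
have Vu : V \in unitmx by move: Uu'; rewrite UV unitmx_mul => /andP[].
have dV : dilat V = 1.
  (* In an upper triangular matrix the weight has to fall as the column index grows, so the index is
     reversed. *)
  apply: (@dilat_unitriangular _ (fun i => n - i)%N) => // [i|i j ij].
    by rewrite mxE mulVf.
  rewrite mxE; have [ji|ij' _|/val_inj/eqP] := ltngtP j i.
  - by rewrite (Uu _ _ ji) mulr0 eqxx.
  - by rewrite ltn_sub2l// (leq_trans ij')// -ltnS.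
  - by rewrite eq_sym (negbTE ij).
have dL : dilat L = 1.
  apply: (@dilat_unitriangular _ (fun i => i : nat)) => // [i|i j ij].
    by rewrite Ll// eqxx.
  by have [ij'|//] := leqP i j; rewrite Ll// (negbTE ij) eqxx.
have : dilat (perm_mx s *m M) = dilat (L *m U) by congr dilat.
rewrite !dilatM// dilat_perm dL !mul1r {1}UV dilatM// dV mulr1 dilat_diag// => ->.
have : \det (perm_mx s *m M) = \det (L *m U) by congr (\det _).
rewrite !det_mulmx Ldet mul1r det_perm => h.
rewrite prodfV; congr (_^-1); transitivity `|\det U|.
  by rewrite detU normr_prod; apply: eq_bigr => i _; rewrite mxE.
by rewrite -h normrM normrX normrN1 expr1n mul1r.
Qed.

Lemma lebesgue_rV_mulmx n (M : 'M[R]_n.+1) A : M \in unitmx -> measurable A ->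
  m n.+1 ((fun v => v *m M) @^-1` A) = ((`|\det M|^-1)%:E * m n.+1 A)%E.
Proof. by move=> Mu mA; rewrite dilatE// dilat_det. Qed.

End linear_change.

(** * Change of variables *)

Section rV_norm.
Context (R : realType).

Lemma rV_normP n (v : 'rV[R]_n) (K : R) : 0 <= K ->
  (forall i, `|v ord0 i| <= K) <-> `|v| <= K.
Proof.
move=> K0; split=> [vK|vK i].
  rewrite /Num.norm/= mx_normrE; apply: bigmax_le => // -[i j] _ /=.
  by rewrite ord1.
rewrite (le_trans _ vK)// /Num.norm/= mx_normrE.
by rewrite (le_bigmax _ (fun ij => `|v ij.1 ij.2|) (ord0, i)).
Qed.

Lemma rV_norm_coord n (v : 'rV[R]_n) i : `|v ord0 i| <= `|v|.
Proof. exact: (rV_normP v (normr_ge0 v)).2. Qed.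

Lemma mulmx_bound n p (M : 'M[R]_(n, p)) :
  exists2 K : R, 0 < K & forall v : 'rV[R]_n, `|v *m M| <= K * `|v|.
Proof.
pose K : R := 1 + \sum_i \sum_j `|M i j|.
have K0 : 0 < K.
  by rewrite ltr_pwDl// sumr_ge0// => i _; rewrite sumr_ge0.
exists K => // v; apply/rV_normP => [|j]; first by rewrite mulr_ge0// ltW.
rewrite mxE (le_trans (ler_norm_sum _ _ _))// /K mulrDl mul1r ler_wpDl//.
rewrite mulr_suml; apply: ler_sum => i _.
rewrite normrM mulrC ler_pM//; last exact: rV_norm_coord.
by rewrite (bigD1 j)//= lerDl sumr_ge0.
Qed.

Lemma mul_jacobian n p (f : 'rV[R]_n -> 'rV[R]_p) (x v : 'rV[R]_n) :
  v *m 'J f x = 'd f x v.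
Proof. by rewrite /jacobian mul_rV_lin1. Qed.

Lemma differentiable_rV n p (f : 'rV[R]_n -> 'rV[R]_p) (x : 'rV[R]_n) :
  differentiable f x -> forall e : R, 0 < e -> exists2 d : R, 0 < d &
  forall z, `|z - x| < d -> `|f z - f x - (z - x) *m 'J f x| <= e * `|z - x|.
Proof.
move=> df e e0.
have /eqaddoP /(_ e e0) /nbhs_ballP[d /= d0 h] := diff_locally df.
exists d => // z zx; rewrite mul_jacobian.
have := h (z - x); rewrite mx_norm_ball /ball_ /= sub0r normrN => /(_ zx).
by rewrite !fctE /= subrK opprD addrA.
Qed.

(** By the chain rule the product is the Jacobian of [g \o f], which is the identity near x. The
    first-order estimate at [x + t *: v] for small t shows that it fixes each basis vector v up to
    an arbitrary error. *)
Lemma jacobian_cancel n (f g : 'rV[R]_n -> 'rV[R]_n) (x : 'rV[R]_n) :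
  differentiable f x -> differentiable g (f x) ->
  (\forall z \near x, g (f z) = z) -> 'J f x *m 'J g (f x) = 1%:M.
Proof.
move=> df dg /nbhs_ballP[r /= r0 gf].
have dgf : differentiable (g \o f) x by exact: differentiable_comp.
have JE : 'J (g \o f) x = 'J f x *m 'J g (f x).
  apply/row_matrixP => i; rewrite !rowE mulmxA.
  apply: etrans (mul_jacobian _ _ _) _.
  apply: etrans (congr1 (fun d => d _) (diff_comp df dg)) _.
  apply/esym; apply: etrans (mul_jacobian _ _ _) _.
  by congr ('d g (f x) _); exact: mul_jacobian.
rewrite -JE; apply/row_matrixP => i; rewrite !rowE mulmx1.
set v := delta_mx 0 i; set J := 'J _ _.
suff small (e : R) : 0 < e -> `|v *m J - v| <= e.
  apply/eqP; rewrite -subr_eq0 -normr_eq0 eq_le normr_ge0 andbT.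
  by apply/ler_addgt0Pl => e e0; rewrite addr0; exact: small.
move=> e0.
have [d d0 H] := differentiable_rV dgf (divr_gt0 e0 (ltr_pwDl ltr01 (normr_ge0 v))).
pose t := Num.min (d / 2) (r / 2) / (1 + `|v|).
have v1 : 0 < 1 + `|v| by rewrite ltr_pwDl.
have t0 : 0 < t by rewrite divr_gt0// lt_min !divr_gt0.
have tv : `|t *: v| < Num.min d r.
  rewrite normrZ gtr0_norm// mulrAC ltr_pdivrMr//.
  rewrite (@le_lt_trans _ _ (Num.min (d / 2) (r / 2) * (1 + `|v|)))//.
    by rewrite ler_wpM2l ?lerDr// le_min !divr_ge0// ltW.
  rewrite ltr_pM2r// lt_min !gt_min.
  by rewrite [d / 2 < d]ltr_pdivrMr// [r / 2 < r]ltr_pdivrMr// !ltr_pMr// !ltr1n orbT.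
move: tv; rewrite lt_min => /andP[tvd tvr].
have zx : x + t *: v - x = t *: v by rewrite addrC addKr.
have := H (x + t *: v); rewrite zx => /(_ tvd).
rewrite /= gf; last by rewrite mx_norm_ball /ball_ /= opprD addrA subrr sub0r normrN.
rewrite (gf x); last exact: ballxx.
rewrite zx -/J -scalemxAl -scalerBr.
rewrite (normrZ t v) (normrZ t (v - v *m J)) (gtr0_norm t0).
rewrite [leRHS]mulrCA ler_pM2l//.
move=> /le_trans; rewrite distrC; apply.
rewrite -mulrA ler_piMr//; first exact: ltW.
by rewrite mulrC ler_pdivrMr// mul1r lerDr.
Qed.

End rV_norm.

(** * Volume of the preimages of small cubes *)

Section local_density.
Context (R : realType).
Local Notation m := (lebesgue_rV R).

Lemma lebesgue_rV_affine n (M : 'M[R]_n.+1) (x0 y0 : 'rV[R]_n.+1) A :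
  M \in unitmx -> measurable A ->
  m n.+1 [set y | A ((y - y0) *m M + x0)] = ((`|\det M|^-1)%:E * m n.+1 A)%E.
Proof.
move=> Mu mA; pose A' := (fun v : 'rV[R]_n.+1 => v + (x0 - y0 *m M)) @^-1` A.
have mA' : measurable A'.
  by rewrite -[A']setTI; exact: measurable_translate.
rewrite -[in RHS](lebesgue_rV_translate (x0 - y0 *m M) mA) -lebesgue_rV_mulmx//.
congr (m _ _); apply/seteqP.
by split=> y /=; rewrite mulmxBl addrAC addrA.
Qed.

Lemma measurable_affine n (M : 'M[R]_n.+1) (x0 y0 : 'rV[R]_n.+1) A :
  measurable A -> measurable [set y | A ((y - y0) *m M + x0)].
Proof.
move=> mA; have -> : [set y | A ((y - y0) *m M + x0)] =
    (fun v => v - y0) @^-1` ((fun v => v *m M) @^-1` ((fun v => v + x0) @^-1` A)).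
  by [].
rewrite -[X in measurable X]setTI; apply: measurable_translate => //.
apply: measurable_preimage_mulmxr.
by rewrite -[X in measurable X]setTI; exact: measurable_translate.
Qed.

Lemma dcube_itv n l (k : 'rV[int]_n) (v : 'rV[R]_n) : dcube l k v <->
  forall i, (k ord0 i)%:~R * 2 ^- l <= v ord0 i < (k ord0 i)%:~R * 2 ^- l + 2 ^- l.
Proof.
rewrite dcubeE; split=> h i; have := h i; rewrite /= in_itv/= intrD;
  by rewrite (_ : 1%:~R = 1 :> R)// mulrDl mul1r.
Qed.

Lemma bernoulli_sub n (y : R) : 0 <= y <= 1 -> 1 - n%:R * y <= (1 - y) ^+ n.
Proof.
move=> /andP[y0 y1]; elim: n => [|n IH]; first by rewrite mul0r subr0 expr0.
rewrite exprS; apply: (@le_trans _ _ ((1 - y) * (1 - n%:R * y))); last first.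
  by rewrite ler_wpM2l// subr_ge0.
have : 0 <= n%:R * y * y by rewrite !mulr_ge0.
by rewrite -natr1; lra.
Qed.

Lemma exp2V_small (d : R) : 0 < d -> exists L, forall l, (L <= l)%N -> 2 ^- l < d.
Proof.
move=> d0; exists (Num.bound d^-1) => l Ll.
have l0 : 0 < 2 ^+ l :> R by exact: exprn_gt0.
rewrite -[ltRHS]invrK ltf_pV2 ?posrE ?invr_gt0//.
rewrite (lt_trans (archi_boundP _)) ?invr_ge0 ?ltW//.
by rewrite -natrX ltr_nat (leq_ltn_trans Ll)// ltn_expl.
Qed.

(** Near [f x0] the map g differs from its affine approximation by a small fraction of the side of
    the cube. So the preimage of a cube lies between the affine preimages of a slightly shrunk and a
    slightly enlarged cube, whose volumes are known. *)
Lemma local_density_mx n (f g : 'rV[R]_n.+1 -> 'rV[R]_n.+1) (W : set 'rV[R]_n.+1)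
    (x0 : 'rV[R]_n.+1) (M Mi : 'M[R]_n.+1) :
  open W -> (forall A, measurable A -> measurable (W `&` g @^-1` A)) ->
  W (f x0) -> (forall y, W y -> f (g y) = y) -> g (f x0) = x0 ->
  M *m Mi = 1%:M ->
  (forall e : R, 0 < e -> exists2 d : R, 0 < d & forall z, `|z - x0| < d ->
    `|f z - f x0 - (z - x0) *m M| <= e * `|z - x0|) ->
  (forall e : R, 0 < e -> exists2 d : R, 0 < d & forall z, `|z - f x0| < d ->
    `|g z - g (f x0) - (z - f x0) *m Mi| <= e * `|z - f x0|) ->
  forall e : R, 0 < e -> exists L, forall l, (L <= l)%N -> forall k : 'rV[int]_n.+1,
    (forall i, `|x0 ord0 i * 2 ^+ l - (k ord0 i)%:~R| <= 1) ->
    (m n.+1 (W `&` g @^-1` dcube l k) <=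
      ((`|\det M| + e) * (2 ^- l) ^+ n.+1)%:E)%E /\
    (((`|\det M| - e) * (2 ^- l) ^+ n.+1)%:E <=
      m n.+1 (W `&` g @^-1` dcube l k))%E.
Proof.
move=> oW mW Wf fgK gf0 MMi df dg e e0.
have /andP[Mu Miu] : (M \in unitmx) && (Mi \in unitmx).
  by rewrite -unitmx_mul MMi unitmx1.
have detE : `|\det Mi|^-1 = `|\det M|.
  suff inv_eq (a b : R) : a * b = 1 -> b^-1 = a.
    by apply: inv_eq; rewrite -normrM -det_mulmx MMi det1 normr1.
  move=> ab; have b0 : b != 0.
    by apply/eqP => b0; move/eqP : ab; rewrite b0 mulr0 eq_sym oner_eq0.
  by rewrite -[RHS](mulfK b0) ab mul1r.
have [K1 K10 HK1] := mulmx_bound Mi.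
have [K2 K20 HK2] := mulmx_bound M.
have [D [<- {}detE D0]] : exists D : R,
    [/\ D = `|\det M|, `|\det Mi|^-1 = D & 0 <= D] by exists `|\det M|.
(* c collects the slopes of the two volume errors, from [ler_bernoulli] above and [bernoulli_sub]
   below, so that a relative change r <= e / c costs at most e; the 1 keeps c positive. *)
pose c : R := D * (2 ^+ n.+1 * 2) + D * (n.+1%:R * 2) + 1.
have c0 : 0 < c.
  by rewrite ltr_wpDl// addr_ge0// mulr_ge0// mulr_ge0// exprn_ge0.
pose r := Num.min (4^-1) (e / c).
have r0 : 0 < r by rewrite lt_min invr_gt0 ltr0n divr_gt0.
have rge : 0 <= r by exact: ltW.
have r4 : r <= 4^-1 by rewrite ge_min lexx.
have rc : r * c <= e by rewrite -ler_pdivlMr// ge_min lexx orbT.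
have rU : D * (2 ^+ n.+1 * (2 * r)) <= e.
  apply: le_trans rc; rewrite /c.
  have : 0 <= r * (D * (n.+1%:R * 2)) by rewrite mulr_ge0// mulr_ge0.
  by lra.
have rL : D * (n.+1%:R * (2 * r)) <= e.
  apply: le_trans rc; rewrite /c.
  have : 0 <= r * (D * (2 ^+ n.+1 * 2)) by rewrite mulr_ge0// mulr_ge0// mulr_ge0// exprn_ge0.
  by lra.
have [d1 d10 Hd1] := df _ (divr_gt0 r0 (mulr_gt0 (ltr0n R 2) K10)).
have [d2 d20 Hd2] := dg _ (divr_gt0 r0 (mulr_gt0 (ltr0n R 2) K20)).
have /nbhs_ballP[d3 /= d30 Hd3] : nbhs (f x0) W by exact: open_nbhs_nbhs.
rewrite mx_norm_ball in Hd3.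
(* Points of a cube of side h are within 2 h of x0 and their affine images within 2 K2 h of [f x0];
   h < d puts them inside the three radii. *)
pose d := Num.min (d1 / 4) (Num.min (d2 / (4 * K2)) (d3 / (4 * K2))).
have d0 : 0 < d by rewrite !lt_min !divr_gt0// mulr_gt0.
have [L HL] := exp2V_small d0.
exists L => l Ll k kx0; set h : R := 2 ^- l.
have h0 : 0 < h by rewrite invr_gt0 exprn_gt0.
have := HL l Ll; rewrite -/h !lt_min => /andP[hd1 /andP[hd2 hd3]].
rewrite ltr_pdivlMr// in hd1.
rewrite ltr_pdivlMr ?mulr_gt0// in hd2; rewrite ltr_pdivlMr ?mulr_gt0// in hd3.
have hl : 2 ^+ l = h^-1 by rewrite /h invrK.
have scal (a : R) : 0 < a -> a * (r / (2 * a) * (2 * h)) = r * h.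
  move=> a0; have qa : r / (2 * a) * (2 * a) = r by rewrite divfK// gt_eqF// mulr_gt0.
  by rewrite -[in RHS]qa; lra.
have near0 (x : 'rV[R]_n.+1) : dcube l k x -> `|x - x0| <= 2 * h.
  move=> /dcube_mem xk; apply/rV_normP => [|i]; first by rewrite mulr_ge0// ltW.
  rewrite !mxE; have := xk i; have := kx0 i; rewrite hl !ler_norml.
  move=> /andP[a1 a2] /andP[b1 b2].
  have hx : x ord0 i = x ord0 i * h^-1 * h by rewrite mulfVK// gt_eqF.
  have hx0 : x0 ord0 i = x0 ord0 i * h^-1 * h by rewrite mulfVK// gt_eqF.
  rewrite hx hx0 -mulrBl -mulNr !ler_pM2r//; apply/andP; split; lra.
(* The cube enlarged by s h on each side, or shrunk when s is negative. *)
pose box (s : R) := rbox (fun i : 'I_n.+1 =>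
  [set` `[(k ord0 i)%:~R * h - s * h, (k ord0 i)%:~R * h + h + s * h[%R]).
have mbox s : measurable (box s) by apply: measurable_rbox => i; exact: measurable_itv.
have vbox s : - 2^-1 <= s -> m n.+1 (box s) = ((1 + 2 * s) ^+ n.+1 * h ^+ n.+1)%:E.
  move=> s2; rewrite lebesgue_rV_box => [|i]; last by nra.
  rewrite -exprMn; congr EFin; under eq_bigr => i _.
    rewrite (_ : _ - _ = (1 + 2 * s) * h); last by lra.
    over.
  by rewrite prodr_const card_ord.
have hn0 : 0 <= h ^+ n.+1 by rewrite exprn_ge0// ltW.
have Maff s : - 2^-1 <= s -> m n.+1 [set y | box s ((y - f x0) *m Mi + x0)] =
    (D * ((1 + 2 * s) ^+ n.+1 * h ^+ n.+1))%:E.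
  by move=> s2; rewrite lebesgue_rV_affine// vbox// detE.
split.
  apply: (@le_trans _ _ (m n.+1 [set y | box r ((y - f x0) *m Mi + x0)])).
    apply: le_measure; rewrite ?inE//.
    - by apply: mW; exact: measurable_dcube.
    - exact: measurable_affine.
    move=> y [Wy /= gyk] i.
    have gyx : `|g y - x0| <= 2 * h by exact: near0.
    have := Hd1 (g y); rewrite fgK// => /(_ _)/wrap[]; first lra.
    move=> H; pose z := (y - f x0) *m Mi + x0.
    have : `|z - g y| <= r * h.
      have -> : z - g y = (y - f x0 - (g y - x0) *m M) *m Mi.
        by rewrite mulmxBl -mulmxA MMi mulmx1 /z opprB addrA addrAC.
      rewrite (le_trans (HK1 _))//.
      rewrite -(scal K1)// ler_pM2l// (le_trans H)//.
      by rewrite ler_wpM2l// divr_ge0// mulr_ge0// ltW.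
    move=> zg; have := rV_norm_coord (z - g y) i; rewrite mxE [(- g y) _ _]mxE => /le_trans/(_ zg).
    move: gyk => /dcube_itv/(_ i); rewrite -/h -!/z ler_norml => /andP[? ?] /andP[? ?].
    by rewrite /= in_itv/=; apply/andP; split; lra.
  rewrite Maff; last by lra.
  rewrite lee_fin mulrA ler_wpM2r//.
  rewrite (@le_trans _ _ (D * (1 + 2 ^+ n.+1 * (2 * r))))//; last by lra.
  by rewrite ler_wpM2l// ler_bernoulli//; apply/andP; split; lra.
apply: (@le_trans _ _ (m n.+1 [set y | box (- r) ((y - f x0) *m Mi + x0)])).
  rewrite Maff; last by lra.
  rewrite lee_fin mulrA ler_wpM2r//.
  rewrite (@le_trans _ _ (D * (1 - n.+1%:R * (2 * r))))//; first by lra.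
  by rewrite ler_wpM2l// mulrN bernoulli_sub//; apply/andP; split; lra.
apply: le_measure; rewrite ?inE//.
- exact: measurable_affine.
- by apply: mW; exact: measurable_dcube.
move=> y; rewrite /box /= => yb; set z := (y - f x0) *m Mi + x0 in yb.
have zk : dcube l k z.
  apply/dcube_itv => i; have := yb i; rewrite /= in_itv/= -/h => /andP[? ?].
  have : 0 < r * h by rewrite mulr_gt0.
  by move=> ?; apply/andP; split; lra.
have yE : y - f x0 = (z - x0) *m M.
  rewrite /z addrK -mulmxA (_ : Mi *m M = 1%:M) ?mulmx1//.
  by move/mulmx1C : MMi.
have yb2 : `|y - f x0| <= K2 * (2 * h).
  by rewrite yE (le_trans (HK2 _))// ler_pM2l//; exact: near0.
have Wy : W y.
  by apply: Hd3; rewrite /ball_ /= distrC; lra.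
split=> //=; apply/dcube_itv => i.
have := Hd2 y => /(_ _)/wrap[]; first lra.
rewrite gf0 => H.
have : `|g y - z| <= r * h.
  rewrite (_ : g y - z = g y - x0 - (y - f x0) *m Mi); last first.
    by rewrite /z opprD addrA addrAC.
  rewrite (le_trans H)// -(scal K2)// [leRHS]mulrCA.
  by rewrite ler_wpM2l// divr_ge0// mulr_ge0// ltW.
move=> gz; have := rV_norm_coord (g y - z) i; rewrite mxE [(- z) _ _]mxE => /le_trans/(_ gz).
have := yb i; rewrite /= in_itv/= -/h -!/z ler_norml => /andP[? ?] /andP[? ?].
by apply/andP; split; lra.
Qed.

Lemma local_density n (f g : 'rV[R]_n.+1 -> 'rV[R]_n.+1) (W : set 'rV[R]_n.+1)
    (x0 : 'rV[R]_n.+1) :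
  open W -> (forall A, measurable A -> measurable (W `&` g @^-1` A)) ->
  W (f x0) -> (forall y, W y -> f (g y) = y) ->
  (\forall z \near x0, g (f z) = z) ->
  differentiable f x0 -> differentiable g (f x0) ->
  forall e : R, 0 < e -> exists L, forall l, (L <= l)%N -> forall k : 'rV[int]_n.+1,
    (forall i, `|x0 ord0 i * 2 ^+ l - (k ord0 i)%:~R| <= 1) ->
    (m n.+1 (W `&` g @^-1` dcube l k) <=
      ((`|\det ('J f x0)| + e) * (2 ^- l) ^+ n.+1)%:E)%E /\
    (((`|\det ('J f x0)| - e) * (2 ^- l) ^+ n.+1)%:E <=
      m n.+1 (W `&` g @^-1` dcube l k))%E.
Proof.
move=> oW mW Wf fgK gfK df dg.
apply: (local_density_mx oW mW Wf fgK _ (jacobian_cancel df dg gfK)).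
- exact: nbhs_singleton gfK.
- exact: differentiable_rV df.
- exact: differentiable_rV dg.
Qed.

End local_density.

(** * Comparing measures by bisection *)

Section bisection.
Context (R : realType).

(** Nested half-open cubes can have empty intersection, so the common point is only in their
    closures, hence the closed bounds. It is the coordinatewise supremum of the lower corners. *)
Lemma nested_dcubes n (l0 : nat) (k : nat -> 'rV[int]_n)
    (b : nat -> {ffun 'I_n -> bool}) :
  (forall j, k j.+1 = halfidx (k j) (b j)) ->
  exists x0 : 'rV[R]_n, forall j i,
    0 <= x0 ord0 i * 2 ^+ (l0 + j) - (k j ord0 i)%:~R <= 1.
Proof.
move=> kS.
pose a j i : R := (k j ord0 i)%:~R / 2 ^+ (l0 + j).
pose c j i : R := ((k j ord0 i)%:~R + 1) / 2 ^+ (l0 + j).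
have p0 j : 0 < 2 ^+ (l0 + j) :> R by exact: exprn_gt0.
have step j i : a j i <= a j.+1 i /\ c j.+1 i <= c j i.
  rewrite /a /c !addnS !exprS !invfM !mulrA !ler_pM2r ?invr_gt0// kS mxE.
  rewrite intrD intrM (_ : 2%:~R = 2 :> R)//.
  rewrite ler_pdivlMr// ler_pdivrMr//; case: (b j i) => /=.
    by rewrite (_ : 1%:~R = 1 :> R)//; lra.
  by rewrite (_ : 0%:~R = 0 :> R)//; lra.
have amono i j j' : (j <= j')%N -> a j i <= a j' i.
  move=> /subnKC <-; elim: (j' - j)%N => [|d IH]; first by rewrite addn0.
  by rewrite addnS (le_trans IH)//; case: (step (j + d)%N i).
have cmono i j j' : (j <= j')%N -> c j' i <= c j i.
  move=> /subnKC <-; elim: (j' - j)%N => [|d IH]; first by rewrite addn0.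
  by rewrite addnS (le_trans _ IH)//; case: (step (j + d)%N i).
have ac j i : a j i <= c j i by rewrite /a /c ler_pM2r ?invr_gt0// lerDl.
have acc i j j' : a j i <= c j' i.
  rewrite (le_trans (amono i _ _ (leq_maxl j j')))//.
  by rewrite (le_trans (ac _ _))// cmono// leq_maxr.
exists (\row_i sup (range (fun j => a j i))) => j i; rewrite mxE.
have sx : has_sup (range (fun j => a j i)).
  by split; [exists (a 0 i), 0|exists (c 0 i) => _ [j' _ <-]; exact: acc].
set s := sup _.
have s1 : a j i <= s by apply: ub_le_sup; [case: sx|exists j].
have s2 : s <= c j i.
  by apply: ge_sup; [case: sx|move=> _ [j' _ <-]; exact: acc].
rewrite /a ler_pdivrMr// in s1; rewrite /c ler_pdivlMr// in s2.
by apply/andP; split; lra.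
Qed.

(* Bisection: a cube violating the conclusion contains nested violating cubes,
   which contradicts the hypothesis at their common point. *)
Lemma le_measure_dcube n (mu nu : {measure set 'rV[R]_n -> \bar R}) l0 (k0 : 'rV[int]_n) :
  (forall x0 : 'rV[R]_n, closure (dcube l0 k0) x0 ->
    forall e : R, 0 < e -> exists L, forall l, (L <= l)%N -> forall k : 'rV[int]_n,
    @dcube R n l k `<=` dcube l0 k0 ->
    (forall i, `|x0 ord0 i * 2 ^+ l - (k ord0 i)%:~R| <= 1) ->
    (mu (dcube l k) <= nu (dcube l k) + (e * (2 ^- l) ^+ n)%:E)%E) ->
  (mu (dcube l0 k0) <= nu (dcube l0 k0))%E.
Proof.
move=> H; apply/lee_addgt0Pr => e e0.
set q : R := (2 ^- l0) ^+ n.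
have q0 : 0 < q by rewrite exprn_gt0// invr_gt0 exprn_gt0.
have {e e0} [e e0 ->] : exists2 e' : R, 0 < e' & e = e' * q.
  by exists (e / q); [rewrite divr_gt0|rewrite divfK// gt_eqF].
rewrite leNgt; apply/negP => bad0.
(* The tolerated error is proportional to volume and hence additive over the children: if no child
   is bad, neither is the parent. *)
pose bad l k := (nu (dcube l k) + (e * (2 ^- l) ^+ n)%:E < mu (dcube l k))%E.
have stepP l k : exists b, bad l k -> bad l.+1 (halfidx k b).
  have [/existsP[b hb]|/existsPn hb] := boolP [exists b, `[< bad l.+1 (halfidx k b) >]].
    by exists b => _; exact/asboolP.
  exists [ffun=> false]; rewrite /bad ltNge => /negP[].
  rewrite (measure_dcube_split mu) (measure_dcube_split nu).
  apply: (@le_trans _ _ (\sum_(b : {ffun 'I_n -> bool})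
      (nu (dcube l.+1 (halfidx k b)) + (e * (2 ^- l.+1) ^+ n)%:E))%E).
    apply: lee_sum => b _; rewrite leNgt; apply/negP => bd.
    by have /asboolP := hb b; apply.
  rewrite big_split/= leeD2l// sumEFin sumr_const card_ffun card_bool card_ord.
  rewrite lee_fin -[_ *+ (2 ^ n)]mulr_natl mulrCA ler_pM2l// natrX -exprMn.
  by rewrite exprS invfM mulrA mulfV// mul1r.
pose nxt (x : nat * 'rV[int]_n) := sval (cid (stepP x.1 x.2)).
pose sq := fix sq j := if j is j'.+1 then halfidx (sq j') (nxt ((l0 + j')%N, sq j')) else k0.
have sbad j : bad (l0 + j)%N (sq j).
  elim: j => [|j IH] /=; first by rewrite addn0.
  by rewrite addnS; exact: (svalP (cid (stepP (l0 + j)%N (sq j)))).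
have ssub j : dcube (l0 + j) (sq j) `<=` @dcube R n l0 k0.
  elim: j => [|j IH]; first by rewrite addn0.
  apply: subset_trans IH; rewrite addnS /= [X in _ `<=` X]dcube_split.
  exact: (@bigcup_sup _ _ (nxt ((l0 + j)%N, sq j))).
have [x0 Hx0] := @nested_dcubes n l0 sq (fun j => nxt ((l0 + j)%N, sq j)) (fun=> erefl).
have x0P j i : `|x0 ord0 i * 2 ^+ (l0 + j) - (sq j ord0 i)%:~R| <= 1.
  by have /andP[? ?] := Hx0 j i; rewrite ger0_norm.
(* x0 is in the closure of the initial cube because the corners of the nested cubes lie in that cube
   and tend to x0. *)
have [|L HL] := H x0 _ e e0.
  move=> V /nbhs_ballP[r /= r0 rV]; have [j Hj] := exp2V_small r0.
  have p0 : 0 < 2 ^+ (l0 + j) :> R by exact: exprn_gt0.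
  exists (\row_i ((sq j ord0 i)%:~R / 2 ^+ (l0 + j))); split.
    by apply: (ssub j) => i; rewrite mxE mulrC divfK ?gt_eqF// intrKfloor.
  apply: rV; split => // i' i; rewrite ord1 /ball/= mxE.
  apply: le_lt_trans (Hj (l0 + j)%N (leq_addl _ _)).
  have /andP[a1 a2] := Hx0 j i.
  rewrite -(ler_pM2r p0) mulVf ?gt_eqF// -[X in _ * X <= _](gtr0_norm p0) -normrM mulrBl.
  by rewrite divfK ?gt_eqF// ger0_norm.
have := HL (l0 + L)%N (leq_addl _ _) (sq L) (ssub L) (x0P L).
by rewrite leNgt => /negP; apply; exact: sbad.
Qed.

End bisection.

Section density.
Context d (T : measurableType d) (R : realType) (mu : {measure set T -> \bar R}).
Variables (g : T -> R).
Hypotheses (mg : measurable_fun setT g) (g0 : forall x, 0 <= g x).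

Definition density_measure (A : set T) : \bar R := (\int[mu]_(x in A) (g x)%:E)%E.

Let density0 : density_measure set0 = 0%E.
Proof. by rewrite /density_measure integral_set0. Qed.

Let density_ge0 A : (0 <= density_measure A)%E.
Proof. by apply: integral_ge0 => x _; rewrite lee_fin. Qed.

Let density_sigma_additive : semi_sigma_additive density_measure.
Proof.
apply: semi_sigma_additive_nng_induced; first exact/measurable_EFinP.
by move=> x; rewrite lee_fin.
Qed.

HB.instance Definition _ := isMeasure.Build _ _ _ density_measure
  density0 density_ge0 density_sigma_additive.

Definition density : {measure set T -> \bar R} := density_measure.

Import HBNNSimple.

(** For simple functions this is the definition of the density; both sides pass to monotone
    limits. *)
Lemma ge0_integral_density (f : T -> \bar R) :
  measurable_fun setT f -> (forall x, 0 <= f x)%E ->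
  (\int[density]_x f x = \int[mu]_x (f x * (g x)%:E))%E.
Proof.
rewrite /density => mf f0; pose h := nnsfun_approx measurableT mf.
have mg' : measurable_fun setT (EFin \o g) by exact/measurable_EFinP.
have -> : (\int[density_measure]_x f x =
    lim (\int[density_measure]_x (EFin \o h n) x @[n --> \oo]))%E.
  have fE x : f x = lim ((EFin \o h n) x @[n --> \oo]).
    by apply/esym/cvg_lim => //; exact: cvg_nnsfun_approx.
  under eq_integral do rewrite fE.
  apply: monotone_convergence => //.
  - by move=> n; exact/measurable_EFinP.
  - by move=> n x _ /=; rewrite lee_fin.
  - by move=> x _ a b ab; rewrite lee_fin; exact/lefP/nd_nnsfun_approx.
have -> : (\int[mu]_x (f x * (g x)%:E) =
    lim (\int[mu]_x ((h n x)%:E * (g x)%:E) @[n --> \oo]))%E.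
  have fg x : (f x * (g x)%:E = lim ((h n x)%:E * (g x)%:E @[n --> \oo]))%E.
    by apply/esym/cvg_lim => //; apply: cvgeZr => //; exact: cvg_nnsfun_approx.
  under eq_integral do rewrite fg.
  apply: monotone_convergence => //.
  - by move=> n; apply: emeasurable_funM => //; exact/measurable_EFinP.
  - by move=> n x _ /=; rewrite mule_ge0 ?lee_fin.
  - move=> x _ a b ab /=; rewrite lee_wpmul2r ?lee_fin//.
    exact/lefP/nd_nnsfun_approx.
apply: congr_lim; apply/funext => n.
rewrite integralT_nnsfun sintegralE.
transitivity (\int[mu]_x (\sum_(y \in range (h n))
    (y * \1_(h n @^-1` [set y]) x)%:E * (g x)%:E))%E; last first.
  apply: eq_integral => x _.
  rewrite -ge0_mule_fsuml => [|y]; last exact: nnfun_muleindic_ge0.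
  by rewrite fsumEFin // -(fimfunE _ x).
rewrite ge0_integral_fsum//; last 2 first.
- move=> y; apply: emeasurable_funM => //.
  by apply/measurable_EFinP; exact: measurable_funM.
- by move=> y x _; apply: mule_ge0; [rewrite EFinM; exact: nnfun_muleindic_ge0|rewrite lee_fin].
transitivity (\sum_(r \in range (h n))
    (r%:E * density_measure (h n @^-1` [set r])))%E.
  apply/esym/fsbig_widen => // y /= [_ hy].
  rewrite (_ : _ @^-1` _ = set0) ?measure0 ?mule0//.
  by apply/seteqP; split=> // x hx; apply: hy; exists x.
apply: eq_fsbigr => r; rewrite inE => -[t _ <-].
under [RHS]eq_integral do rewrite EFinM -muleA.
rewrite ge0_integralZl//; last 3 first.
- by apply: emeasurable_funM => //; exact/measurable_EFinP.
- by move=> x _; rewrite mule_ge0// lee_fin.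
- by rewrite lee_fin.
congr (_ * _)%E; rewrite /= /density_measure integral_mkcond.
by apply: eq_integral => x _; rewrite epatch_indic muleC.
Qed.

End density.

Section change_of_variables.
Context (R : realType).
Local Notation m := (lebesgue_rV R).

Lemma open_setI_preimage (S T : topologicalType) (D : set S) (f : S -> T) (A : set T) :
  open D -> (forall x, D x -> {for x, continuous f}) -> open A ->
  open (D `&` f @^-1` A).
Proof.
move=> oD cf oA; rewrite openE => x [Dx Ax]; apply: filterI.
  by apply: open_nbhs_nbhs; split.
by apply: (cf x Dx); exact: open_nbhs_nbhs.
Qed.

Lemma measurable_fun_open_rV n p (D : set 'rV[R]_n) (f : 'rV[R]_n -> 'rV[R]_p) :
  open D -> (forall x, D x -> {for x, continuous f}) -> measurable_fun D f.
Proof.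
move=> oD cf; apply: (@measurability _ _ _ _ _ _ (@open 'rV[R]_p)) => //.
by move=> _ [A oA <-]; apply: open_measurable_rV; exact: open_setI_preimage.
Qed.

Lemma measurable_fun_open_R n (D : set 'rV[R]_n) (f : 'rV[R]_n -> R) :
  open D -> (forall x, D x -> {for x, continuous f}) ->
  measurable_fun D (f : _ -> measurableTypeR R).
Proof.
move=> oD cf; apply: (measurability _ (RGenOpens.measurableE R)) => //.
move=> _ [_ [x [y ->]] <-]; apply: open_measurable_rV.
by apply: open_setI_preimage => //; exact: interval_open.
Qed.

Lemma continuous_det (S : topologicalType) n (A : S -> 'M[R]_n) (x : S) :
  {for x, continuous A} -> {for x, continuous (fun z => \det (A z))}.
Proof.
move=> cA; rewrite /determinant.
apply: cvg_big; first exact: add_continuous.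
move=> s _; apply: cvgM; first exact: cvg_cst.
apply: cvg_big; first exact: mul_continuous.
move=> i _; exact: (cvg_comp _ _ cA (@coord_continuous _ _ _ _ _ _)).
Qed.

(** * Measures determined by a continuous local density *)

Section eq_density.
Variables (n : nat) (U : set 'rV[R]_n) (J : 'rV[R]_n -> R).
Variable (nu : {measure set 'rV[R]_n -> \bar R}).
Hypotheses (oU : open U) (J0 : forall x, 0 <= J x).
Hypothesis cJ : forall x, U x -> {for x, continuous J}.
Hypothesis nuU : nu (~` U) = 0%E.
Hypothesis nuJ : forall x0, U x0 -> forall e : R, 0 < e -> exists L,
  forall l, (L <= l)%N -> forall k : 'rV[int]_n,
    (forall i, `|x0 ord0 i * 2 ^+ l - (k ord0 i)%:~R| <= 1) ->
    (nu (dcube l k) <= ((J x0 + e) * (2 ^- l) ^+ n)%:E)%E /\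
    (((J x0 - e) * (2 ^- l) ^+ n)%:E <= nu (dcube l k))%E.

Let mU : measurable U. Proof. exact: open_measurable_rV. Qed.

Definition restricted_density x : R := J x * \1_U x.
Local Notation F := restricted_density.

Lemma restricted_density_ge0 x : 0 <= F x.
Proof. by rewrite /F mulr_ge0. Qed.

Lemma measurable_restricted_density : measurable_fun setT F.
Proof.
have -> : F = (J : _ -> measurableTypeR R) \_ U.
  by apply/funext => x; rewrite /F patchE; case: ifPn => h;
    rewrite indicE ?h ?(negbTE h) ?mulr1 ?mulr0.
apply/(@measurable_restrictT _ _ _ (measurableTypeR R) _ _ mU).
exact: measurable_fun_open_R.
Qed.

Local Notation kappa := (density (m n)
  measurable_restricted_density restricted_density_ge0).

(** By continuity of J, [kappa] obeys the same local estimate as the one assumed for [nu]. *)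
Lemma density_dcube x0 : U x0 -> forall e : R, 0 < e -> exists L,
  forall l, (L <= l)%N -> forall k : 'rV[int]_n, dcube l k `<=` U ->
    (forall i, `|x0 ord0 i * 2 ^+ l - (k ord0 i)%:~R| <= 1) ->
    (kappa (dcube l k) <= ((J x0 + e) * (2 ^- l) ^+ n)%:E)%E /\
    (((J x0 - e) * (2 ^- l) ^+ n)%:E <= kappa (dcube l k))%E.
Proof.
move=> Ux0 e e0.
have /cvgrPdist_lt/(_ e e0)/nbhs_ballP[r /= r0 Hr] := cJ Ux0.
have [L HL] := exp2V_small (divr_gt0 r0 (ltr0n R 2)).
exists L => l Ll k kU kx0; have lr := HL l Ll; rewrite ltr_pdivlMr// in lr.
have p0 : 0 < 2 ^+ l :> R by exact: exprn_gt0.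
have JQ z : dcube l k z -> J x0 - e <= F z <= J x0 + e.
  move=> kz; rewrite /F indicE (mem_set (kU _ kz)) mulr1.
  have : `|J x0 - J z| < e.
    apply: Hr; split => // i' i; rewrite ord1 /ball/=.
    apply: le_lt_trans lr; rewrite mulrC -ler_pdivrMr ?invr_gt0// invrK.
    rewrite -{1}(gtr0_norm p0) -normrM mulrBl.
    have := kx0 i; have := dcube_mem kz i; rewrite !ler_norml => /andP[? ?] /andP[? ?].
    by apply/andP; split; lra.
  by rewrite ltr_norml => /andP[? ?]; apply/andP; split; lra.
have mF : measurable_fun (dcube l k) (EFin \o F).
  by apply/measurable_EFinP; apply: measurable_funTS; exact: measurable_restricted_density.
rewrite /= /density_measure; split.
  apply: (@le_trans _ _ (\int[m n]_(x in dcube l k) (cst (J x0 + e)%:E) x)%E).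
    apply: ge0_le_integral => //.
    - exact: measurable_dcube.
    - by move=> x _; rewrite lee_fin restricted_density_ge0.
    - by move=> x /JQ/andP[_ ?]; rewrite lee_fin.
  rewrite integral_cst; last exact: measurable_dcube.
  by rewrite -[X in (_ * X)%E]/(lebesgue_rV R n (dcube l k)) lebesgue_dcube.
(* A nonpositive lower bound is trivial; a positive one can be integrated as a constant. *)
have [Je|Je] := leP (J x0 - e) 0.
  apply: (@le_trans _ _ 0%E).
    by rewrite lee_fin mulr_le0_ge0// exprn_ge0// invr_ge0 ltW.
  by apply: integral_ge0 => x _; rewrite lee_fin restricted_density_ge0.
apply: (@le_trans _ _ (\int[m n]_(x in dcube l k) (cst (J x0 - e)%:E) x)%E).
  rewrite integral_cst; last exact: measurable_dcube.
  by rewrite -[X in (_ * X)%E]/(lebesgue_rV R n (dcube l k)) lebesgue_dcube.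
apply: ge0_le_integral => //.
- exact: measurable_dcube.
- by move=> x _; rewrite lee_fin ltW.
- by move=> x /JQ/andP[? _]; rewrite lee_fin.
Qed.

(** Both measures have density J x0 up to e / 2 near each point x0 of the closed cube, so bisection
    gives the two inequalities. *)
Lemma eq_density_dcube l k : closure (dcube l k) `<=` U ->
  nu (dcube l k) = kappa (dcube l k).
Proof.
move=> clU; apply/eqP; rewrite eq_le; apply/andP; split;
  apply: le_measure_dcube => x0 /clU Ux0 e e0;
  have e20 : 0 < e / 2 by [rewrite divr_gt0];
  have [L1 H1] := nuJ Ux0 e20; have [L2 H2] := density_dcube Ux0 e20;
  exists (maxn L1 L2) => l'; rewrite geq_max => /andP[l1 l2] k' kk kx;
  have k'U : dcube l' k' `<=` U by [apply: subset_trans clU;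
    apply: subset_trans kk _; exact: subset_closure];
  have [u1 v1] := H1 l' l1 k' kx; have [u2 v2] := H2 l' l2 k' k'U kx;
  [apply: le_trans u1 _ | apply: le_trans u2 _];
  [rewrite -leeBlDr// | rewrite -leeBlDr//];
  [apply: le_trans v2 | apply: le_trans v1];
  rewrite -EFinB lee_fin -mulrBl ler_wpM2r ?exprn_ge0 ?invr_ge0 ?exprn_ge0//; lra.
Qed.

(** U is covered by countably many cubes with closure in U and finite mass. The measures agree on
    the Borel subsets of each cube, hence, once the cover is made disjoint, on those of U; both
    vanish outside U. *)
Lemma eq_density A : measurable A -> nu A = kappa A.
Proof.
move=> mA.
pose good (x : nat * 'rV[int]_n) := closure (@dcube R n x.1 x.2) `<=` U /\
  (kappa (dcube x.1 x.2) < +oo)%E.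
pose G i : set 'rV[R]_n := if unpickle i is Some x then
  if pselect (good x) then dcube x.1 x.2 else set0 else set0.
have GP i : G i = set0 \/ exists l k, [/\ closure (@dcube R n l k) `<=` U,
    (kappa (dcube l k) < +oo)%E & G i = dcube l k].
  rewrite /G; case: unpickle => [[l k]|]; last by left.
  by case: pselect => [[? ?]|?]; [right; exists l, k|left].
have mG i : measurable (G i).
  by case: (GP i) => [->|[l [k [_ _ ->]]]]; [exact: measurable0|exact: measurable_dcube].
have GU : \bigcup_i G i = U.
  apply/seteqP; split=> [x [i _]|x Ux].
    case: (GP i) => [->//|[l [k [clU _ ->]]]] xk.
    by apply: clU; exact: subset_closure.
  have /cvgrPdist_lt/(_ 1 ltr01) H1 := cJ Ux.
  have : nbhs x (U `&` [set z | `|J x - J z| < 1]).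
    by apply: filterI => //; exact: open_nbhs_nbhs.
  move=> /nbhs_closedballP[r rU].
  have [l Hl] := dcube_small (near_ball x r%:num (gt0 r)).
  set k := dcube_idx l x.
  have kr : dcube l k `<=` ball x r%:num.
    by move=> w /dcube_mem; apply: Hl; exact/dcube_mem/dcube_idxP.
  have clk : closure (dcube l k) `<=` closed_ball x r%:num by exact: closure_subset.
  have gk : good (l, k).
    split; first by move=> w /clk/rU[].
    rewrite /= /density_measure.
    apply: (@le_lt_trans _ _ (\int[m n]_(z in dcube l k) (cst (J x + 1)%:E) z)%E).
      apply: ge0_le_integral => //.
      - exact: measurable_dcube.
      - by move=> z _; rewrite lee_fin restricted_density_ge0.
      - by apply/measurable_EFinP; apply: measurable_funTS; exact: measurable_restricted_density.
      - move=> z kz; have [Uz /=] : (U `&` [set z | `|J x - J z| < 1]) z.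
          by apply: rU; apply: subset_closed_ball; exact: kr.
        rewrite lee_fin /F indicE mem_set// mulr1 ltr_norml => /andP[? ?]; lra.
    rewrite integral_cst; last exact: measurable_dcube.
    by rewrite -[X in (_ * X)%E]/(lebesgue_rV R n (dcube l k)) lebesgue_dcube ltry.
  exists (pickle (l, k)) => //; rewrite /G pickleK /=; case: pselect => [ok|ko].
    exact: dcube_idxP.
  by case: ko.
have eqG i A' : measurable A' -> A' `<=` G i -> nu A' = kappa A'.
  move=> mA' A'G; case: (GP i) => [G0|[l [k [clU kfin GE]]]].
    by move: A'G; rewrite G0 subset0 => ->; rewrite !measure0.
  have mQ := @measurable_dcube R n l k.
  have sub l' k' : nu (dcube l' k' `&` dcube l k) = kappa (dcube l' k' `&` dcube l k).
    have : dcubes (@dcube R n l' k' `&` dcube l k).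
      by apply: dcubes_setI; right; [exists l', k'|exists l, k].
    case=> [->|[l1 [k1 E]]]; first by rewrite !measure0.
    rewrite E eq_density_dcube// -E; apply: subset_trans clU.
    by apply: closure_subset; exact: subIsetr.
  have := @eq_measure_dcube R n (mrestr nu mQ) (mrestr kappa mQ) sub _ A' mA'.
  rewrite /= /mrestr setIidl; last by rewrite -GE.
  apply=> k'; apply: le_lt_trans kfin; rewrite sub.
  apply: le_measure; rewrite ?inE//.
  by apply: measurableI => //; exact: measurable_dcube.
have eqU A' : measurable A' -> A' `<=` U -> nu A' = kappa A'.
  move=> mA' A'U.
  have A'E : A' = \bigcup_i (A' `&` seqDU G i).
    by rewrite -setI_bigcupr -seqDU_bigcup_eq GU setIidl.
  have mS i : measurable (A' `&` seqDU G i).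
    by apply: measurableI => //; exact: seqDU_measurable.
  have tS : trivIset setT (fun i => A' `&` seqDU G i).
    by apply: trivIset_setIl; exact: trivIset_seqDU.
  rewrite A'E !measure_bigcup//.
  apply: eq_eseriesr => i _; apply: (eqG i) => // x [_ []].
  by [].
have kU : kappa (~` U) = 0%E.
  rewrite /= /density_measure integral0_eq// => x /= Ux.
  by rewrite /F indicE memNset// mulr0.
have split_ (mu : {measure set 'rV[R]_n -> \bar R}) :
    mu (~` U) = 0%E -> mu A = mu (A `&` U).
  move=> muU; rewrite -[in LHS](setIT A) -(setUv U) setIUr measureU//.
  - rewrite [X in (_ + X)%E](_ : _ = 0%E) ?adde0//.
    apply: (subset_measure0 _ _ _ muU) => //.
    + by apply: measurableI => //; exact: measurableC.
    + exact: measurableC.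
  - exact: measurableI.
  - by apply: measurableI => //; exact: measurableC.
  - by rewrite setIACA setICr setI0.
rewrite (split_ nu)// (split_ kappa)//; apply: eqU => //.
exact: measurableI.
Qed.
End eq_density.

(** Lebesgue measure on W, pushed forward by g, has local density |det 'J f| at every point of U by
    [local_density]; [eq_density] makes this global, and phi is integrated against both
    descriptions. *)
Theorem change_of_variables n (f g : 'rV[R]_n.+1 -> 'rV[R]_n.+1)
    (U W : set 'rV[R]_n.+1) (phi : 'rV[R]_n.+1 -> \bar R) :
  open U -> open W ->
  (forall x, U x -> W (f x)) -> (forall y, W y -> U (g y)) ->
  (forall x, U x -> g (f x) = x) -> (forall y, W y -> f (g y) = y) ->
  (forall x, U x -> differentiable f x) -> (forall y, W y -> differentiable g y) ->
  (forall x, U x -> {for x, continuous (fun z => 'J f z)}) ->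
  measurable_fun setT phi -> (forall x, 0 <= phi x)%E ->
  (\int[m n.+1]_(y in W) phi (g y) =
   \int[m n.+1]_(x in U) (phi x * `|\det ('J f x)|%:E))%E.
Proof.
move=> oU oW fUW gWU gfK fgK df dg cJ mphi phi0.
have mW : measurable W by exact: open_measurable_rV.
have mU : measurable U by exact: open_measurable_rV.
have mgW : measurable_fun W g.
  by apply: measurable_fun_open_rV => // y Wy; exact/differentiable_continuous/dg.
(* Extended by zero, since the pushforward asks for a map measurable on the whole space. *)
pose g' := g \_ W.
have g'E y : W y -> g' y = g y by move=> Wy; rewrite /g' patchE mem_set.
have mg' : measurable_fun setT g' by apply/(measurable_restrictT _ mW).
have W0 x : 0 <= \1_W x :> R by rewrite indicE.
pose mW1 := density (m n.+1) (measurable_indic mW : measurable_fun setT (\1_W : _ -> R))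
  W0.
pose nu := pushforward_measure mW1 mg'.
have nuE A : measurable A -> nu A = m n.+1 (W `&` g @^-1` A).
  move=> mA; rewrite /nu /= /pushforward /density_measure integral_indic//.
    by congr (m _ _); apply/seteqP; split=> y /= [Wy]; rewrite ?g'E.
  by rewrite -[X in measurable X]setTI; exact (mg' measurableT A mA).
have mWg A : measurable A -> measurable (W `&` g @^-1` A) by move=> mA; exact: mgW.
have J0 x : 0 <= `|\det ('J f x)| by exact: normr_ge0.
have cdJ x : U x -> {for x, continuous (fun z => `|\det ('J f z)|)}.
  move=> Ux; exact: (cvg_norm (continuous_det (cJ x Ux))).
have nuU : nu (~` U) = 0%E.
  rewrite nuE; last exact: measurableC.
  by rewrite (_ : _ `&` _ = set0) ?measure0//; apply/seteqP; split=> y // [/gWU].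
have nuJ x0 : U x0 -> forall e : R, 0 < e -> exists L,
  forall l, (L <= l)%N -> forall k : 'rV[int]_n.+1,
    (forall i, `|x0 ord0 i * 2 ^+ l - (k ord0 i)%:~R| <= 1) ->
    (nu (dcube l k) <= ((`|\det ('J f x0)| + e) * (2 ^- l) ^+ n.+1)%:E)%E /\
    (((`|\det ('J f x0)| - e) * (2 ^- l) ^+ n.+1)%:E <= nu (dcube l k))%E.
  move=> Ux0 e e0.
  have gfx0 : \forall z \near x0, g (f z) = z.
    apply: filterS (open_nbhs_nbhs (conj oU Ux0)) => z; exact: gfK.
  have [L HL] := local_density oW mWg (fUW _ Ux0) fgK gfx0 (df _ Ux0) (dg _ (fUW _ Ux0)) e0.
  exists L => l Ll k kx0; rewrite nuE; last exact: measurable_dcube.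
  exact: HL.
have nu_kappa := eq_density oU J0 cdJ nuU nuJ.
have -> : (\int[m n.+1]_(y in W) phi (g y) = \int[nu]_x phi x)%E.
  have -> : (\int[nu]_x phi x = \int[mW1]_(y in g' @^-1` setT) (phi \o g') y)%E.
    by apply: (@ge0_integral_pushforward _ _ _ _ _ _ mg' mW1).
  have mpg : measurable_fun setT (phi \o g').
    by apply: measurableT_comp => //; exact mg'.
  have pg0 x : (0 <= (phi \o g') x)%E by exact: phi0.
  rewrite preimage_setT ge0_integral_density//.
  rewrite [LHS]integral_mkcond; congr (integral _ _ _); apply/funext => y.
  rewrite patchE /= indicE; case: ifPn => [/set_mem Wy|_].
    by rewrite g'E// mule1.
  by rewrite mule0.
rewrite (eq_measure_integral (density (m n.+1)
  (measurable_restricted_density oU cdJ) (restricted_density_ge0 U J0))).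
  rewrite ge0_integral_density// [RHS]integral_mkcond.
  apply: eq_integral => x _; rewrite patchE /restricted_density indicE.
  by case: ifPn => _; rewrite ?mulr1 ?mulr0 ?mule0.
by move=> A mA _; exact: nu_kappa.
Qed.

End change_of_variables.

(** * Duality for the transfer operator *)

Section branch.
Context (R : realType).
Local Notation m := (lebesgue_rV R).

Lemma near_eq_differentiable n p (f g : 'rV[R]_n -> 'rV[R]_p) (x : 'rV[R]_n) :
  (\forall z \near x, f z = g z) -> differentiable f x -> differentiable g x.
Proof.
move=> fg df; have fgx := nbhs_singleton fg.
have o : g \o shift x = cst (g x) + 'd f x +o_ (0 : 'rV[R]_n) id.
  apply/eqaddoP => e e0; have /eqaddoP /(_ e e0) := diff_locally df.
  have : \forall z \near (0 : 'rV[R]_n), f (z + x) = g (z + x).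
    move/nbhs_ballP : fg => [d /= d0 fg]; apply/nbhs_ballP; exists d => //= z.
    rewrite !mx_norm_ball /ball_ /= sub0r normrN => zd; apply: fg.
    by rewrite mx_norm_ball /ball_ /= opprD addrCA subrr addr0 normrN.
  by apply: filterS2 => z fgz; rewrite !fctE /= fgz fgx.
have dg := diff_unique (diff_continuous df) o.
apply/diff_locallyP; rewrite dg; exact: (conj (diff_continuous df) o).
Qed.

Lemma eucl_dist_le n (x y : 'rV[R]_n) : eucl_dist x y <= n%:R * `|x - y|.
Proof.
have K0 : 0 <= n%:R * `|x - y| by rewrite mulr_ge0.
rewrite -[leRHS](ger0_norm K0) -sqrtr_sqr /eucl_dist ler_wsqrtr//.
apply: (@le_trans _ _ (\sum_(i < n) `|x - y| ^+ 2)).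
  apply: ler_sum => i _; rewrite -[leLHS]real_normK ?num_real// ler_pXn2r ?nnegrE//.
  by have := rV_norm_coord (x - y) i; rewrite !mxE.
rewrite sumr_const card_ord -[leLHS]mulr_natl exprMn ler_wpM2r ?sqr_ge0//.
by rewrite -natrX ler_nat; case: n {x y K0} => // n; exact: leq_pmulr.
Qed.

Lemma nbhs_nbhd_set n (e : R) (K : set 'rV[R]_n) y : 0 < e -> K y ->
  nbhs y (nbhd_set e K).
Proof.
move=> e0 Ky; apply/nbhs_ballP; have n0 : 0 < n%:R + 1 :> R by rewrite ltr_wpDl.
exists (e / (n%:R + 1)); first by rewrite /= divr_gt0.
move=> z; rewrite mx_norm_ball /ball_ /= ltr_pdivlMr// => zy.
rewrite /nbhd_set /= /dist_set (@le_lt_trans _ _ (eucl_dist z y)%:E)//.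
  by apply: ereal_inf_lbound; exists y.
rewrite lte_fin (le_lt_trans (eucl_dist_le _ _))// (le_lt_trans _ zy)//.
by rewrite distrC mulrC ler_wpM2l// lerDl.
Qed.

(** [change_of_variables] with the inverse branch h in the role of the map; the chain rule turns the
    weight |det 'J T|^-1 at h y into |det 'J h| at y. *)
Lemma integral_branch n (T h : 'rV[R]_n.+1 -> 'rV[R]_n.+1)
    (U W : set 'rV[R]_n.+1) (B : set 'rV[R]_n.+1) (G : 'rV[R]_n.+1 -> \bar R) :
  open U -> open W ->
  (forall y, W y -> U (h y)) -> (forall x, U x -> W (T x)) ->
  (forall y, W y -> T (h y) = y) -> (forall x, U x -> h (T x) = x) ->
  (forall y, W y -> differentiable h y) -> (forall x, U x -> differentiable T x) ->
  (forall y, W y -> {for y, continuous (fun z => 'J h z)}) ->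
  measurable B -> measurable_fun setT G -> (forall x, 0 <= G x)%E ->
  (\int[m n.+1]_(y in W `&` B) (G (h y) * (`|\det ('J T (h y))|^-1)%:E) =
   \int[m n.+1]_(x in U `&` T @^-1` B) G x)%E.
Proof.
move=> oU oW hWU TUW ThK hTK dh dT cJ mB mG G0.
have mW : measurable W by exact: open_measurable_rV.
have mhW : measurable_fun W h.
  by apply: measurable_fun_open_rV => // y Wy; exact/differentiable_continuous/dh.
have mWB : measurable (W `&` B) by exact: measurableI.
pose phi := (G \o h) \_ (W `&` B).
have mphi : measurable_fun setT phi.
  apply/(measurable_restrictT _ mWB); apply: measurableT_comp => //.
  by apply: measurable_funS mhW => //; exact: subIsetl.
have phi0 y : (0 <= phi y)%E by rewrite /phi patchE; case: ifP => _; [exact: G0|exact: lexx].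
have := @change_of_variables R n h T W U phi oW oU hWU TUW ThK hTK dh dT cJ mphi phi0.
have -> : (\int[m n.+1]_(x in U) phi (T x) =
    \int[m n.+1]_(x in U `&` T @^-1` B) G x)%E.
  rewrite integral_mkcond [RHS]integral_mkcond; congr (integral _ _ _).
  apply/funext => x; rewrite !patchE; case: ifPn => [/set_mem Ux|/negP nU]; last first.
    by case: ifPn => // /set_mem[Ux _]; case: nU; exact/mem_set.
  rewrite /phi patchE; case: ifPn => [/set_mem[_ Bx]|/negP nB].
    by rewrite /= hTK// mem_set//; split.
  case: ifPn => // /set_mem[_ Bx]; case: nB; apply/mem_set; split => //.
  exact: TUW.
move=> ->; rewrite integral_mkcond [RHS]integral_mkcond; congr (integral _ _ _).
apply/funext => y; rewrite !patchE.
case: ifPn => [/set_mem[Wy By]|/negP nWB]; last first.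
  case: ifPn => // /set_mem Wy; rewrite /phi patchE; case: ifPn => [/set_mem //|_].
  by rewrite mul0e.
rewrite mem_set// /phi patchE mem_set; last by split.
rewrite /=; congr (_ * _%:E)%E.
have nT : \forall z \near h y, h (T z) = z.
  by apply: filterS (open_nbhs_nbhs (conj oU (hWU _ Wy))) => z; exact: hTK.
have := jacobian_cancel (dT _ (hWU _ Wy)).
rewrite ThK// => /(_ _ (dh _ Wy) nT) JJ.
suff inv_eq (a b : R) : a * b = 1 -> a^-1 = b.
  by apply: inv_eq; rewrite -normrM -det_mulmx JJ det1 normr1.
move=> ab; have a0 : a != 0.
  by apply/eqP => a0; move/eqP : ab; rewrite a0 mul0r eq_sym oner_eq0.
by rewrite -[RHS](mulKf a0) ab mulr1.
Qed.

End branch.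

Section duality.
Context (R : realType) (n : nat) (Om : ptopologicalType).
Local Notation m := (lebesgue_rV R n.+1).
Local Notation E := 'rV[R]_n.+1.
Variables (C : set E) (T : borel Om -> E -> E) (B : branches R n.+1 Om).
Variables (w : borel Om) (e0 : R).
Hypotheses (wf : branches_wf C B) (e00 : 0 < e0).
Hypothesis pe2 : forall i, br_idx B w i ->
    {in br_U B w i, T w =1 br_map B w i} /\
    nbhd_set e0 (br_map B w i @` br_U B w i) `<=` br_map B w i @` br_V B w i.
Hypothesis pe3 : forall i, br_idx B w i ->
    [/\ C1_on (br_V B w i) (br_map B w i),
        {in br_V B w i &, injective (br_map B w i)} &
        C1_on (br_map B w i @` br_V B w i) (br_inv B w i)].
Hypothesis pe4 : m (C `\` \bigcup_(i in br_idx B w) br_U B w i) = 0%E.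
Hypothesis mC : measurable C.
Hypothesis mT : forall A, measurable A -> measurable (C `&` T w @^-1` A).

Local Notation U := (br_U B w).
Local Notation h := (br_inv B w).
Local Notation W i := (T w @` U i).

Lemma br_U_V i : br_idx B w i -> U i `<=` br_V B w i.
Proof.
by move=> Ii; apply: subset_trans (wf_V_closure wf Ii); exact: subset_closure.
Qed.

Lemma br_TE i x : br_idx B w i -> U i x -> T w x = br_map B w i x.
Proof. by move=> /pe2[H _] Ux; apply: H; exact/mem_set. Qed.

Lemma br_invK i x : br_idx B w i -> U i x -> h i (T w x) = x.
Proof.
move=> Ii Ux; rewrite (br_TE Ii Ux) /br_inv pinvKV//; last exact/mem_set/(br_U_V Ii).
by have [_ ? _] := pe3 Ii.
Qed.

Lemma br_invP i y : br_idx B w i -> W i y -> U i (h i y) /\ T w (h i y) = y.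
Proof. by move=> Ii [x Ux <-]; rewrite br_invK. Qed.

Lemma br_W_V i y : br_idx B w i -> W i y -> nbhs y (br_map B w i @` br_V B w i).
Proof.
move=> Ii [x Ux <-]; have [_ H] := pe2 Ii.
apply: filterS H _; apply: nbhs_nbhd_set => //.
by exists x => //; rewrite (br_TE Ii Ux).
Qed.

Lemma br_inv_differentiable i y : br_idx B w i -> W i y -> differentiable (h i) y.
Proof.
move=> Ii Wy; have [_ _ [H _]] := pe3 Ii; apply: H.
exact: nbhs_singleton (br_W_V Ii Wy).
Qed.

Lemma br_inv_continuousJ i y : br_idx B w i -> W i y ->
  {for y, continuous (fun z => 'J (h i) z)}.
Proof.
move=> Ii Wy; have [_ _ [_ H]] := pe3 Ii; apply: H.
exact: nbhs_singleton (br_W_V Ii Wy).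
Qed.

(** PE2 places a whole neighbourhood of y in the domain of the inverse branch, which is continuous
    at y, so nearby points are also sent into the open set U i. *)
Lemma br_W_open i : br_idx B w i -> open (W i).
Proof.
move=> Ii; rewrite openE => y Wy.
have [Uhy _] := br_invP Ii Wy.
have hU : nbhs y (h i @^-1` U i).
  apply: (differentiable_continuous (br_inv_differentiable Ii Wy)).
  by apply: open_nbhs_nbhs; split => //; exact: (wf_U_open wf Ii).
apply: filterS2 (br_W_V Ii Wy) hU => z [v Vv vz] Uhz.
exists (h i z) => //; rewrite (br_TE Ii Uhz) -[in LHS]vz /br_inv pinvKV ?vz//.
- by have [_ ? _] := pe3 Ii.
- exact/mem_set.
Qed.

Lemma br_T_differentiable i x : br_idx B w i -> U i x -> differentiable (T w) x.
Proof.
move=> Ii Ux; have [[H _] _ _] := pe3 Ii.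
apply: near_eq_differentiable (H _ (br_U_V Ii Ux)).
apply: filterS (open_nbhs_nbhs (conj (wf_U_open wf Ii) Ux)) => z Uz.
by rewrite (br_TE Ii Uz).
Qed.

Let mW i : br_idx B w i -> measurable (W i).
Proof. by move=> Ii; apply: open_measurable_rV; exact: br_W_open. Qed.

Lemma integral_br_term i (G : E -> \bar R) D : br_idx B w i ->
  measurable D -> measurable_fun setT G -> (forall x, 0 <= G x)%E ->
  (\int[m]_(y in D) (G (h i y) * (`|\det ('J (T w) (h i y))|^-1 * \1_(W i) y)%:E) =
   \int[m]_(x in U i `&` T w @^-1` D) G x)%E.
Proof.
move=> Ii mD mG G0.
rewrite -(@integral_branch R n (T w) (h i) (U i) (W i) D G)//.
- rewrite integral_mkcond [RHS]integral_mkcond; congr (integral _ _ _).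
  apply/funext => y; rewrite !patchE indicE; case: ifPn => [/set_mem Dy|/negP nD].
    case: ifPn => [/set_mem[Wy _]|/negP nWD]; first by rewrite mem_set// mulr1.
    rewrite (_ : (y \in W i) = false) ?mulr0 ?mule0//.
    by apply/negP => /set_mem Wy; apply: nWD; exact/mem_set.
  by case: ifPn => // /set_mem[_ Dy]; case: nD; exact/mem_set.
- exact: (wf_U_open wf Ii).
- exact: br_W_open.
- by move=> y /(br_invP Ii)[].
- by move=> y /(br_invP Ii)[].
- by move=> x; exact: br_invK.
- by move=> y; exact: br_inv_differentiable.
- by move=> x; exact: br_T_differentiable.
- by move=> y; exact: br_inv_continuousJ.
Qed.

Lemma det_br_inv i y : br_idx B w i -> W i y ->
  `|\det ('J (T w) (h i y))|^-1 = `|\det ('J (h i) y)|.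
Proof.
move=> Ii Wy; have [Uhy Thy] := br_invP Ii Wy.
have nT : \forall z \near h i y, h i (T w z) = z.
  apply: filterS (open_nbhs_nbhs (conj (wf_U_open wf Ii) Uhy)) => z.
  exact: br_invK.
have := jacobian_cancel (br_T_differentiable Ii Uhy).
rewrite Thy => /(_ _ (br_inv_differentiable Ii Wy) nT) JJ.
suff inv_eq (a b : R) : a * b = 1 -> a^-1 = b.
  by apply: inv_eq; rewrite -normrM -det_mulmx JJ det1 normr1.
move=> ab; have a0 : a != 0.
  by apply/eqP => a0; move/eqP : ab; rewrite a0 mul0r eq_sym oner_eq0.
by rewrite -[RHS](mulKf a0) ab mulr1.
Qed.

Variable (f : E -> R).
Hypothesis intf : m.-integrable setT (EFin \o f).

Let mf : measurable_fun setT f.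
Proof. by apply/measurable_EFinP; exact: measurable_int intf. Qed.

(** Zero at the indices outside [br_idx], so that the series runs over all of nat. *)
Let t i x : R := if `[< br_idx B w i >] then
  f (h i x) / `|\det ('J (T w) (h i x))| * \1_(W i) x else 0.

Let mt i : measurable_fun setT (t i).
Proof.
rewrite /t; case: asboolP => [Ii|_]; last exact: measurable_cst.
have -> : (fun x => f (h i x) / `|\det ('J (T w) (h i x))| * \1_(W i) x) =
  ((fun x => f (h i x) * `|\det ('J (h i) x)|) : _ -> measurableTypeR R) \_ (W i).
  apply/funext => y; rewrite patchE indicE; case: ifPn => [/set_mem Wy|_].
    by rewrite mulr1 (det_br_inv Ii Wy).
  by rewrite mulr0.
apply/(@measurable_restrictT _ _ _ (measurableTypeR R) _ _ (mW Ii)).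
apply: measurable_funM.
  apply: measurableT_comp => //; apply: measurable_fun_open_rV; first exact: br_W_open.
  by move=> y Wy; exact/differentiable_continuous/br_inv_differentiable.
apply: measurable_fun_open_R; first exact: br_W_open.
by move=> y Wy; exact: (cvg_norm (continuous_det (br_inv_continuousJ Ii Wy))).
Qed.

Let V i : set E := if `[< br_idx B w i >] then U i else set0.

Let mV i : measurable (V i).
Proof.
rewrite /V; case: asboolP => [Ii|_]; last exact: measurable0.
by apply: open_measurable_rV; exact: (wf_U_open wf Ii).
Qed.

Let VC i : V i `<=` C.
Proof. by rewrite /V; case: asboolP => [Ii|_ ? //]; exact: (wf_U_sub wf Ii). Qed.

Let bigV : \bigcup_i V i = \bigcup_(i in br_idx B w) U i.
Proof.
apply/seteqP; split=> [x [i _]|x [i Ii Ux]].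
  by rewrite /V; case: asboolP => // Ii Ux; exists i.
by exists i => //; rewrite /V asboolT.
Qed.

Let tV : trivIset setT V.
Proof.
move=> i j _ _ [x []]; rewrite /V.
case: asboolP => // Ii Uix; case: asboolP => // Ij Ujx.
by apply: (wf_U_disjoint wf (w := w)) => //; exists x.
Qed.

Let mVT i D : measurable D -> measurable (V i `&` T w @^-1` D).
Proof.
move=> mD; have -> : V i `&` T w @^-1` D = V i `&` (C `&` T w @^-1` D).
  by apply/seteqP; split=> x [Vx] => [Dx|[_ Dx]]; split => //; split => //; exact: (VC Vx).
by apply: measurableI => //; exact: mT.
Qed.

(** A general nonnegative G serves for |f| and for the positive and negative parts of f alike,
    because the weights are nonnegative and commute with these operations. *)
Let int_t (G H : E -> \bar R) i D : measurable D ->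
  measurable_fun setT G -> (forall x, 0 <= G x)%E ->
  (forall x, br_idx B w i ->
     H x = (G (h i x) * (`|\det ('J (T w) (h i x))|^-1 * \1_(W i) x)%:E)%E) ->
  (forall x, ~ br_idx B w i -> H x = 0%E) ->
  (\int[m]_(x in D) H x = \int[m]_(x in V i `&` T w @^-1` D) G x)%E.
Proof.
move=> mD mG G0 HI HnI; rewrite /V; case: asboolP => [Ii|nI].
  rewrite -(integral_br_term Ii mD mG G0); congr (integral _ _ _).
  by apply/funext => x; rewrite HI.
rewrite set0I integral_set0; apply: integral0_eq => x _; exact: HnI.
Qed.

Let c_ge0 i x : 0 <= `|\det ('J (T w) (h i x))|^-1 * \1_(W i) x :> R.
Proof. by rewrite mulr_ge0. Qed.

Let tE i x : br_idx B w i -> t i x =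
  f (h i x) * (`|\det ('J (T w) (h i x))|^-1 * \1_(W i) x).
Proof. by move=> Ii; rewrite /t asboolT// mulrA. Qed.

Let tE0 i x : ~ br_idx B w i -> t i x = 0.
Proof. by move=> nI; rewrite /t asboolF. Qed.

Let int_abs_t i D : measurable D ->
  (\int[m]_(x in D) `|(t i x)%:E| = \int[m]_(x in V i `&` T w @^-1` D) `|(f x)%:E|)%E.
Proof.
move=> mD; apply: (@int_t (fun x => `|(f x)%:E|)%E) => // [|x Ii|x nI].
- by apply/measurableT_comp/measurable_EFinP.
- by rewrite (tE _ Ii) EFinM abseM /= (ger0_norm (c_ge0 _ _)).
- by rewrite (tE0 _ nI) abse0.
Qed.

Let intg_t i : m.-integrable setT (EFin \o t i).
Proof.
apply/integrableP; split; first exact/measurable_EFinP.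
rewrite int_abs_t//; have [_] := integrableP _ _ _ intf; apply: le_lt_trans.
apply: ge0_subset_integral => //; first exact: mVT.
by apply/measurableT_comp/measurable_EFinP.
Qed.

Let int_tE i D : measurable D ->
  (\int[m]_(x in D) (t i x)%:E = \int[m]_(x in V i `&` T w @^-1` D) (f x)%:E)%E.
Proof.
move=> mD; rewrite integralE [RHS]integralE; congr (_ - _)%E.
  apply: (@int_t (EFin \o f)^\+%E) => // [|x Ii|x nI].
  - by apply: measurable_funepos; exact/measurable_EFinP.
  - by rewrite !funeposE /= (tE _ Ii) -!EFin_max -EFinM maxr_pMl// mul0r.
  - by rewrite !funeposE /= (tE0 _ nI) maxxx.
apply: (@int_t (EFin \o f)^\-%E) => // [|x Ii|x nI].
- by apply: measurable_funeneg; exact/measurable_EFinP.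
- by rewrite !funenegE /= (tE _ Ii) -!EFin_max -EFinM maxr_pMl// mul0r mulNr.
- by rewrite !funenegE /= (tE0 _ nI) oppr0 maxxx.
Qed.

(** Dominates all partial sums; its integral is that of |f| over a disjoint union of branch domains,
    hence finite. *)
Let g x : \bar R := (\sum_(i <oo) `|(t i x)%:E|)%E.

Let mabsf : measurable_fun setT (fun x => `|(f x)%:E|)%E.
Proof. by apply/measurableT_comp/measurable_EFinP. Qed.

Let mabs_t i : measurable_fun setT (fun x => `|(t i x)%:E|)%E.
Proof. by apply/measurableT_comp/measurable_EFinP. Qed.

Let intg_g : m.-integrable setT g.
Proof.
apply/integrableP; split.
  by apply: ge0_emeasurable_sum => // i x _ _; exact: abse_ge0.
under eq_integral.
  move=> x _; rewrite gee0_abs; last by apply: nneseries_ge0 => i _ _; exact: abse_ge0.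
  over.
rewrite /g integral_nneseries//.
under eq_eseriesr do rewrite int_abs_t//.
rewrite -ge0_integral_bigcup//.
- have [_] := integrableP _ _ _ intf; apply: le_lt_trans.
  apply: ge0_subset_integral => //; first by apply: bigcupT_measurable => i; exact: mVT.
- by move=> i; exact: mVT.
- by apply: measurable_funTS; exact: mabsf.
- by apply: trivIset_setIr; exact: tV.
Qed.

Let s_ k x : R := \sum_(0 <= i < k) t i x.

Let s_E k x : s_ k x = \sum_(0 <= i < k | `[< br_idx B w i >])
    (let y := h i x in f y / `|\det ('J (T w) y)| * \1_(W i) x).
Proof. by rewrite /s_ [RHS]big_mkcond. Qed.

Let s_le_g k x : (`|(s_ k x)%:E| <= g x)%E.
Proof.
rewrite /s_ -sumEFin (le_trans (lee_abs_sum _ _ _))//.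
by apply: nneseries_lim_ge => *; exact: abse_ge0.
Qed.

Let cvg_s : {ae m, forall x, setT x -> (s_ k x)%:E @[k --> \oo] --> (transfer T B w f x)%:E}.
Proof.
have := integrable_ae measurableT intg_g.
apply: filterS => x gfin _; have {gfin} gfin := gfin I.
apply: cvg_EFin; first exact: nearW.
have -> : transfer T B w f x = limn (s_ ^~ x).
  by rewrite /transfer; congr (limn _); apply/funext => k; rewrite s_E.
have cn : cvgn [normed series (t ^~ x)].
  apply: nondecreasing_is_cvgn.
    by apply: nondecreasing_series => i _ _; exact: normr_ge0.
  exists (fine (g x)) => _ [k _ <-]; rewrite -lee_fin fineK//.
  rewrite /series /= -sumEFin.
  by apply: (@nneseries_lim_ge _ (fun i => `|(t i x)%:E|%E) xpredT) => *; exact: abse_ge0.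
exact: (normed_cvg cn).
Qed.

(** Each term is integrated by the change of variables; the partial sums are dominated by g and
    converge almost everywhere, so the integral passes to the limit. *)
Lemma transfer_duality D : measurable D ->
  measurable_fun setT (transfer T B w f) ->
  (forall x, ~ C x -> f x = 0) ->
  (\int[m]_(x in D) (transfer T B w f x)%:E =
   \int[m]_(x in C `&` T w @^-1` D) (f x)%:E)%E.
Proof.
move=> mD mtr f0.
have sI k : (\int[m]_(x in D) (s_ k x)%:E =
    \sum_(0 <= i < k) \int[m]_(x in V i `&` T w @^-1` D) (f x)%:E)%E.
  under eq_integral do rewrite /s_ -sumEFin.
  rewrite integral_sum//; first by apply: eq_bigr => i _; exact: int_tE.
  by move=> i; apply: integrableS (intg_t i).
have ms k : measurable_fun D (fun x => (s_ k x)%:E).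
  apply/measurable_EFinP/measurable_funTS; apply: measurable_sum => i; exact: mt.
have mtrD : measurable_fun D (EFin \o transfer T B w f).
  by apply/measurable_EFinP; exact: measurable_funTS.
have gD : m.-integrable D g by apply: integrableS intg_g.
have cD : {ae m, forall x, D x -> (s_ k x)%:E @[k --> \oo] --> (EFin \o transfer T B w f) x}.
  by apply: filterS cvg_s => x + _ => /(_ I).
have bD : {ae m, forall x k, D x -> (`|(s_ k x)%:E| <= g x)%E}.
  by apply: aeW => x k _; exact: s_le_g.
have [_ _ lim1] := dominated_convergence mD ms mtrD cD gD bD.
have tVT : trivIset setT (fun i => V i `&` T w @^-1` D).
  by apply: trivIset_setIr; exact: tV.
have mbig : measurable (\bigcup_i (V i `&` T w @^-1` D)).
  by apply: bigcupT_measurable => i; exact: mVT.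
have lim2 : (\int[m]_(x in \bigcup_i (V i `&` T w @^-1` D)) (f x)%:E =
    \sum_(i <oo) \int[m]_(x in V i `&` T w @^-1` D) (f x)%:E)%E.
  apply: integral_bigcup => //; first by move=> i; exact: mVT.
  by apply: integrableS intf.
have -> : (\int[m]_(x in D) (transfer T B w f x)%:E =
    \int[m]_(x in \bigcup_i (V i `&` T w @^-1` D)) (f x)%:E)%E.
  rewrite lim2 -(cvg_lim (@ereal_hausdorff R) lim1).
  by apply: congr_lim; apply/funext => k; exact: sI.
set A := \bigcup_i _ in mbig *.
set A' := C `&` T w @^-1` D.
have mA' : measurable A' by exact: mT.
have AA' : A `<=` A'.
  by move=> x [i _ [Vx Dx]]; split=> //; exact: VC Vx.
(* By PE4 the branch domains miss only a null part of C. *)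
have N0 : m (A' `\` A) = 0%E.
  apply: subset_measure0 pe4; first exact: measurableD.
    rewrite -bigV; apply: measurableD => //.
    by apply: bigcupT_measurable.
  move=> x [[Cx Dx] nA]; split=> // -[i Ii Ux]; apply: nA.
  by exists i => //; split=> //; rewrite /V asboolT.
rewrite [RHS](negligible_integral (measurableD mA' mbig))//.
  congr (integral _ _ _); apply/seteqP; split=> [x Ax|x [A'x nx]].
    by split; [exact: AA'|case].
  by apply: contrapT => nA; apply: nx.
by apply: integrableS intf.
Qed.

End duality.

(** * Functions of bounded oscillation *)

Section lower_integral.
Context d (T : measurableType d) (R : realType) (mu : {measure set T -> \bar R}).
Implicit Types a b : T -> \bar R.
Import HBNNSimple.

(* The library's integral of a nonnegative function is a supremum over simple
   minorants, which makes sense, and is monotone, without measurability. *)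
Lemma le_lower_integral a b : (forall x, 0 <= a x)%E ->
  (forall x, a x <= b x)%E -> (\int[mu]_x a x <= \int[mu]_x b x)%E.
Proof.
move=> a0 ab; have b0 x : (0 <= b x)%E by exact: le_trans (a0 x) (ab x).
rewrite !ge0_integralTE//; apply: ereal_sup_le => _ [h ha <-].
by exists h => // x; exact: le_trans (ha x) (ab x).
Qed.

Lemma lower_integralZ a (t : R) : 0 < t -> (forall x, 0 <= a x)%E ->
  (\int[mu]_x (t%:E * a x) <= t%:E * \int[mu]_x a x)%E.
Proof.
move=> t0 a0; rewrite [leLHS]ge0_integralTE; last first.
  by move=> x; rewrite mule_ge0// lee_fin ltW.
apply: ge_ereal_sup => _ [h ha <-].
have ti0 : 0 <= t^-1 by rewrite invr_ge0 ltW.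
pose h' := scale_nnsfun h ti0.
have -> : sintegral mu h = (t%:E * sintegral mu h')%E.
  rewrite -sintegralrM; congr (sintegral mu _); apply/funext => x /=.
  by rewrite mulrA mulfV ?mul1r// gt_eqF.
rewrite lee_pmul2l//.
rewrite [leRHS]ge0_integralTE//; apply: ereal_sup_ubound; exists h' => // x /=.
rewrite -(@lee_pmul2l _ t%:E) ?lte_fin//; apply: le_trans (ha x).
by rewrite -EFinM mulrA mulfV ?mul1r// gt_eqF.
Qed.

(** Lower integrals are not subadditive in general. With b measurable, a simple minorant h of a + b
    yields the measurable function (h - b)^+, which is a minorant of a. *)
Lemma lower_integralD a b : (forall x, 0 <= a x)%E -> (forall x, 0 <= b x)%E ->
  measurable_fun setT b ->
  (\int[mu]_x (a x + b x) <= \int[mu]_x a x + \int[mu]_x b x)%E.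
Proof.
move=> a0 b0 mb; rewrite [leLHS]ge0_integralTE; last first.
  by move=> x; rewrite adde_ge0.
apply: ge_ereal_sup => _ [h hab <-].
rewrite -integralT_nnsfun.
pose g x : \bar R := (maxe ((h x)%:E - b x) 0)%E.
have mg : measurable_fun setT g.
  apply: measurable_maxe => //; apply: emeasurable_funB => //.
  exact/measurable_EFinP.
have g0 x : (0 <= g x)%E by rewrite /g le_max lexx orbT.
apply: (@le_trans _ _ (\int[mu]_x (g x + b x))%E).
  apply: le_lower_integral => x; first by rewrite lee_fin.
  rewrite /g; have := b0 x; case: (b x) => [r|_|//].
    rewrite lee_fin => r0; rewrite -EFinB -EFin_max -EFinD lee_fin.
    by rewrite -lerBlDr le_max lexx.
  by rewrite addey ?leey// -ltNye (@lt_le_trans _ _ 0%E)// le_max lexx orbT.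
rewrite ge0_integralD//; apply: leeD => //.
apply: le_lower_integral => // x; rewrite /g ge_max a0 andbT.
have := hab x; have := b0 x; case: (b x) => [r||//] _ /=; last by rewrite leNye.
by move=> ?; rewrite EFinN leeBlDr.
Qed.

End lower_integral.

Section quasi_hoelder.
Context (R : realType) (N : nat).
Local Notation m := (lebesgue_rV R N).
Local Notation E := 'rV[R]_N.
Implicit Types (f : E -> R) (K C : set E).

Lemma lebesgue_open_gt0 (U : set E) (x : E) : nbhs x U -> ~ m.-negligible U.
Proof.
move=> /dcube_small[l Hl] [A [mA A0 UA]].
pose k := dcube_idx l x.
have kU : dcube l k `<=` U.
  by move=> w /dcube_mem; apply: Hl; exact/dcube_mem/dcube_idxP.
have : (m (dcube l k) <= 0)%E.
  rewrite -A0; apply: le_measure; rewrite ?inE//; first exact: measurable_dcube.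
  exact: subset_trans UA.
by rewrite lebesgue_dcube lee_fin leNgt exprn_gt0// invr_gt0 exprn_gt0.
Qed.

Lemma nbhs_eucl_ball (e : R) (x : E) : 0 < e -> nbhs x (eucl_ball e x).
Proof.
move=> e0; have n0 : 0 < N%:R + 1 :> R by rewrite ltr_wpDl.
apply/nbhs_ballP; exists (e / (N%:R + 1)); first by rewrite /= divr_gt0.
move=> z; rewrite mx_norm_ball /ball_ /= ltr_pdivlMr// => zy.
rewrite /eucl_ball /= (le_lt_trans (eucl_dist_le _ _))// (le_lt_trans _ zy)//.
by rewrite mulrC ler_wpM2l// lerDl.
Qed.

Lemma eucl_ball_notnegl (e : R) (x : E) : 0 < e -> ~ m.-negligible (eucl_ball e x).
Proof. by move=> e0; apply: (@lebesgue_open_gt0 _ x); exact: nbhs_eucl_ball. Qed.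

Lemma norm_le_eucl_dist (x y : E) : `|x - y| <= eucl_dist x y.
Proof.
apply/rV_normP => [|i]; first exact: sqrtr_ge0.
rewrite !mxE -sqrtr_sqr /eucl_dist ler_wsqrtr//.
by rewrite (bigD1 i)//= lerDl sumr_ge0// => j _; rewrite sqr_ge0.
Qed.

Lemma ae_meets K (Q : E -> Prop) : ~ m.-negligible K ->
  {ae m, forall x, K x -> Q x} -> exists2 x, K x & Q x.
Proof.
move=> K0 KQ; apply: contrapT => nx; apply: K0.
apply: negligibleS KQ => x Kx /= KQx; apply: nx; exists x => //; exact: KQx.
Qed.

(** If it failed, f would exceed every natural number almost everywhere on K. With [ess_sup_gtNy]
    this keeps [osc] from being a difference of equal infinities on sets that are not null. *)
Lemma ess_inf_lty f K : ~ m.-negligible K -> (ess_inf_on f K < +oo)%E.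
Proof.
move=> K0; rewrite ltey; apply/eqP => I.
have H k : {ae m, forall x, K x -> k%:R <= f x}.
  have [|y /= Hy ky] := @ereal_sup_gt _ [set y | {ae m, forall x, K x -> (y <= (f x)%:E)%E}] k%:R%:E.
    by rewrite -/(ess_inf_on f K) I ltry.
  apply: filterS Hy => x h Kx; rewrite -lee_fin; exact: le_trans (ltW ky) (h Kx).
have [|x Kx Hx] := @ae_meets K (fun x => forall k, k%:R <= f x) K0.
  have /ae_foralln : forall k, {ae m, forall x, K x -> k%:R <= f x} by [].
  by apply: filterS => x h Kx k; exact: h.
have := archi_boundP (normr_ge0 (f x)); rewrite ltNge => /negP; apply.
by rewrite (le_trans (Hx _))// ler_norm.
Qed.

Lemma ess_sup_gtNy f K : ~ m.-negligible K -> (-oo < ess_sup_on f K)%E.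
Proof.
move=> K0; rewrite ltNye; apply/eqP => I.
have H k : {ae m, forall x, K x -> f x <= - k%:R}.
  have [|y /= Hy ky] := @ereal_inf_lt _ [set y | {ae m, forall x, K x -> ((f x)%:E <= y)%E}] (- k%:R)%:E.
    by rewrite -/(ess_sup_on f K) I ltNyr.
  apply: filterS Hy => x h Kx; rewrite -lee_fin; exact: le_trans (h Kx) (ltW ky).
have [|x Kx Hx] := @ae_meets K (fun x => forall k, f x <= - k%:R) K0.
  have /ae_foralln : forall k, {ae m, forall x, K x -> f x <= - k%:R} by [].
  by apply: filterS => x h Kx k; exact: h.
have := archi_boundP (normr_ge0 (f x)); rewrite ltNge => /negP; apply.
by rewrite -normrN (le_trans _ (ler_norm _))// lerNr; exact: Hx.
Qed.

Lemma ess_inf_le_sup f K : ~ m.-negligible K ->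
  (ess_inf_on f K <= ess_sup_on f K)%E.
Proof.
move=> K0; apply: ge_ereal_sup => y Hy; apply: le_ereal_inf_tmp => z Hz.
have [|x Kx] := @ae_meets K (fun x => (y <= (f x)%:E)%E /\ ((f x)%:E <= z)%E) K0.
  by apply: filterS2 Hy Hz => x h1 h2 Kx; split; [exact: h1|exact: h2].
by case; exact: le_trans.
Qed.

Lemma osc_ge0 f K : ~ m.-negligible K -> (0 <= osc f K)%E.
Proof.
move=> K0; rewrite /osc; have := ess_inf_lty f K0; have := ess_sup_gtNy f K0.
have := ess_inf_le_sup f K0.
case: (ess_inf_on f K) => [r| |]; case: (ess_sup_on f K) => [s| |] //= rs _ _;
  rewrite ?addye ?addey ?leey//.
by rewrite lee_fin subr_ge0 -lee_fin.
Qed.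

Lemma osc_le f K (a b : R) : ~ m.-negligible K ->
  {ae m, forall x, K x -> a <= f x <= b} -> (osc f K <= (b - a)%:E)%E.
Proof.
move=> K0 H; rewrite /osc EFinB; apply: leeB.
  apply: ereal_inf_lbound; apply: filterS H => x h Kx; rewrite lee_fin.
  by have /andP[] := h Kx.
apply: ereal_sup_ubound; apply: filterS H => x h Kx; rewrite lee_fin.
by have /andP[] := h Kx.
Qed.

Lemma oscZ f K (t : R) : 0 < t -> ~ m.-negligible K ->
  (osc (t *: f) K <= t%:E * osc f K)%E.
Proof.
move=> t0 K0; rewrite /osc.
have S1 : (ess_sup_on (t *: f) K <= t%:E * ess_sup_on f K)%E.
  rewrite /ess_sup_on -ereal_inf_pZl//.
  apply: ereal_inf_le_tmp => _ [y Hy <-]; apply: filterS Hy => x h Kx.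
  by rewrite /= EFinM lee_pmul2l ?lte_fin//; exact: h.
have I1 : (t%:E * ess_inf_on f K <= ess_inf_on (t *: f) K)%E.
  rewrite /ess_inf_on -ereal_sup_pZl//.
  apply: ereal_sup_le => _ [y Hy <-]; apply: filterS Hy => x h Kx.
  by rewrite /= EFinM lee_pmul2l ?lte_fin//; exact: h.
rewrite muleBr//; first exact: leeB.
have := ess_inf_lty f K0; have := ess_sup_gtNy f K0.
by case: (ess_inf_on f K) => [r| |]; case: (ess_sup_on f K) => [s| |].
Qed.

Lemma L1normE f : L1norm f = (\int[m]_x `|(f x)%:E|)%E.
Proof. by rewrite /L1norm Lnorm1. Qed.

Section norm.
Variables (alpha e0 : R).
Hypothesis e00 : 0 < e0.

Lemma osc_seminorm_ge0 f : (0 <= osc_seminorm alpha e0 f)%E.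
Proof.
apply: le_ereal_sup_tmp; exists ((e0 `^ (- alpha))%:E * \int[m]_x osc f (eucl_ball e0 x))%E.
  by exists e0 => //=; rewrite e00 lexx.
rewrite mule_ge0 ?lee_fin ?powR_ge0// integral_ge0// => x _.
by apply: osc_ge0; exact: eucl_ball_notnegl.
Qed.

Lemma L1norm_le_Vnorm f : (L1norm f <= Vnorm alpha e0 f)%E.
Proof. by rewrite /Vnorm leeDl// osc_seminorm_ge0. Qed.

Lemma Vnorm_ge0 f : (0 <= Vnorm alpha e0 f)%E.
Proof. by rewrite (le_trans _ (L1norm_le_Vnorm f))// L1normE integral_ge0. Qed.

Lemma Vnorm_ae0 f : {ae m, forall x, f x = 0} -> Vnorm alpha e0 f = 0%E.
Proof.
move=> f0; have osc0 e x : 0 < e -> osc f (eucl_ball e x) = 0%E.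
  move=> ep; apply/eqP; rewrite eq_le osc_ge0 ?andbT; last exact: eucl_ball_notnegl.
  have := @osc_le f (eucl_ball e x) 0 0 (@eucl_ball_notnegl e x ep).
  by rewrite subrr; apply; apply: filterS f0 => z -> _; rewrite lexx.
have -> : Vnorm alpha e0 f = (0 + 0)%E; last by rewrite adde0.
congr (_ + _)%E.
  rewrite L1normE -(integral0 m setT).
  apply/eqP; rewrite eq_le; apply/andP; split; last first.
    by rewrite integral0 integral_ge0.
  have [A [mA A0 fA]] := f0.
  (* f is not assumed measurable, so |f| is bounded by infinity times the indicator of a null
     set. *)
  apply: (@le_trans _ _ (\int[m]_x (+oo * (\1_A x)%:E))%E).
    apply: le_lower_integral => // x; have [xA|xA] := pselect (A x).
      by rewrite indicE mem_set// mule1 leey.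
    have -> : f x = 0 by apply: contrapT => fx; apply: xA; exact: fA.
    by rewrite abse0 mule_ge0// lee_fin.
  rewrite ge0_integralZl//; last exact/measurable_EFinP/measurable_indic.
  rewrite [X in (_ * X)%E](_ : _ = 0%E) ?mule0 ?integral0//.
  by rewrite integral_indic// setIT.
apply/eqP; rewrite eq_le osc_seminorm_ge0 andbT.
apply: ge_ereal_sup => _ [e /andP[ep _] <-].
under eq_integral do rewrite osc0//.
by rewrite integral0 mule0.
Qed.

Lemma VnormZ f (t : R) : 0 < t -> (Vnorm alpha e0 (t *: f) <= t%:E * Vnorm alpha e0 f)%E.
Proof.
move=> t0; rewrite /Vnorm muleDr//; last first.
  by rewrite ge0_adde_def// inE ?osc_seminorm_ge0// L1normE integral_ge0.
apply: leeD.
  rewrite !L1normE; apply: le_trans (lower_integralZ _ t0 _) => //.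
  apply: le_lower_integral => // x.
  by rewrite (_ : (t *: f) x = t * f x)// EFinM abseM /= (gtr0_norm t0).
apply: ge_ereal_sup => _ [e /andP[ep ee] <-].
apply: (@le_trans _ _ (t%:E * ((e `^ (- alpha))%:E * \int[m]_x osc f (eucl_ball e x)))%E).
  rewrite muleCA lee_wpmul2l ?lee_fin ?powR_ge0//.
  have o0 (g : E -> R) (x : E) : (0 <= osc g (eucl_ball e x))%E.
    by apply: osc_ge0; exact: eucl_ball_notnegl.
  apply: le_trans (lower_integralZ m t0 (o0 f)).
  apply: le_lower_integral => // x; apply: oscZ => //; exact: eucl_ball_notnegl.
rewrite lee_pmul2l ?lte_fin//; apply: ereal_sup_ubound.
by exists e => //=; rewrite ep.
Qed.

End norm.

End quasi_hoelder.

(** * Lipschitz weights and the oscillation seminorm *)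

Section lipschitz_weight.
Context (R : realType) (N : nat).
Local Notation m := (lebesgue_rV R N).
Local Notation E := 'rV[R]_N.

Lemma closed_measurable_rV (A : set E) : closed A -> measurable A.
Proof.
move=> cA; rewrite -[A]setCK; apply: measurableC; apply: open_measurable_rV.
exact: closed_openC.
Qed.

Lemma compact_measurable_rV (A : set E) : compact A -> measurable A.
Proof.
move=> cA; apply: closed_measurable_rV; apply: compact_closed cA.
exact: norm_hausdorff.
Qed.

Lemma osc_ge (f : E -> R) (K : set E) (a b : R) :
  ~ m.-negligible [set x | K x /\ b <= f x] ->
  ~ m.-negligible [set x | K x /\ f x <= a] -> ((b - a)%:E <= osc f K)%E.
Proof.
move=> Hb Ha; rewrite /osc EFinB; apply: leeB.
  apply: le_ereal_inf_tmp => y Hy; have [|x [Kx bx] h] :=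
    @ae_meets _ _ _ (fun x => K x -> ((f x)%:E <= y)%E) Hb.
    by apply: filterS Hy => x h _.
  by apply: le_trans (h Kx); rewrite lee_fin.
apply: ge_ereal_sup => y Hy; have [|x [Kx bx] h] :=
  @ae_meets _ _ _ (fun x => K x -> (y <= (f x)%:E)%E) Ha.
  by apply: filterS Hy => x h _.
by apply: le_trans (h Kx) _; rewrite lee_fin.
Qed.

Lemma compact_rV_bounded (C : set E) : compact C ->
  exists2 M : R, 0 < M & forall x, C x -> `|x| <= M.
Proof.
move=> /compact_bounded[M [_ H]]; exists (`|M| + 1); first by rewrite ltr_wpDl.
by apply: H; rewrite ltr_pwDr// ler_norm.
Qed.

Lemma lebesgue_bounded_lty (A : set E) (M : R) : measurable A ->
  (forall x, A x -> `|x| <= M) -> (m A < +oo)%E.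
Proof.
move=> mA AM; pose D : set E := rbox (fun=> [set` `[- M, M + 1[%R]).
have [M0|M0] := ltP M 0.
  rewrite (_ : A = set0) ?measure0//; apply/seteqP; split=> // x /AM h.
  by have := le_lt_trans h M0; rewrite normr_lt0.
apply: (@le_lt_trans _ _ (m D)).
  apply: le_measure; rewrite ?inE//.
    by apply: measurable_rbox => i; exact: measurable_itv.
  move=> x /AM xM i; have := le_trans (rV_norm_coord x i) xM.
  by rewrite /= in_itv/= ler_norml; lra.
by rewrite lebesgue_rV_box ?ltry// => i; lra.
Qed.

Lemma lipschitz_measurable (K : R) (h : E -> R) : 0 <= K ->
  (forall y z, `|h y - h z| <= K * `|y - z|) -> measurable_fun setT h.
Proof.
move=> K0 hK; apply: (measurable_fun_open_R openT) => x _ U.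
move=> /nbhs_ballP[e /= ep eU]; apply/nbhs_ballP.
have K1 : 0 < K + 1 by rewrite ltr_wpDl.
exists (e / (K + 1)); first by rewrite /= divr_gt0.
move=> z; rewrite mx_norm_ball /ball_ /= ltr_pdivlMr// => xz; apply: eU.
rewrite /ball /= (le_lt_trans (hK _ _))// (le_lt_trans _ xz)// mulrC.
by rewrite ler_wpM2l// lerDl.
Qed.

(** Three kinds of balls: where C is null the oscillation vanishes; where the complement of C is
    null f is Lipschitz, with oscillation at most 2 K e; where neither is null the indicator of C
    already oscillates by 1, which bounds that of f. *)
Lemma Valpha_lipschitz (C : set E) (alpha e0 K : R) (l : E -> R) :
  compact C -> 0 < alpha <= 1 -> 0 < e0 -> 0 <= K ->
  (forall y, 0 <= l y <= 1) -> (forall y z, `|l y - l z| <= K * `|y - z|) ->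
  Valpha C alpha e0 \1_C -> Valpha C alpha e0 (fun x => \1_C x * l x).
Proof.
move=> cC /andP[a0 a1] e00 K0 l01 lK [[int1 _] osc1].
have [M M0 CM] := compact_rV_bounded cC.
have mC : measurable C by exact: compact_measurable_rV.
have ml := lipschitz_measurable K0 lK.
set f := fun x => _.
have f0 x : ~ C x -> f x = 0 by move=> nC; rewrite /f indicE memNset// mul0r.
have f1 x : C x -> f x = l x by move=> xC; rewrite /f indicE mem_set// mul1r.
have f01 x : 0 <= f x <= 1.
  by have [/f1->//|/f0->] := pselect (C x); rewrite lexx ler01.
have intf : m.-integrable setT (EFin \o f).
  apply: le_integrable int1 => //.
    apply/measurable_EFinP; apply: measurable_funM => //; exact: measurable_indic.
  move=> x _; rewrite /= lee_fin /f normrM ler_piMr//.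
  by have /andP[? ?] := l01 x; rewrite ger0_norm.
split; first by split.
(* A ball of radius at most e0 about a point outside A misses C, so the Lipschitz term occurs only
   on this set of finite volume. *)
pose A : set E := [set x | `|x| <= M + e0].
have mA : measurable A.
  apply: closed_measurable_rV; apply: (@preimage_closed _ _ (fun x : E => `|x|) [set r | r <= M + e0]).
    by move=> x _; exact: norm_continuous.
  exact: closed_le.
have Aoo : (m A < +oo)%E by exact: (@lebesgue_bounded_lty A (M + e0)).
pose c := fine (m A).
have c0 : 0 <= c by rewrite fine_ge0.
have oscf e x : 0 < e <= e0 ->
    (osc f (eucl_ball e x) <= osc \1_C (eucl_ball e x) + (2 * K * e * \1_A x)%:E)%E.
  move=> /andP[ep ee]; have B0 := @eucl_ball_notnegl _ _ e x ep.
  have [BC|BC] := pselect (m.-negligible (eucl_ball e x `&` C)).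
    apply: (@le_trans _ _ (0 - 0)%:E).
      apply: osc_le => //; apply: negligibleS BC => y /= H.
      apply: contrapT => nB; apply: H => By; rewrite f0 ?lexx// => Cy; exact: nB.
    rewrite subrr adde_ge0 ?osc_ge0// lee_fin.
    by rewrite !mulr_ge0 ?(ltW ep)// indicE.
  have [BnC|BnC] := pselect (m.-negligible (eucl_ball e x `\` C)).
    have Ax : A x.
      have [y [By Cy]] : (eucl_ball e x `&` C) !=set0.
        apply/set0P/eqP => h; apply: BC; rewrite h; exact: negligible_set0.
      have := norm_le_eucl_dist x y; have := CM _ Cy; have := By : eucl_dist x y < e.
      rewrite /A /=; have := ler_normD (x - y) y; rewrite subrK; lra.
    rewrite indicE mem_set// mulr1.
    apply: (@le_trans _ _ ((l x + K * e) - (l x - K * e))%:E).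
      apply: osc_le => //; apply: negligibleS BnC => y /= H.
      apply: contrapT => nB; apply: H => By; rewrite f1; last first.
        by apply: contrapT => nC; exact: nB.
      have h1 : `|x - y| <= e by exact: le_trans (norm_le_eucl_dist _ _) (ltW By).
      have := lK x y; have := ler_wpM2l K0 h1.
      by move=> h2 h3; have := le_trans h3 h2; rewrite ler_norml; lra.
    rewrite -[leLHS]add0e; apply: leeD; first exact: osc_ge0.
    by rewrite lee_fin; lra.
  apply: (@le_trans _ _ (1 - 0)%:E).
    by apply: osc_le => //; apply: aeW => y _; exact: f01.
  rewrite -[leLHS]adde0; apply: leeD; last first.
    by rewrite lee_fin !mulr_ge0 ?(ltW ep)// indicE.
  apply: osc_ge.
    apply: contra_not BC => h; apply: negligibleS h => y [By Cy]; split=> //.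
    by rewrite indicE mem_set.
  apply: contra_not BnC => h; apply: negligibleS h => y [By Cy]; split=> //.
  by rewrite indicE memNset.
have intosc e : 0 < e <= e0 -> (\int[m]_x osc f (eucl_ball e x) <=
    \int[m]_x osc \1_C (eucl_ball e x) + (2 * K * e * c)%:E)%E.
  move=> ee; have /andP[ep _] := ee.
  have o0 (g : E -> R) (x : E) : (0 <= osc g (eucl_ball e x))%E.
    by apply: osc_ge0; exact: eucl_ball_notnegl.
  have b0 x : (0 <= (2 * K * e * \1_A x)%:E)%E.
    by rewrite lee_fin !mulr_ge0 ?(ltW ep)// indicE.
  apply: le_trans (le_lower_integral m (o0 f) (fun x => oscf e x ee)) _.
  apply: le_trans (lower_integralD m (o0 _) b0 _) _.
    apply/measurable_EFinP; apply: measurable_funM => //; exact: measurable_indic.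
  apply: leeD => //; under eq_integral do rewrite EFinM.
  rewrite ge0_integralZl_EFin ?mulr_ge0 ?(ltW ep)//; last first.
    exact/measurable_EFinP/measurable_indic.
  rewrite [leRHS]EFinM (fineK (_ : m A \is a fin_num)) ?ge0_fin_numE//.
  by rewrite integral_indic// setIT.
apply: (@le_lt_trans _ _ (osc_seminorm alpha e0 \1_C + (e0 `^ (1 - alpha) * (2 * K * c))%:E)%E); last first.
  by rewrite lte_add_pinfty// ltry.
apply: ge_ereal_sup => _ [e /= ee <-]; have /andP[ep _] := ee.
apply: le_trans (lee_wpmul2l _ (intosc e ee)) _; first by rewrite lee_fin powR_ge0.
rewrite ge0_muleDr; last 2 first.
- by apply: integral_ge0 => x _; apply: osc_ge0; exact: eucl_ball_notnegl.
- by rewrite lee_fin !mulr_ge0 ?(ltW ep).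
apply: leeD; first by apply: ereal_sup_ubound; exists e.
rewrite -EFinM lee_fin.
(* The factor e from the Lipschitz bound absorbs e^-alpha: what remains is e^(1 - alpha), bounded by
   e0^(1 - alpha) as alpha <= 1. *)
have -> : e `^ (- alpha) * (2 * K * e * c) = (e `^ (- alpha) * e `^ 1) * (2 * K * c).
  by rewrite powRr1 ?(ltW ep)//; lra.
rewrite -powRD; last by rewrite (gt_eqF ep) implybT.
rewrite ler_wpM2r ?mulr_ge0// addrC ge0_ler_powR ?subr_ge0 ?nnegrE ?(ltW ep) ?(ltW e00)//.
by case/andP: ee.
Qed.

End lipschitz_weight.

(** * Integrals over a fixed set as linear functionals *)

Section functionals.
Context (R : realType) (N : nat).
Local Notation m := (lebesgue_rV R N).
Local Notation E := 'rV[R]_N.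
Implicit Types (f g : E -> R) (D : set E).

Lemma integrable_lin f g (a : R) : m.-integrable setT (EFin \o f) ->
  m.-integrable setT (EFin \o g) -> m.-integrable setT (EFin \o (a *: f + g)).
Proof.
move=> If Ig; rewrite (_ : EFin \o _ = ((fun x => a%:E * (EFin \o f) x) \+ (EFin \o g))%E).
  by apply: integrableD => //; exact: integrableZl.
by apply/funext => x; rewrite /= EFinD EFinM.
Qed.

Lemma integrableB_lin f g : m.-integrable setT (EFin \o f) ->
  m.-integrable setT (EFin \o g) -> m.-integrable setT (EFin \o (f - g)).
Proof. by move=> If Ig; rewrite -scaleN1r addrC; exact: integrable_lin. Qed.

Lemma integrableD_lin f g : m.-integrable setT (EFin \o f) ->
  m.-integrable setT (EFin \o g) -> m.-integrable setT (EFin \o (f + g)).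
Proof. by move=> If Ig; rewrite -[f]scale1r; exact: integrable_lin. Qed.

Lemma integrable_zero : m.-integrable setT (EFin \o (0 : E -> R)).
Proof. exact: integrable0. Qed.

Lemma integrableZ_lin f (a : R) : m.-integrable setT (EFin \o f) ->
  m.-integrable setT (EFin \o (a *: f)).
Proof.
by move=> If; have := integrable_lin a If integrable_zero; rewrite addr0.
Qed.

Lemma integrable_sum_lin d (a : 'I_d -> R) (b : 'I_d -> E -> R) :
  (forall i, m.-integrable setT (EFin \o b i)) ->
  m.-integrable setT (EFin \o (\sum_i a i *: b i)).
Proof.
move=> Ib; apply: (big_ind (fun g : E -> R => m.-integrable setT (EFin \o g))).
- exact: integrable_zero.
- by move=> f g; exact: integrableD_lin.
- move=> i _; exact: integrableZ_lin.
Qed.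

Lemma Rintegral_lin D f g (a : R) : measurable D ->
  m.-integrable setT (EFin \o f) -> m.-integrable setT (EFin \o g) ->
  \int[m]_(x in D) (a *: f + g) x =
  a * \int[m]_(x in D) f x + \int[m]_(x in D) g x.
Proof.
move=> mD If Ig; have sub (h : E -> R) : m.-integrable setT (EFin \o h) ->
    m.-integrable D (EFin \o h) by apply: integrableS.
rewrite -RintegralZl//; last exact: sub If.
rewrite -RintegralD//; last exact: sub Ig.
exact: (sub _ (integrableZ_lin a If)).
Qed.

Lemma Rintegral_zero D : \int[m]_(x in D) (0 : E -> R) x = 0.
Proof. by rewrite /Rintegral (eq_integral (cst 0%E)) ?integral0. Qed.

Lemma RintegralD_lin D f g : measurable D ->
  m.-integrable setT (EFin \o f) -> m.-integrable setT (EFin \o g) ->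
  \int[m]_(x in D) (f + g) x = \int[m]_(x in D) f x + \int[m]_(x in D) g x.
Proof.
by move=> mD If Ig; rewrite -{1}[f]scale1r Rintegral_lin// mul1r.
Qed.

Lemma RintegralB_lin D f g : measurable D ->
  m.-integrable setT (EFin \o f) -> m.-integrable setT (EFin \o g) ->
  \int[m]_(x in D) (f - g) x = \int[m]_(x in D) f x - \int[m]_(x in D) g x.
Proof.
move=> mD If Ig; rewrite -scaleN1r addrC Rintegral_lin//.
by rewrite mulN1r addrC.
Qed.

Lemma Rintegral_sum_lin D d (a : 'I_d -> R) (b : 'I_d -> E -> R) :
  measurable D -> (forall i, m.-integrable setT (EFin \o b i)) ->
  \int[m]_(x in D) (\sum_i a i *: b i) x = \sum_i a i * \int[m]_(x in D) b i x.
Proof.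
move=> mD Ib.
pose Q (g : E -> R) (r : R) := m.-integrable setT (EFin \o g) /\
  \int[m]_(x in D) g x = r.
suff [] : Q (\sum_i a i *: b i) (\sum_i a i * \int[m]_(x in D) b i x) by [].
apply: (big_ind2 Q); first by split; [exact: integrable_zero|exact: Rintegral_zero].
  move=> f1 r1 f2 r2 [I1 <-] [I2 <-]; split; first exact: integrableD_lin.
  exact: RintegralD_lin.
move=> i _; split; first exact: integrableZ_lin.
have := Rintegral_lin (a i) mD (Ib i) integrable_zero.
by rewrite addr0 Rintegral_zero addr0.
Qed.

Lemma norm_Rintegral_le D f : measurable D -> m.-integrable setT (EFin \o f) ->
  (`|\int[m]_(x in D) f x|%:E <= L1norm f)%E.
Proof.
move=> mD If; have IfD : m.-integrable D (EFin \o f) by apply: integrableS If.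
rewrite EFin_normr_Rintegral// L1normE (le_trans (le_abse_integral _ _ _))//.
  by case/integrableP : IfD.
apply: ge0_subset_integral => //.
by have /integrableP[+ _] := If; exact: measurableT_comp.
Qed.

Lemma norm_Rintegral_le_Vnorm (alpha e0 : R) D f : 0 < e0 -> measurable D ->
  m.-integrable setT (EFin \o f) ->
  (`|\int[m]_(x in D) f x|%:E <= Vnorm alpha e0 f)%E.
Proof.
move=> e00 mD If; apply: le_trans (norm_Rintegral_le mD If) _.
exact: L1norm_le_Vnorm.
Qed.

Lemma eq_Rintegral_Vnorm (alpha e0 : R) D f g : 0 < e0 -> measurable D ->
  m.-integrable setT (EFin \o f) -> m.-integrable setT (EFin \o g) ->
  Vnorm alpha e0 (f - g) = 0%E ->
  \int[m]_(x in D) f x = \int[m]_(x in D) g x.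
Proof.
move=> e00 mD If Ig n0; apply/eqP; rewrite -subr_eq0 -RintegralB_lin//.
have := norm_Rintegral_le_Vnorm alpha e00 mD (integrableB_lin If Ig).
by rewrite n0 lee_fin normr_le0.
Qed.

(** The positive and negative parts of g are densities of two finite measures that agree on cubes,
    hence on all Borel sets. *)
Lemma ae0_dcube g : m.-integrable setT (EFin \o g) ->
  (forall l k, \int[m]_(x in dcube l k) g x = 0) -> {ae m, forall x, g x = 0}.
Proof.
move=> Ig g0; have mg : measurable_fun setT g.
  by apply/measurable_EFinP; case/integrableP : Ig.
pose gp x := Num.max (g x) 0; pose gn x := Num.max (- g x) 0.
have gp0 x : 0 <= gp x by rewrite /gp le_max lexx orbT.
have gn0 x : 0 <= gn x by rewrite /gn le_max lexx orbT.
have gE x : g x = gp x - gn x.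
  by rewrite /gp /gn /Num.max; do 2 case: ifP; lra.
have gple x : gp x <= `|g x| by rewrite /gp ge_max ler_norm normr_ge0.
have gnle x : gn x <= `|g x| by rewrite /gn ge_max -normrN ler_norm normr_ge0.
have mgp : measurable_fun setT gp by apply: measurable_maxr.
have mgn : measurable_fun setT gn.
  by apply: measurable_maxr => //; exact: measurableT_comp.
have Igp : m.-integrable setT (EFin \o gp).
  apply: le_integrable Ig => //; first exact/measurable_EFinP.
  by move=> x _; rewrite /= lee_fin (ger0_norm (gp0 x)).
have Ign : m.-integrable setT (EFin \o gn).
  apply: le_integrable Ig => //; first exact/measurable_EFinP.
  by move=> x _; rewrite /= lee_fin (ger0_norm (gn0 x)).
have fin (h : E -> R) D : measurable D -> m.-integrable setT (EFin \o h) ->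
    (\int[m]_(x in D) (h x)%:E)%E \is a fin_num.
  by move=> mD Ih; apply: integrable_fin_num => //; apply: integrableS Ih.
have gpn A : measurable A -> (\int[m]_(x in A) (gp x)%:E = \int[m]_(x in A) (gn x)%:E)%E.
  apply: (@eq_measure_dcube _ _ (density m mgp gp0) (density m mgn gn0)) => [l k|k].
    rewrite /= /density_measure; have mQ := @measurable_dcube R N l k.
    have := g0 l k; rewrite (_ : g = gp - gn); last by apply/funext => x; exact: gE.
    rewrite RintegralB_lin// => /eqP; rewrite subr_eq0 /Rintegral => /eqP h.
    by rewrite -[LHS]fineK ?fin// -[RHS]fineK ?fin// h.
  rewrite /= /density_measure -ge0_fin_numE ?fin//; first exact: measurable_dcube.
  by apply: integral_ge0 => x _; rewrite lee_fin.
have H : ae_eq m setT (EFin \o g) (cst 0%E).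
  apply: integral_ae_eq => // D _ mD; rewrite integral0.
  transitivity (\int[m]_(x in D) ((gp x)%:E - (gn x)%:E))%E.
    by apply: eq_integral => x _; rewrite /= gE EFinB.
  rewrite integralB_EFin//; [|exact: integrableS Igp|exact: integrableS Ign].
  by rewrite gpn// subee// fin.
by apply: filterS H => x /(_ I) /= [].
Qed.

End functionals.

Section lipschitz_cutoff.
Context (R : realType) (N : nat).
Local Notation m := (lebesgue_rV R N).
Local Notation E := 'rV[R]_N.

Lemma norm_minB (u u' v v' K : R) : `|u - v| <= K -> `|u' - v'| <= K ->
  `|Num.min u u' - Num.min v v'| <= K.
Proof. by rewrite !ler_norml /Num.min; do 2 case: ltP => ?; lra. Qed.

Lemma norm_maxB (u u' v v' K : R) : `|u - v| <= K -> `|u' - v'| <= K ->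
  `|Num.max u u' - Num.max v v'| <= K.
Proof. by rewrite !ler_norml /Num.max; do 2 case: ltP => ?; lra. Qed.

(** A Lipschitz approximation of the indicator of [a, b[. The left ramp is outside the interval and
    the right one inside, which gives the correct limits 1 at a and 0 at b. *)
Definition trapezoid (n a b x : R) : R :=
  Num.max 0 (Num.min 1 (Num.min (1 + n * (x - a)) (n * (b - x)))).

Lemma trapezoid_ge0_le1 n a b x : 0 <= trapezoid n a b x <= 1.
Proof. by rewrite /trapezoid le_max lexx ge_max ler01 ge_min lexx. Qed.

Lemma trapezoid_lipschitz n a b x y : 0 <= n ->
  `|trapezoid n a b x - trapezoid n a b y| <= n * `|x - y|.
Proof.
move=> n0; have K0 : 0 <= n * `|x - y| by rewrite mulr_ge0.
apply: norm_maxB; first by rewrite subrr normr0.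
apply: norm_minB; first by rewrite subrr normr0.
have E1 : `|n * x - n * y| = n * `|x - y|.
  by rewrite -mulrBr normrM ger0_norm.
apply: norm_minB; rewrite -E1.
  by rewrite (_ : _ - _ = n * x - n * y)//; lra.
by rewrite distrC (_ : _ - _ = n * x - n * y)//; lra.
Qed.

Lemma trapezoid_cvg a b x : exists n0 : nat, forall n, (n0 <= n)%N ->
  trapezoid n%:R a b x = \1_[set` `[a, b[%R] x.
Proof.
have big (r : R) : 0 < r -> exists n0 : nat, forall n, (n0 <= n)%N -> 1 <= n%:R * r.
  move=> r0; have [n0 _ H] := @near_infty_natSinv_lt R (PosNum r0).
  exists n0.+1 => -[//|n] nn0; have := H _ nn0 => /= /ltW.
  by rewrite -[X in X <= r -> _]mul1r ler_pdivrMr// mulrC.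
rewrite indicE; have [xa|xa] := ltP x a.
  have [|n0 H] := big (a - x); first by rewrite subr_gt0.
  exists n0 => n /H nx; rewrite memNset /= ?in_itv/= ?leNgt ?xa//.
  rewrite /trapezoid; apply/max_idPl; rewrite !ge_min.
  by apply/orP; right; apply/orP; left; lra.
have [bx|bx] := leP b x.
  exists 0%N => n _; rewrite memNset /= ?in_itv/= ?ltNge ?bx ?andbF//.
  rewrite /trapezoid; apply/max_idPl; rewrite !ge_min.
  apply/orP; right; apply/orP; right; rewrite mulr_ge0_le0//; lra.
have [|n0 H] := big (b - x); first by rewrite subr_gt0.
exists n0 => n /H nx; rewrite mem_set /= ?in_itv/= ?xa//.
rewrite /trapezoid; rewrite (min_idPl _) ?(max_idPr _)// le_min nx andbT.
by rewrite lerDl mulr_ge0// subr_ge0.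
Qed.

(** A minimum instead of a product keeps the Lipschitz constant n for the sup norm. *)
Definition box_cutoff (n : nat) (a b : 'I_N -> R) (x : E) : R :=
  \big[Num.min/1]_i trapezoid n%:R (a i) (b i) (x ord0 i).

Lemma box_cutoff_ge0_le1 n a b x : 0 <= box_cutoff n a b x <= 1.
Proof.
apply: (big_ind (fun r : R => 0 <= r <= 1)); first by rewrite ler01 lexx.
  by move=> r s /andP[r0 r1] /andP[s0 s1]; rewrite le_min ge_min r0 s0 r1.
by move=> i _; exact: trapezoid_ge0_le1.
Qed.

Lemma box_cutoff_lipschitz n a b x y :
  `|box_cutoff n a b x - box_cutoff n a b y| <= n%:R * `|x - y|.
Proof.
apply: (big_ind2 (fun r s : R => `|r - s| <= n%:R * `|x - y|)).
- by rewrite subrr normr0 mulr_ge0.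
- by move=> *; exact: norm_minB.
- move=> i _; apply: le_trans (trapezoid_lipschitz _ _ _ _ _) _ => //.
  by rewrite ler_wpM2l//; have := rV_norm_coord (x - y) i; rewrite !mxE.
Qed.

Lemma box_cutoff_cvg a b x : exists n0 : nat, forall n, (n0 <= n)%N ->
  box_cutoff n a b x = \1_(rbox (fun i => [set` `[a i, b i[%R])) x.
Proof.
have [n0 H] : exists n0 : 'I_N -> nat, forall i n, (n0 i <= n)%N ->
    trapezoid n%:R (a i) (b i) (x ord0 i) = \1_[set` `[a i, b i[%R] (x ord0 i).
  by have [f Hf] := choice (fun i => trapezoid_cvg (a i) (b i) (x ord0 i)); exists f.
exists (\max_i n0 i)%N => n nn.
have Hn i : trapezoid n%:R (a i) (b i) (x ord0 i) = \1_[set` `[a i, b i[%R] (x ord0 i).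
  by apply: H; apply: leq_trans nn; exact: leq_bigmax.
rewrite indicE; case: (boolP (x \in _)) => [/set_mem xb|/negP xb].
  rewrite /box_cutoff; apply: (big_ind (fun r : R => r = 1)) => //.
    by move=> r s -> ->; rewrite minxx.
  by move=> i _; rewrite Hn indicE mem_set//; exact: xb.
have [i xi] : exists i, ~ [set` `[a i, b i[%R] (x ord0 i).
  by apply: contrapT => h; apply: xb; apply/mem_set => i; apply: contrapT => xi; apply: h; exists i.
apply/eqP; rewrite eq_le; have /andP[-> _] := box_cutoff_ge0_le1 n a b x.
rewrite andbT; apply: (le_trans (bigmin_le _ i _)).
by rewrite Hn indicE memNset.
Qed.

(** Indicators of dyadic cubes are pointwise limits of the cutoffs, so by dominated convergence g
    has integral 0 over every cube. *)
Lemma ae0_lipschitz (g : E -> R) : m.-integrable setT (EFin \o g) ->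
  (forall (K : R) (h : E -> R), 0 <= K -> (forall y, 0 <= h y <= 1) ->
    (forall y z, `|h y - h z| <= K * `|y - z|) ->
    measurable_fun setT h -> \int[m]_x (g x * h x) = 0) ->
  {ae m, forall x, g x = 0}.
Proof.
move=> Ig H; have mg : measurable_fun setT g.
  by apply/measurable_EFinP; case/integrableP : Ig.
apply: ae0_dcube => // l k; rewrite dcubeE.
set a := fun i : 'I_N => (k ord0 i)%:~R / 2 ^+ l : R.
set b := fun i : 'I_N => (k ord0 i + 1)%:~R / 2 ^+ l : R.
set Q := rbox _.
have mQ : measurable Q by apply: measurable_rbox => i; exact: measurable_itv.
pose h n := box_cutoff n a b.
have mh n : measurable_fun setT (h n).
  by apply: (@lipschitz_measurable _ _ n%:R) => // y z; exact: box_cutoff_lipschitz.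
have Hn n : \int[m]_x (g x * h n x) = 0.
  apply: (H n%:R) => //.
    by move=> y; exact: box_cutoff_ge0_le1.
  by move=> y z; exact: box_cutoff_lipschitz.
have mgh n : measurable_fun setT (fun x => (g x * h n x)%:E).
  by apply/measurable_EFinP; exact: measurable_funM.
have mgQ : measurable_fun setT (fun x => (g x * \1_Q x)%:E).
  by apply/measurable_EFinP; apply: measurable_funM => //; exact: measurable_indic.
have cgh : {ae m, forall x, setT x -> (g x * h n x)%:E @[n --> \oo] --> (g x * \1_Q x)%:E}.
  apply: aeW => x _; have [n0 Hx] := box_cutoff_cvg a b x.
  by apply: cvg_near_cst; exists n0 => // n /= /Hx; rewrite /h => ->.
have Igabs : m.-integrable setT (fun x => `|(g x)%:E|)%E by exact: integrable_abse.
have bgh : {ae m, forall x n, setT x -> (`|(g x * h n x)%:E| <= `|(g x)%:E|)%E}.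
  apply: aeW => x n _; rewrite /= lee_fin normrM ler_piMr//.
  by have /andP[? ?] := box_cutoff_ge0_le1 n a b x; rewrite ger0_norm.
have [_ _ lim1] := dominated_convergence measurableT mgh mgQ cgh Igabs bgh.
have E0 : (\int[m]_x (g x * \1_Q x)%:E = 0)%E.
  apply: (cvg_unique _ lim1); first exact: ereal_hausdorff.
  rewrite (_ : (fun n => _) = cst 0%E); first exact: cvg_cst.
  apply/funext => n; have := Hn n; rewrite /Rintegral => h0.
  rewrite -[LHS]fineK ?h0//; apply: integrable_fin_num => //.
  apply: le_integrable Ig => // x _; rewrite /= lee_fin normrM ler_piMr//.
  by have /andP[? ?] := box_cutoff_ge0_le1 n a b x; rewrite ger0_norm.
rewrite /Rintegral integral_mkcond (_ : (_ \_ _)%E = (fun x => (g x * \1_Q x)%:E)) ?E0//.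
apply/funext => x; rewrite patchE indicE; case: ifP => _; by rewrite ?mulr1 ?mulr0.
Qed.

End lipschitz_cutoff.

(** * Invariant sets and invariant measures *)

Section separation.
Context d (X : measurableType d) (R : realType).
Implicit Types (mu nu : probability X R) (A B : set X).

Definition measure_gap mu nu A : R := fine (mu A) - fine (nu A).

(** These are the positive sets of the Hahn decompositions of mu - nu. As maximizers they are
    visibly stable under preimages by a map that preserves both measures, which yields an invariant
    one. *)
Definition gap_maximal mu nu A : Prop :=
  measurable A /\ forall B, measurable B -> measure_gap mu nu B <= measure_gap mu nu A.

Lemma fine_probabilityU mu A B : measurable A -> measurable B ->
  fine (mu (A `|` B)) + fine (mu (A `&` B)) = fine (mu A) + fine (mu B).
Proof.
move=> mA mB; have fin D : measurable D -> mu D \is a fin_num by exact: fin_num_measure.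
have mAB := measurableD mA mB; have mI := measurableI _ _ mA mB.
have -> : A `|` B = (A `\` B) `|` B by rewrite setDE setUIl setUCl setIT.
rewrite measureU//; last by rewrite setDKI.
have -> : mu A = (mu (A `\` B) + mu (A `&` B))%E by exact: measureDI.
by rewrite !fineD ?fin//; lra.
Qed.

Lemma measure_gapU mu nu A B : measurable A -> measurable B ->
  measure_gap mu nu (A `|` B) + measure_gap mu nu (A `&` B) =
  measure_gap mu nu A + measure_gap mu nu B.
Proof.
move=> mA mB; have := fine_probabilityU mu mA mB.
have := fine_probabilityU nu mA mB; rewrite /measure_gap; lra.
Qed.

Lemma measure_gapUdisj mu nu A B : measurable A -> measurable B ->
  A `&` B = set0 ->
  measure_gap mu nu (A `|` B) = measure_gap mu nu A + measure_gap mu nu B.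
Proof.
move=> mA mB AB; rewrite -measure_gapU// AB.
by rewrite [X in _ = _ + X]/measure_gap !measure0 subrr addr0.
Qed.

Lemma measure_gapC mu nu A : measurable A ->
  measure_gap mu nu (~` A) = - measure_gap mu nu A.
Proof.
move=> mA; have := @measure_gapUdisj mu nu A (~` A) mA (measurableC mA) (setICr A).
by rewrite setUCr [X in X = _ -> _]/measure_gap !probability_setT; lra.
Qed.

Lemma measure_gap_sym mu nu A : measure_gap nu mu A = - measure_gap mu nu A.
Proof. by rewrite /measure_gap opprB. Qed.

Lemma gap_maximal_exists mu nu : exists A, gap_maximal mu nu A.
Proof.
pose c : {charge set X -> \bar R} :=
  cadd (charge_of_finite_measure mu) (copp (charge_of_finite_measure nu)).
have cE A : measurable A -> c A = (measure_gap mu nu A)%:E.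
  move=> mA; rewrite /measure_gap EFinB !fineK//; exact: fin_num_measure.
have [P [N [[mP Ppos] [mN Nneg] PN PN0]]] := Hahn_decomposition c.
exists P; split=> // A mA.
have mAP := measurableI _ _ mA mP; have mAN := measurableI _ _ mA mN.
have gA : measure_gap mu nu A =
    measure_gap mu nu (A `&` P) + measure_gap mu nu (A `&` N).
  rewrite -measure_gapUdisj//; last by rewrite setIACA PN0 setI0.
  by rewrite -setIUr PN setIT.
have mPA := measurableD mP mA.
have gP : measure_gap mu nu P =
    measure_gap mu nu (A `&` P) + measure_gap mu nu (P `\` A).
  rewrite -measure_gapUdisj//; last by apply/seteqP; split=> x // -[[? _] [_]].
  by rewrite setIC setUIDK.
have := Nneg _ mAN (@subIsetr _ _ _); have := Ppos _ mPA (@subDsetl _ _ _).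
by rewrite !cE// !lee_fin; lra.
Qed.

Lemma gap_maximalC mu nu A : gap_maximal mu nu A -> gap_maximal nu mu (~` A).
Proof.
move=> [mA Amax]; split=> [|B mB]; first exact: measurableC.
have := Amax _ (measurableC mB).
by rewrite !measure_gapC// !(measure_gap_sym mu nu); lra.
Qed.

(** The gap is modular: union and intersection together have the gaps of A and B, and the
    intersection has at most that of B. *)
Lemma gap_maximalU mu nu A B : gap_maximal mu nu A -> gap_maximal mu nu B ->
  gap_maximal mu nu (A `|` B).
Proof.
move=> [mA Amax] [mB Bmax]; split=> [|D mD]; first exact: measurableU.
have := measure_gapU mu nu mA mB.
have := Bmax _ (measurableI _ _ mA mB); have := Amax _ mD; lra.
Qed.

(** Finite unions are maximal, and the gap is continuous along increasing unions. *)
Lemma gap_maximal_bigcup mu nu (A : (set X)^nat) :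
  (forall k, gap_maximal mu nu (A k)) -> gap_maximal mu nu (\bigcup_k A k).
Proof.
move=> Amax; pose u := fix u p := if p is q.+1 then u q `|` A p else A 0%N.
have umax p : gap_maximal mu nu (u p).
  by elim: p => [|p IH] /=; [exact: Amax|exact: gap_maximalU].
have mu_ p : measurable (u p) by have [] := umax p.
have und : nondecreasing_seq u.
  by apply/nondecreasing_seqP => p; apply/subsetPset => x ux; left.
have -> : \bigcup_k A k = \bigcup_p u p.
  apply/seteqP; split=> x [k _ kx].
    by exists k => //; case: k kx => // k kx; right.
  elim: k kx => [A0|k IH /= [/IH//|Ak]]; first by exists 0%N.
  by exists k.+1.
have mU : measurable (\bigcup_p u p) by exact: bigcupT_measurable.
have cv (la : probability X R) : fine (la (u p)) @[p --> \oo] --> fine (la (\bigcup_p u p)).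
  apply: fine_cvg; rewrite fineK ?fin_num_measure//.
  exact: nondecreasing_cvg_mu.
split=> // B mB.
have : measure_gap mu nu (u p) @[p --> \oo] --> measure_gap mu nu (\bigcup_p u p).
  by apply: cvgB; exact: cv.
move=> cg; apply: (ler_cvg_to (cvg_cst _) cg).
by apply: nearW => p; have [_] := umax p; exact.
Qed.

Variables (Z : set X) (F : X -> X).
Hypotheses (mZ : measurable Z) (mF : measurable_fun Z F).

Definition pull A := Z `&` F @^-1` A.

Lemma measurable_iter_pull A k : measurable A -> measurable (iter k pull A).
Proof. by move=> mA; elim: k => //= k IH; exact: mF. Qed.

(** The limsup of the preimages of a maximizer is an exactly invariant maximizer, of positive gap
    since the measures differ. Ergodicity leaves only the values 0 and 1, so they are 1 for mu and 0
    for nu. *)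
Lemma ergodic_separation mu nu :
  (forall A, measurable A -> mu (pull A) = mu A) ->
  (forall A, measurable A -> nu (pull A) = nu A) ->
  (forall A, measurable A -> A `<=` Z -> pull A = A -> mu A = 0%E \/ mu A = 1%E) ->
  (forall A, measurable A -> A `<=` Z -> pull A = A -> nu A = 0%E \/ nu A = 1%E) ->
  (exists2 A, measurable A & mu A <> nu A) ->
  exists A, [/\ measurable A, A `<=` Z, pull A = A, mu A = 1%E & nu A = 0%E].
Proof.
move=> muF nuF mue nue [A0 mA0 A0ne].
have [P Pmax] := gap_maximal_exists mu nu; have [mP _] := Pmax.
have itmax k : gap_maximal mu nu (iter k pull P).
  elim: k => //= k [mk IH]; split=> [|B mB]; first exact: mF.
  by have := IH B mB; rewrite /measure_gap muF// nuF.
(* Iterates are counted from 1 because every pull-back lies in Z, whereas P need not. *)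
pose S := \bigcap_n \bigcup_k iter (n + k).+1 pull P.
have Smax : gap_maximal mu nu S.
  rewrite /S -[X in gap_maximal _ _ X]setCK; apply: gap_maximalC.
  rewrite setC_bigcap; apply: gap_maximal_bigcup => n; apply: gap_maximalC.
  exact: gap_maximal_bigcup.
have [mS SM] := Smax.
have SZ : S `<=` Z by move=> x /(_ 0%N I)[k _ []].
have SF : pull S = S.
  apply/seteqP; split=> [x [Zx Fx] n _|x Sx].
    have [k _ /= kx] := Fx n I; exists k.+1 => //; rewrite addnS.
    by split.
  split; first exact: SZ.
  by move=> n _; have [k _ [_ /= kx]] := Sx n.+1 I; exists k.
have gap0 : 0 < measure_gap mu nu S.
  have A0g : measure_gap mu nu A0 != 0.
    rewrite subr_eq0; apply/eqP => h; apply: A0ne.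
    by rewrite -[LHS]fineK ?fin_num_measure// -[RHS]fineK ?fin_num_measure// h.
  have := SM _ mA0; have := SM _ (measurableC mA0); rewrite measure_gapC//.
  by move: A0g; rewrite neq_lt => /orP[] ? ? ?; lra.
have [S1|S1] := mue S mS SZ SF; have [S2|S2] := nue S mS SZ SF;
  move: gap0; rewrite /measure_gap S1 S2 /=; first by lra.
- by lra.
- by exists S.
- by lra.
Qed.

End separation.

Lemma iter_cancel (X : Type) (f g : X -> X) k : cancel f g ->
  cancel (iter k f) (iter k g).
Proof. by move=> fK; elim: k => // k IH w; rewrite iterSr iterS fK IH. Qed.

Section invariant_core.
Context d (X : measurableType d) (R : realType) (P : probability X R).
Variables (s si : X -> X).
Hypotheses (ssi : cancel s si) (sis : cancel si s).
Hypotheses (ms : measurable_fun setT s) (msi : measurable_fun setT si).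
Hypothesis Ps : forall A, measurable A -> P (s @^-1` A) = P A.

Lemma measurable_iter (f : X -> X) k : measurable_fun setT f ->
  measurable_fun setT (iter k f).
Proof.
move=> mf; elim: k => [|k IH] /=; first exact: measurable_id.
exact: (measurableT_comp mf IH).
Qed.

Lemma preserving_iter A k : measurable A -> P (iter k s @^-1` A) = P A.
Proof.
move=> mA; elim: k => //= k IH; rewrite -[RHS]IH -[RHS]Ps; last first.
  by rewrite -[X in measurable X]setTI; exact: measurable_iter.
by congr (P _); apply/seteqP; split=> x /=; rewrite -iterSr.
Qed.

Lemma preserving_iter_inv A k : measurable A -> P (iter k si @^-1` A) = P A.
Proof.
move=> mA; rewrite -(@preserving_iter _ k); last first.
  by rewrite -[X in measurable X]setTI; exact: measurable_iter.
by congr (P _); apply/seteqP; split=> x /=; rewrite (iter_cancel k ssi).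
Qed.

(** All preimages of the exceptional null set under the iterates of s and of its inverse are
    removed; there are countably many and they are null, as P is preserved in both directions. *)
Lemma invariant_core (Q : X -> Prop) : {ae P, forall w, Q w} ->
  exists G, [/\ measurable G, P (~` G) = 0%E, (forall w, G w -> Q w),
    (forall w, G w -> G (s w)) & (forall w, G w -> G (si w))].
Proof.
move=> [A [mA A0 QA]].
pose H f := \bigcup_k (iter k f @^-1` A).
have mit f k : measurable_fun setT f -> measurable (iter k f @^-1` A).
  by move=> mf; rewrite -[X in measurable X]setTI; exact: measurable_iter.
have mH f : measurable_fun setT f -> measurable (H f).
  by move=> mf; apply: bigcupT_measurable => k; exact: mit.
exists (~` (H s `|` H si)); split.
- by apply: measurableC; apply: measurableU; exact: mH.
- rewrite setCK; apply/negligibleP; first by apply: measurableU; exact: mH.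
  apply: negligibleU; apply: negligible_bigcup => k; apply/negligibleP;
    try exact: mit.
    exact: (etrans (preserving_iter k mA) A0).
  exact: (etrans (preserving_iter_inv k mA) A0).
- move=> w Gw; apply: contrapT => nQ; apply: Gw; left; exists 0%N => //.
  exact: QA.
- move=> w Gw [[k _ kw]|[k _ kw]]; apply: Gw.
    by left; exists k.+1 => //; rewrite /= -iterS iterSr.
  case: k kw => [|k] kw; first by left; exists 1%N.
  by right; exists k => //; move: kw; rewrite /= -iterS iterSr ssi.
- move=> w Gw [[k _ kw]|[k _ kw]]; apply: Gw.
    case: k kw => [|k] kw; first by right; exists 1%N.
    by left; exists k => //; move: kw; rewrite /= -iterS iterSr sis.
  by right; exists k.+1 => //; rewrite /= -iterS iterSr.
Qed.

Lemma integral_preserving_iter (f : X -> \bar R) k : measurable_fun setT f ->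
  (forall w, 0 <= f w)%E -> (\int[P]_w f (iter k s w) = \int[P]_w f w)%E.
Proof.
move=> mf f0; have mk := @measurable_iter s k ms.
have := ge0_integral_pushforward mk P measurableT mf.
rewrite preimage_setT => <- //; apply: eq_measure_integral => A mA _.
exact: preserving_iter.
Qed.

End invariant_core.

(** * Integrals along the cocycle *)

Section decay.
Context (R : realType).

(** A limsup below 0 makes u k at most exp(- c k) eventually, for some c > 0. *)
Lemma decay_of_rate (u : nat -> \bar R) : (limn_esup (log_rate u) < 0)%E ->
  forall e : R, 0 < e -> exists n0, forall k, (n0 <= k)%N -> (u k <= e%:E)%E.
Proof.
move=> u0 e e0.
have [_ /= [A [n1 _ An1]] <- HA] := ereal_inf_lt u0.
(* Half of the distance to 0, or 1 if the supremum is -oo. *)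
have [c c0 cA] : exists2 c : R, 0 < c &
    (ereal_sup [set log_rate u k | k in A] < (- c)%:E)%E.
  case: (ereal_sup _) HA => [r|//|]; rewrite ?lte_fin => r0.
    by exists (- r / 2); [lra|rewrite lte_fin; lra].
  by exists 1 => //; exact: ltNyr.
(* Past b the bound exp(- c k) is below e; the successor on the next line keeps k nonzero. *)
pose b := `|ln e| / c; pose n2 := (Num.bound b).
exists (maxn n1 n2).+1 => -[//|k]; rewrite ltnS geq_max => /andP[k1 k2].
have k0 : 0 < k.+1%:R :> R by rewrite ltr0n.
have uk : (log_rate u k.+1 < (- c)%:E)%E.
  apply: le_lt_trans cA; apply: ereal_sup_ubound; exists k.+1 => //.
  by apply: An1; rewrite /= (leq_trans k1).
rewrite leNgt; apply/negP => eu.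
have : ((ln e)%:E <= lne (u k.+1))%E.
  by rewrite -lne_EFin// lee_lne ?in_itv/= ?lee_fin ?leey ?(ltW e0) ?(ltW eu)//=;
    rewrite ?andbT; apply: le_trans (ltW eu); rewrite lee_fin ltW.
have ki : 0 < (k.+1%:R^-1) :> R by rewrite invr_gt0.
move=> /(lee_wpmul2l (_ : 0 <= (k.+1%:R^-1)%:E)%E); rewrite lee_fin (ltW ki) => /(_ isT).
move=> /le_lt_trans /(_ uk); rewrite -EFinM lte_fin mulrC ltr_pdivrMr// => h.
have bk : b < k.+1%:R.
  apply: lt_le_trans (archi_boundP _) _; first by rewrite divr_ge0// ltW.
  by rewrite ler_nat (leq_trans k2).
move: bk; rewrite ltr_pdivrMr// => bk.
by have := ler_norm (- ln e); rewrite normrN; lra.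
Qed.

Lemma decay_of_cvg_rate (u : nat -> \bar R) (l : R) : l < 0 ->
  log_rate u @ \oo --> l%:E ->
  forall e : R, 0 < e -> exists n0, forall k, (n0 <= k)%N -> (u k <= e%:E)%E.
Proof.
move=> l0 ul; apply: decay_of_rate; rewrite limn_esup_lim.
rewrite (cvg_lim (@ereal_hausdorff R) (cvg_esups ul)).
by rewrite lte_fin.
Qed.

End decay.

Section pointwise.
Context (R : realType) (n : nat) (Om : ptopologicalType).
Local Notation E := 'rV[R]_n.+1.
Local Notation m := (lebesgue_rV R n.+1).
Variables (sigma : borel Om -> borel Om) (C : set E) (T : borel Om -> E -> E).
Variables (B : branches R n.+1 Om) (alpha e1 : R).
Local Notation V := (Valpha C alpha e1).
Local Notation nrm := (Vnorm (N := n.+1) alpha e1).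
Local Notation L := (transfer T B).
Local Notation pullF := (pull (setT `*` C) (skew_map T sigma)).
Hypotheses (e10 : 0 < e1) (mC : measurable C).
Hypothesis mF : measurable_fun (setT `*` C) (skew_map T sigma).
Hypothesis LV : forall w f, V f -> V (L w f).

Lemma Valpha_integrable (f : E -> R) : V f -> m.-integrable setT (EFin \o f).
Proof. by case=> -[]. Qed.

Lemma measurable_cylinder : measurable ([set: borel Om] `*` C).
Proof. exact: measurableX. Qed.

Lemma xsection_pull S w : xsection (pullF S) w = C `&` T w @^-1` xsection S (sigma w).
Proof.
apply/seteqP; split=> x; rewrite /xsection /= !inE /pull /skew_map /=.
  by move=> [[_ Cx] Sx]; split=> //; rewrite inE.
by move=> [Cx Sx].
Qed.

Lemma xsection_setT D (w : borel Om) : xsection (setT `*` D) w = D :> set E.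
Proof. by apply/seteqP; split=> x; rewrite /xsection /= inE; [case|]. Qed.

Definition dual_at w : Prop := forall (f : E -> R) D, V f -> measurable D ->
  \int[m]_(x in D) (L w f x) = \int[m]_(x in C `&` T w @^-1` D) f x.

Lemma dual_atP (e0 : R) w : branches_wf C B -> 0 < e0 ->
  (forall i, br_idx B w i ->
    {in br_U B w i, T w =1 br_map B w i} /\
    nbhd_set e0 (br_map B w i @` br_U B w i) `<=` br_map B w i @` br_V B w i) ->
  (forall i, br_idx B w i ->
    [/\ C1_on (br_V B w i) (br_map B w i),
        {in br_V B w i &, injective (br_map B w i)} &
        C1_on (br_map B w i @` br_V B w i) (br_inv B w i)]) ->
  m (C `\` \bigcup_(i in br_idx B w) br_U B w i) = 0%E ->
  dual_at w.
Proof.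
move=> wf e00 pe2 pe3 pe4 f D Vf mD; rewrite /Rintegral; congr fine.
apply: (transfer_duality wf e00 pe2 pe3 pe4) => //.
- move=> A mA; rewrite (_ : _ `&` _ = xsection (pullF (setT `*` A)) w).
    apply: measurable_xsection; apply: mF; first exact: measurable_cylinder.
    exact: measurableX.
  by rewrite xsection_pull xsection_setT.
- exact: Valpha_integrable.
- apply/measurable_EFinP; have /integrableP[] := Valpha_integrable (LV w Vf).
  by [].
- by case: Vf => -[].
Qed.

Variable w : borel Om.
Hypothesis dual : forall k, dual_at (iter k sigma w).

Lemma cocycle_V k (f : E -> R) : V f -> V (cocycle sigma L k w f).
Proof.
move=> Vf; elim: k => [|k IH]; first exact: Vf.
exact: (LV (iter k sigma w) IH).
Qed.

Lemma cocycle_dual k f S : V f -> measurable S ->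
  \int[m]_(x in xsection S (iter k sigma w)) (cocycle sigma L k w f x) =
  \int[m]_(x in xsection (iter k pullF S) w) f x.
Proof.
move=> Vf; elim: k S => [//|k IH S mS].
have mS' : measurable (pullF S) by apply: mF; [exact: measurable_cylinder|].
have mxS := measurable_xsection (iter k.+1 sigma w) mS.
rewrite [LHS](dual k (cocycle_V k Vf) mxS).
have -> : C `&` T (iter k sigma w) @^-1` xsection S (iter k.+1 sigma w) =
    xsection (pullF S) (iter k sigma w) by rewrite xsection_pull.
by rewrite (IH _ mS') -iterSr.
Qed.

Definition pulled k D : set E := xsection (iter k pullF (setT `*` D)) w.

Lemma measurable_pulled k D : measurable D -> measurable (pulled k D).
Proof.
move=> mD; apply: measurable_xsection.
apply: measurable_iter_pull => //; first exact: measurable_cylinder.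
exact: measurableX.
Qed.

Lemma cocycle_pulled k f D : V f -> measurable D ->
  \int[m]_(x in D) (cocycle sigma L k w f x) = \int[m]_(x in pulled k D) f x.
Proof.
move=> Vf mD; rewrite /pulled -cocycle_dual//; first by rewrite xsection_setT.
exact: measurableX.
Qed.

(** Decay is expressed by integrals of f itself because these are exactly linear in f, whereas [L]
    is linear only up to functions of norm 0. *)
Definition decaying (f : E -> R) : Prop := m.-integrable setT (EFin \o f) /\
  forall e : R, 0 < e -> exists n0, forall k, (n0 <= k)%N -> forall D, measurable D ->
    `|\int[m]_(x in pulled k D) f x| <= e.

Lemma decaying_nrm f : V f ->
  (forall e : R, 0 < e -> exists n0, forall k, (n0 <= k)%N ->
     (nrm (cocycle sigma L k w f) <= e%:E)%E) -> decaying f.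
Proof.
move=> Vf H; split=> [|e e0]; first exact: Valpha_integrable.
have [n0 Hn] := H e e0; exists n0 => k nk D mD; rewrite -cocycle_pulled//.
rewrite -lee_fin; apply: le_trans (Hn k nk); apply: norm_Rintegral_le_Vnorm => //.
exact/Valpha_integrable/cocycle_V.
Qed.

Lemma decaying0 : decaying 0.
Proof.
split=> [|e e0]; first exact: integrable_zero.
by exists 0%N => k _ D _; rewrite Rintegral_zero normr0 ltW.
Qed.

Lemma decayingD f g : decaying f -> decaying g -> decaying (f + g).
Proof.
move=> [If Hf] [Ig Hg]; split; first exact: integrableD_lin.
move=> e e0; have e2 : 0 < e / 2 by rewrite divr_gt0.
have [n1 H1] := Hf _ e2; have [n2 H2] := Hg _ e2.
exists (maxn n1 n2) => k; rewrite geq_max => /andP[k1 k2] D mD.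
rewrite (RintegralD_lin (measurable_pulled k mD) If Ig).
rewrite (le_trans (ler_normD _ _))//.
by have := H1 k k1 D mD; have := H2 k k2 D mD; lra.
Qed.

Variables (kstar : \bar R) (l : option nat) (lam : nat -> R).
Variables (Y : nat -> set (E -> R)) (W : set (E -> R)).
Hypothesis kstar0 : (kstar < 0)%E.
Hypothesis lam0 : forall j, (0 < j)%N -> below l j -> lam j < 0.
Hypothesis l0 : below l 0.
Hypothesis Ysub : forall j, below l j -> Defs.subspace V nrm (Y j).
Hypothesis Wsub : Defs.subspace V nrm W.
Hypothesis YW : direct_sum V nrm (sum_spaces V nrm l Y) W.
Hypothesis Yrate : forall j, below l j -> forall y, Y j y -> nrm y <> 0%E ->
  log_rate (fun k => nrm (cocycle sigma L k w y)) @ \oo --> (lam j)%:E.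
Hypothesis Wrate : forall v, W v ->
  (limn_esup (log_rate (fun k => nrm (cocycle sigma L k w v))) <= kstar)%E.

Lemma decaying_Y j y : (0 < j)%N -> below l j -> Y j y -> decaying y.
Proof.
move=> j0 lj Yy; have [YV _ _ _] := Ysub lj; have Vy := YV _ Yy.
have [y0|y0] := eqVneq (nrm y) 0%E; last first.
  apply: decaying_nrm => // e e0.
  by apply: (decay_of_cvg_rate (lam0 j0 lj) (Yrate lj Yy _)) => //; apply/eqP.
split=> [|e e0]; first exact: Valpha_integrable.
exists 0%N => k _ D mD; rewrite (le_trans _ (ltW e0))//.
have := norm_Rintegral_le_Vnorm alpha e10 (measurable_pulled k mD)
  (Valpha_integrable Vy).
by rewrite y0 lee_fin.
Qed.

Lemma decaying_W v : W v -> decaying v.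
Proof.
move=> Wv; have [WV _ _ _] := Wsub.
apply: decaying_nrm; first exact: WV.
by apply: decay_of_rate; exact: le_lt_trans (Wrate Wv) kstar0.
Qed.

Lemma finite_sums_integrable g : finite_sums l Y g -> m.-integrable setT (EFin \o g).
Proof.
move=> [p [y [Yy ->]]].
rewrite (eq_bigr (fun j : 'I_p => (1 : R) *: y j)); last by move=> j _; rewrite scale1r.
apply: integrable_sum_lin => j; have [lj Yj] := Yy _ (ltn_ord j).
by have [YV _ _ _] := Ysub lj; exact/Valpha_integrable/YV.
Qed.

(** For infinite l the sum is a closure, and its elements inherit no rate from the summands. The
    norm bounds the integrals over all measurable sets at once, so the error does not depend on how
    often D is pulled back. *)
Lemma sum_spaces_approx s (e : R) : sum_spaces V nrm l Y s -> 0 < e ->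
  exists2 g, finite_sums l Y g & m.-integrable setT (EFin \o s) /\
    forall D, measurable D -> `|\int[m]_(x in D) s x - \int[m]_(x in D) g x| <= e.
Proof.
have := @finite_sums_integrable; rewrite /sum_spaces; case: l => [q|] fI Hs e0.
  by exists s => //; split=> [|D mD]; [exact: fI|rewrite subrr normr0 ltW].
have [Vs /(_ e e0)[g Hg sg]] := Hs; exists g => //.
have Is := Valpha_integrable Vs; have Ig := fI _ Hg.
split=> // D mD; rewrite -RintegralB_lin// -lee_fin.
apply: le_trans (ltW sg); apply: norm_Rintegral_le_Vnorm => //.
exact: integrableB_lin.
Qed.

Lemma finite_sums_head g : finite_sums l Y g ->
  exists y z, [/\ Y 0%N y, decaying z & g = y + z].
Proof.
move=> [[|p] [y [Yy ->]]].
  exists 0, 0; rewrite big_ord0 addr0; split=> //; last exact: decaying0.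
  by have [_ ? _ _] := Ysub l0.
exists (y 0%N), (\sum_(i < p) y i.+1); rewrite big_ord_recl; split=> //.
  by have [] := Yy 0%N isT.
apply: (big_ind decaying); [exact: decaying0|exact: decayingD|move=> i _].
by have [? ?] := Yy i.+1 (ltn_ord i); exact: (@decaying_Y i.+1).
Qed.

(** f is split into a finite sum, a remainder of norm below e / 2 and a part in W; all but the Y_1
    component of the finite sum decays. For infinite l, y may depend on e. *)
Lemma leading_part f (e : R) : V f -> 0 < e -> exists2 y, Y 0%N y &
  exists n0, forall k, (n0 <= k)%N -> forall D, measurable D ->
    `|\int[m]_(x in pulled k D) f x - \int[m]_(x in pulled k D) y x| <= e.
Proof.
move=> Vf e0; have e2 : 0 < e / 2 by rewrite divr_gt0.
have [_ /(_ f Vf)[s [v [Ys Wv fsv]]]] := YW.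
have [g Hg [Is sg]] := sum_spaces_approx Ys e2.
have [y [z [Yy [Iz Hz] gyz]]] := finite_sums_head Hg.
have [Iv Hv] := decaying_W Wv.
have [_ Hzv] := decayingD (conj Iz Hz) (conj Iv Hv).
exists y => //; have [n0 Hn] := Hzv _ e2; exists n0 => k nk D mD.
have mk := measurable_pulled k mD.
have Iy : m.-integrable setT (EFin \o y).
  by have [YV _ _ _] := Ysub l0; exact/Valpha_integrable/YV.
have Isv := integrableD_lin Is Iv.
rewrite (eq_Rintegral_Vnorm e10 mk (Valpha_integrable Vf) Isv fsv).
rewrite RintegralD_lin//.
have := Hn k nk D mD; have := sg _ mk; rewrite gyz !RintegralD_lin//.
rewrite !ler_norml; lra.
Qed.

End pointwise.

(** * The number of ergodic measures *)

(** Turns a bound on the size of families into a complete finite list: an element equivalent to no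
    member of a largest family could be added to it. *)
Lemma maximal_family (X : Type) (Q : X -> Prop) (e : X -> X -> Prop) (d : nat) :
  (forall x y, e x y -> e y x) ->
  (forall r (f : 'I_r -> X), (forall i, Q (f i)) ->
    (forall i j, e (f i) (f j) -> i = j) -> (r <= d)%N) ->
  exists r (f : 'I_r -> X), [/\ (r <= d)%N, (forall i, Q (f i)),
    (forall i j, e (f i) (f j) -> i = j) &
    (forall x, Q x -> exists i, e x (f i))].
Proof.
move=> esym bound; pose p r := `[< exists f : 'I_r -> X,
  (forall i, Q (f i)) /\ (forall i j, e (f i) (f j) -> i = j) >].
have ub r : p r -> (r <= d)%N by move=> /asboolP[f [? ?]]; exact: (bound r f).
have [|r /asboolP[f [Qf ef]] rmax] := ex_maxnP _ ub.
  have f0 : 'I_0 -> X by case.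
  by exists 0%N; apply/asboolP; exists f0; split=> -[].
exists r, f; split => // [|x Qx]; first exact: bound Qf ef.
apply: contrapT => nx; have : p r.+1; last by move=> /rmax; rewrite ltnn.
apply/asboolP; exists (fun i => if unlift ord0 i is Some j then f j else x).
split=> [i|i j]; first by case: unliftP => [j _|_].
case: unliftP => [i' ->|->]; case: unliftP => [j' ->|->] //.
- by move=> /ef ->.
- by move=> /esym fx; case: nx; exists i'.
- by move=> fx; case: nx; exists j'.
Qed.

Lemma ae_exists d (X : measurableType d) (R : realType) (P : probability X R)
  (Q : X -> Prop) : {ae P, forall w, Q w} -> exists w, Q w.
Proof.
move=> [Z [mZ Z0 QZ]]; apply: contrapT => nQ.
have ZT : Z = setT.
  by apply/seteqP; split=> // w _; apply: QZ => Qw; apply: nQ; exists w.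
have := probability_setT P; rewrite -ZT => P1.
by have := etrans (esym Z0) P1 => /esym/eqP; rewrite onee_eq0.
Qed.

Section dimension_bound.
Context (R : realType) (n : nat) (Om : ptopologicalType).
Local Notation E := 'rV[R]_n.+1.
Local Notation m := (lebesgue_rV R n.+1).
Variables (sigma : borel Om -> borel Om) (C : set E) (T : borel Om -> E -> E).
Variables (alpha e1 : R).
Local Notation V := (Valpha C alpha e1).
Local Notation nrm := (Vnorm (N := n.+1) alpha e1).
Local Notation pullF := (pull (setT `*` C) (skew_map T sigma)).
Hypotheses (a01 : 0 < alpha <= 1) (e10 : 0 < e1) (cC : compact C).
Hypothesis mF : measurable_fun (setT `*` C) (skew_map T sigma).
Hypothesis V1 : V \1_C.

(** The fiber at w of the k-th pull-back depends only on the fiber at sigma^k w. Hence, for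
    invariant A, pulling back the fiber of A at sigma^k w gives the fiber of A at w. *)
Lemma xsection_iter_pull k S S' w :
  xsection S (iter k sigma w) = xsection S' (iter k sigma w) ->
  xsection (iter k pullF S) w = xsection (iter k pullF S') w.
Proof.
elim: k S S' => [//|k IH] S S' SS'; rewrite !iterSr; apply: IH.
rewrite !xsection_pull; congr (_ `&` _ @^-1` _); exact: SS'.
Qed.

(* All that is used of the splitting: the integral of f over [pulled k D] is the
   integral over D of its image under the k-th cocycle, and for that integral
   the summands of f outside of Y_1 do not count in the limit. *)
Definition leading_at w (Y : set (E -> R)) : Prop :=
  forall f (e : R), V f -> 0 < e -> exists2 y, Y y &
  exists n0, forall k, (n0 <= k)%N -> forall D, measurable D ->
    `|\int[m]_(x in pulled sigma C T w k D) f x -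
      \int[m]_(x in pulled sigma C T w k D) y x| <= e.

Section fiber.
Variables (w : borel Om) (Y : set (E -> R)) (d r : nat).
Hypotheses (lw : leading_at w Y) (Ysub : Y `<=` V) (Yd : has_dim nrm Y d).
Variable A : 'I_r -> set (borel Om * E).
Hypotheses (mA : forall i, measurable (A i)) (AC : forall i, A i `<=` setT `*` C).
Hypothesis AA : forall i, pullF (A i) = A i.
Local Notation a i := (xsection (A i) w).

Lemma measurable_fiber i : measurable (a i).
Proof. exact: measurable_xsection. Qed.

Lemma fiber_sub i : a i `<=` C.
Proof. by move=> x; rewrite /xsection /= inE => /AC[]. Qed.

Lemma compact_lebesgue_lty : (m C < +oo)%E.
Proof.
have [M M0 CM] := compact_rV_bounded cC.
by apply: (@lebesgue_bounded_lty _ _ _ M) => //; exact: compact_measurable_rV.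
Qed.

Lemma integrable_fiber i : m.-integrable setT (EFin \o \1_(a i)).
Proof.
apply/integrableP; split.
  by apply/measurable_EFinP/measurable_indic; exact: measurable_fiber.
under eq_integral do rewrite /= normr_nat.
rewrite integral_indic//; last exact: measurable_fiber.
rewrite setIT; apply: le_lt_trans compact_lebesgue_lty.
apply: le_measure; rewrite ?inE//; [exact: measurable_fiber| |exact: fiber_sub].
exact: compact_measurable_rV.
Qed.

(** The r by d matrix of integrals of a basis of Y has a left kernel vector c, so the combination
    vanishes on Y; [leading_at] extends this to V, as the fibers of invariant sets are pull-backs of
    any order. *)
Lemma annihilator_gt_dim : (d < r)%N -> exists2 c : 'I_r -> R,
  (exists i, c i != 0) &
  forall f, V f -> \sum_i c i * \int[m]_(x in a i) f x = 0.
Proof.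
move=> dr; have [b [Yb _ bspan]] := Yd.
pose M : 'M[R]_(r, d) := \matrix_(i, p) \int[m]_(x in a i) b p x.
have /rowV0Pn[c /sub_kermxP cM c0] : kermx M != 0.
  rewrite -mxrank_eq0 -lt0n mxrank_ker subn_gt0.
  by apply: leq_ltn_trans dr; exact: rank_leq_col.
exists (c ord0).
  by have /rV0Pn[i ci] := c0; exists i.
have Y0 y : Y y -> \sum_i c ord0 i * \int[m]_(x in a i) y x = 0.
  move=> Yy; have [t yt] := bspan y Yy.
  have Ib p : m.-integrable setT (EFin \o b p).
    by apply: Valpha_integrable; exact/Ysub/Yb.
  have Iy := Valpha_integrable (Ysub Yy).
  under eq_bigr => i _.
    rewrite (eq_Rintegral_Vnorm e10 (measurable_fiber i) Iy _ yt); last first.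
      exact: integrable_sum_lin.
    rewrite (Rintegral_sum_lin _ (measurable_fiber i) Ib) mulr_sumr; over.
  rewrite exchange_big big1//= => p _.
  have := congr1 (fun v : 'rV_d => v ord0 p) cM; rewrite !mxE => h.
  rewrite (eq_bigr (fun i => t p * (c ord0 i * M i p))) -?mulr_sumr ?h ?mulr0//.
  by move=> i _; rewrite mxE mulrCA.
move=> f Vf; set s := \sum_i _; apply/eqP; apply: contraT => s0.
(* With error |s| / (2 K) in each integral, s would be at most |s| / 2 in absolute value. *)
pose K := \sum_i `|c ord0 i| + 1; have K0 : 0 < K.
  by rewrite ltr_wpDl// sumr_ge0.
have e0 : 0 < `|s| / K / 2 by rewrite !divr_gt0// normr_gt0.
have [y Yy [k Hk]] := lw Vf e0.
(* [leading_at] is applied with D the fiber of A i at sigma^k w, whose pull-back is the fiber at w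
   itself. *)
have Hi i : `|\int[m]_(x in a i) f x - \int[m]_(x in a i) y x| <= `|s| / K / 2.
  have := Hk k (leqnn k) (xsection (A i) (iter k sigma w)) (measurable_xsection _ (mA i)).
  rewrite /pulled (@xsection_iter_pull k _ (A i)); last by rewrite xsection_setT.
  by have -> : iter k pullF (A i) = A i by elim: (k) => //= j ->.
have sE : s = \sum_i c ord0 i * (\int[m]_(x in a i) f x - \int[m]_(x in a i) y x).
  by under [RHS]eq_bigr do rewrite mulrBr; rewrite sumrB (Y0 y Yy) subr0.
clearbody s.
have : `|s| <= K * (`|s| / K / 2).
  rewrite {1}sE (le_trans (ler_norm_sum _ _ _))//.
  rewrite /K mulrDl mul1r ler_wpDr ?(ltW e0)// mulr_suml; apply: ler_sum => i _.
  by rewrite normrM ler_wpM2l.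
have -> : K * (`|s| / K / 2) = `|s| / 2.
  by rewrite !mulrA [K * _]mulrC mulfK// gt_eqF.
have := normr_gt0 s; rewrite s0; lra.
Qed.

Variable kappa : 'I_r -> {measure set E -> \bar R}.
Hypothesis kappam : forall j, kappa j `<< m.
Hypothesis kappaC : forall j, kappa j C = 1%E.
Hypothesis kappaD : forall j, kappa j (~` a j) = 0%E.
Hypothesis kappaO : forall i j, i != j -> kappa j (a i) = 0%E.

Lemma fiber_card_le_dim : (r <= d)%N.
Proof.
rewrite leqNgt; apply/negP => /annihilator_gt_dim[c [j cj] cV].
pose g : E -> R := \sum_i c i *: \1_(a i).
have gE x : g x = \sum_i c i * \1_(a i) x.
  rewrite /g; elim/big_ind2 : _ => // f1 r1 f2 r2 h1 h2.
  by rewrite -h1 -h2.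
have Ig : m.-integrable setT (EFin \o g).
  exact: integrable_sum_lin integrable_fiber.
have g0 : {ae m, forall x, g x = 0}.
  apply: ae0_lipschitz => // K h K0 h01 hK mh.
  pose f i : E -> R := fun x => \1_(a i) x * h x.
  have If i : m.-integrable setT (EFin \o f i).
    apply: le_integrable (integrable_fiber i) => //.
      apply/measurable_EFinP; apply: measurable_funM => //.
      apply: measurable_indic; exact: measurable_fiber.
    move=> x _; rewrite /= lee_fin normrM ler_piMr//.
    by have /andP[? ?] := h01 x; rewrite ger0_norm.
  have -> : (fun x => g x * h x) = \sum_i c i *: f i.
    apply/funext => x; rewrite gE mulr_suml.
    transitivity (\sum_i c i * f i x); first by apply: eq_bigr => i _; rewrite mulrA.
    by elim/big_ind2 : _ => // u1 r1 u2 r2 -> ->.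
  rewrite Rintegral_sum_lin//.
  (* h cut off to C belongs to V, so the relation between the functionals applies to it. *)
  rewrite -[RHS](cV _ (Valpha_lipschitz cC a01 e10 K0 h01 hK V1)).
  apply: eq_bigr => i _; congr (_ * _); rewrite [RHS]Rintegral_mkcond.
  apply: eq_Rintegral => x _; rewrite patchE /f !indicE.
  have [xa|xa] := boolP (x \in a i); last by rewrite mul0r.
  by rewrite mem_set//; apply: (@fiber_sub i); exact/set_mem.
have [N [mN N0 gN]] := g0.
have kN : kappa j N = 0%E.
  by have /null_content_dominatesP := @kappam j; apply.
have : (kappa j).-negligible setT.
  (* A point outside these null sets lies in a j and in no other fiber; there g equals c j, which is
     nonzero, so no such point exists. *)
  rewrite (_ : setT = N `|` ((~` a j) `|` \bigcup_(i in [set i | i != j]) a i)).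
    apply: negligibleU; first by apply/negligibleP.
    apply: negligibleU.
      by apply/negligibleP; [exact: measurableC (measurable_fiber j)|exact: kappaD].
    rewrite bigcup_mkcond.
    have -> : \bigcup_i (if i \in [set i | i != j] then a i else set0) =
        \big[setU/set0]_(i : 'I_r) (if i \in [set i | i != j] then a i else set0).
      rewrite -bigcup_seq; apply/seteqP; split=> x [i _ xi]; exists i => //.
      by rewrite /= mem_index_enum.
    apply: big_ind; [exact: negligible_set0|by move=> *; exact: negligibleU|].
    move=> i _; case: ifPn => [|_]; last exact: negligible_set0.
    rewrite inE /= => ij; apply/negligibleP; first exact: measurable_fiber.
    exact: kappaO.
  apply/seteqP; split=> // x _.
  have [xj|] := pselect (a j x); last by right; left.
  have [xi|xi] := pselect (exists2 i, i != j & a i x); first by right; right.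
  left; apply: gN => /= gx; move/negP: cj; apply; rewrite -gx gE (bigD1 j)//=.
  rewrite big1 ?addr0 ?indicE ?mem_set ?mulr1// => i ij.
  by rewrite indicE memNset ?mulr0// => ax; apply: xi; exists i.
move=> [Z [mZ Z0 TZ]]; have := kappaC j.
have mC := compact_measurable_rV cC.
have : (kappa j C <= kappa j Z)%E.
  by apply: le_measure; rewrite ?inE//; exact: subset_trans TZ.
by rewrite Z0 => + k1; rewrite k1 leNgt lte01.
Qed.

End fiber.

Variable P : probability (borel Om) R.
Hypothesis TC : forall w, T w @` C `<=` C.

Lemma acip_cylinder mu : skew_acip P C T sigma mu -> mu (setT `*` C) = 1%E.
Proof.
move=> [_ [k [kC ->]]]; last first.
  by apply: measurableX => //; exact: compact_measurable_rV.
under eq_integral => w _ do rewrite xsection_setT (kC w).1.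
rewrite integral_cst// mul1e; exact: probability_setT.
Qed.

Lemma acip_null_fiber mu (k : R.-pker (borel Om) ~> E) A : measurable A ->
  mu A = 0%E -> (mu A = \int[P]_w k w (xsection A w))%E ->
  {ae P, forall w, k w (xsection A w) = 0%E}.
Proof.
move=> mA -> /esym k0.
have mk : measurable_fun setT (fun w => k w (xsection A w)).
  by apply: measurable_fun_xsection_finite_kernel; rewrite inE.
have : ae_eq P setT (fun w => k w (xsection A w)) (cst 0%E).
  apply/ae_eq_integral_abs => //; rewrite -[RHS]k0; apply: eq_integral => w _.
  by rewrite gee0_abs.
by apply: filterS => w /(_ I).
Qed.

Lemma acip_card_le_dim (Y : borel Om -> set (E -> R)) (d r : nat)
    (mu : 'I_r -> probability (borel Om * E)%type R) :
  {ae P, forall w, [/\ leading_at w (Y w), Y w `<=` V & has_dim nrm (Y w) d]} ->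
  (forall i, skew_acip P C T sigma (mu i) /\ skew_ergodic C T sigma (mu i)) ->
  (forall i j, (forall A, measurable A -> mu i A = mu j A) -> i = j) ->
  (r <= d)%N.
Proof.
move=> good acip inj; have mC := compact_measurable_rV cC.
have mZ : measurable ([set: borel Om] `*` C) by exact: measurableX.
have ZZ : pullF (setT `*` C) = setT `*` C.
  apply/seteqP; split=> [[w x] []//|[w x] /= [_ Cx]]; split=> //; split=> //=.
  by apply: (@TC w); exists x.
(* On the diagonal the whole cylinder serves as a filler, so that the choice can be made over all
   pairs. *)
have sep (p : 'I_r * 'I_r) : exists A, [/\ measurable A, A `<=` setT `*` C,
    pullF A = A, mu p.1 A = 1%E & p.1 != p.2 -> mu p.2 A = 0%E].
  case: p => i j /=; have [->|ij] := eqVneq i j.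
    by exists (setT `*` C); split => //; apply: acip_cylinder; have [] := acip j.
  have [[inv1 _] erg1] := acip i; have [[inv2 _] erg2] := acip j.
  have [|A [mA AZ AA A1 A0]] := ergodic_separation mZ mF inv1 inv2 erg1 erg2.
    apply: contrapT => h; move/negP: ij; apply; apply/eqP/inj => A mA.
    by apply: contrapT => ne; apply: h; exists A.
  by exists A.
have [S HS] := choice sep.
(* Full for mu i and null for every other mu j; any overlaps are null for each of the measures. *)
pose A i := \bigcap_j S (i, j).
have mA i : measurable (A i).
  by apply: fin_bigcap_measurable => // j _; have [] := HS (i, j).
have AZ i : A i `<=` setT `*` C.
  by move=> p /(_ i I); have [_ + _ _ _] := HS (i, i); exact.
have AA i : pullF (A i) = A i.
  apply/seteqP; split=> [p [Zp Ap] j _|p Ap].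
    by have [_ _ <- _ _] := HS (i, j); split => //; exact: Ap.
  split=> [|j _]; first exact: AZ Ap.
  have [_ _ Sij _ _] := HS (i, j).
  by have [] : pullF (S (i, j)) p by rewrite Sij; exact: Ap.
have A1 i : mu i (~` A i) = 0%E.
  rewrite setC_bigcap; apply/negligibleP.
    by apply: fin_bigcup_measurable => // j _; apply: measurableC; have [] := HS (i, j).
  rewrite (_ : \bigcup_j _ = \big[setU/set0]_(j : 'I_r) ~` S (i, j)); last first.
    rewrite -bigcup_seq; apply/seteqP; split=> x [j _ xj]; exists j => //.
    by rewrite /= mem_index_enum.
  apply: big_ind; [exact: negligible_set0|by move=> *; exact: negligibleU|].
  move=> j _; have [mS _ _ S1 _] := HS (i, j).
  apply/negligibleP; first exact: measurableC.
  apply: (etrans (probability_setC (mu i) mS)).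
  by rewrite [X in (1 - X)%E]S1 subee.
have A0 i j : i != j -> mu j (A i) = 0%E.
  move=> ij; have [mS _ _ _ /(_ ij) S0] := HS (i, j).
  by apply: subset_measure0 S0 => // p /(_ j I).
have kex j : exists k : R.-pker (borel Om) ~> E,
    (forall w, k w C = 1%E /\ k w `<< m) /\
    (forall A, measurable A -> mu j A = \int[P]_w k w (xsection A w))%E.
  by have [[]] := acip j.
have [k Hk] := choice kex.
have k1 : {ae P, forall w, forall j, k j w (~` xsection (A j) w) = 0%E}.
  apply: filter_forall => j.
  have := acip_null_fiber (measurableC (mA j)) (A1 j) ((Hk j).2 _ (measurableC (mA j))).
  apply: filterS => w <-; congr (k j w _).
  by apply/seteqP; split=> x; rewrite /xsection /= !inE.
have k0 : {ae P, forall w, forall i j, i != j -> k j w (xsection (A i) w) = 0%E}.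
  apply: filter_forall => i; apply: filter_forall => j.
  have [->|ij] := eqVneq i j; first by apply: aeW => w.
  have := acip_null_fiber (mA i) (A0 i j ij) ((Hk j).2 _ (mA i)).
  by apply: filterS => w kw _.
(* The bound on r follows from a single fiber on which all the almost sure properties hold. *)
have [w [[lw Yw dw] [w1 w0]]] : exists w, [/\ leading_at w (Y w), Y w `<=` V &
    has_dim nrm (Y w) d] /\ ((forall j, k j w (~` xsection (A j) w) = 0%E) /\
    forall i j, i != j -> k j w (xsection (A i) w) = 0%E).
  have [w [? [? ?]]] := ae_exists (filterI good (filterI k1 k0)).
  by exists w.
apply: (@fiber_card_le_dim w (Y w) d r lw Yw dw A mA AZ AA (fun j => k j w)) => //.
- by move=> j; exact: ((Hk j).1 w).2.
- by move=> j; exact: ((Hk j).1 w).1.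
Qed.

End dimension_bound.

(** * The averaged densities *)

Section exact_solution.
Context (R : realType) (d : nat).

(* A vector that is approximated by a finite-dimensional space in every finite
   set of coordinates belongs to it: finite-dimensional subspaces are closed,
   and finitely many coordinates already separate the points of the space. *)
Lemma exact_solution (phi : nat -> 'I_d -> R) (x : nat -> R) :
  (forall k (e : R), 0 < e -> exists a : 'I_d -> R, forall i, (i < k)%N ->
     `|x i - \sum_p a p * phi i p| <= e) ->
  (forall a : 'I_d -> R, (forall i, \sum_p a p * phi i p = 0) ->
     forall p, a p = 0) ->
  exists a : 'I_d -> R, forall i, x i = \sum_p a p * phi i p.
Proof.
move=> approx sep.
pose M k : 'M[R]_(d, k) := \matrix_(p, i) phi i p.
pose X k : 'rV[R]_k := \row_i x i.
have Mi k (a : 'rV[R]_d) i : (a *m M k) ord0 i = \sum_p a ord0 p * phi i p.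
  by rewrite mxE; apply: eq_bigr => p _; rewrite mxE.
have XM k : (X k <= M k)%MS.
  (* The row space is the kernel of [cokermx], a bounded linear map that kills all the approximants
     and hence x. *)
  rewrite submxE; apply/eqP; have [K K0 HK] := mulmx_bound (cokermx (M k)).
  apply/eqP; rewrite -normr_eq0 eq_le normr_ge0 andbT.
  apply/ler_addgt0Pr => e e0; rewrite add0r.
  have [a Ha] := approx k (e / K) (divr_gt0 e0 K0).
  have -> : X k *m cokermx (M k) = (X k - (\row_p a p) *m M k) *m cokermx (M k).
    by rewrite mulmxBl -mulmxA mulmx_coker mulmx0 subr0.
  rewrite (le_trans (HK _))// mulrC -ler_pdivlMr//.
  apply/rV_normP => [|i]; first by rewrite divr_ge0// ltW.
  have -> : (X k - (\row_p a p) *m M k) ord0 i = x i - \sum_p a p * phi i p.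
    by rewrite !mxE; congr (_ - _); apply: eq_bigr => p _; rewrite !mxE.
  exact: Ha.
(* At a truncation of maximal rank the kernel no longer shrinks; a nonzero vector in it would vanish
   in every coordinate, against [sep]. *)
have [k0 free] : exists k0, row_free (M k0).
  pose p r := `[< exists k, \rank (M k) = r >].
  have p0 : exists r, p r by exists (\rank (M 0%N)); apply/asboolP; exists 0%N.
  have pd r : p r -> (r <= d)%N by move=> /asboolP[k <-]; exact: rank_leq_row.
  have [r /asboolP[k kr] rmax] := ex_maxnP p0 pd.
  exists k; apply: contraT; rewrite /row_free neq_ltn [X in _ || X]ltnNge rank_leq_row orbF => kd.
  have /rowV0Pn[v /sub_kermxP vM v0] : kermx (M k) != 0.
    by rewrite -mxrank_eq0 -lt0n mxrank_ker subn_gt0.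
  have vk k' : (k <= k')%N -> v *m M k' = 0.
    move=> kk; have sub : (kermx (M k') <= kermx (M k))%MS.
      apply/sub_kermxP; apply/matrixP => a i; rewrite mxE [RHS]mxE.
      transitivity ((kermx (M k') *m M k') a (widen_ord kk i)).
        by rewrite [RHS]mxE; apply: eq_bigr => q _; rewrite !mxE.
      by rewrite mulmx_ker mxE.
    apply/sub_kermxP; have := mxrank_leqif_eq sub; rewrite !mxrank_ker => -[_ h].
    have : (kermx (M k') == kermx (M k))%MS.
      rewrite -h eqn_leq leq_sub2l ?andTb; last first.
        rewrite -(mxrank_tr (M k)) -(mxrank_tr (M k')).
        have -> : (M k)^T = rowsub (widen_ord kk) (M k')^T.
          by apply/matrixP => i q; rewrite !mxE.
        exact: mxrankS (rowsub_sub _ _).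
      by rewrite leq_sub2l// kr; apply: rmax; apply/asboolP; exists k'.
    move=> /eqmxP->; exact/sub_kermxP.
  case/negP: v0; apply/eqP/rowP => q; rewrite mxE.
  apply: (sep (v ord0)) => i; have i_lt : (i < maxn k i.+1)%N by rewrite leq_maxr.
  have := congr1 (fun A : 'rV_(maxn k i.+1) => A ord0 (Ordinal i_lt))
    (vk _ (leq_maxl k i.+1)).
  by rewrite Mi mxE.
have [a aM] := submxP (XM k0); exists (a ord0) => i.
have i_lt : (i < maxn k0 i.+1)%N by rewrite leq_maxr.
have [b bM] := submxP (XM (maxn k0 i.+1)).
(* Solutions of the truncation k0 are unique, so the solution of a longer truncation is the same
   vector. *)
have -> : a = b.
  apply: (row_free_inj free); rewrite -aM; apply/rowP => j.
  have := congr1 (fun A : 'rV_(maxn k0 i.+1) =>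
    A ord0 (widen_ord (leq_maxl k0 i.+1) j)) bM.
  by rewrite !Mi !mxE.
have := congr1 (fun A : 'rV_(maxn k0 i.+1) => A ord0 (Ordinal i_lt)) bM.
by rewrite Mi mxE.
Qed.

End exact_solution.

(** * Distance to a subspace seen through finitely many integrals *)

Section distance.
Context (R : realType) (N : nat).
Local Notation E := 'rV[R]_N.
Local Notation m := (lebesgue_rV R N).
Variables (C : set E) (alpha e1 : R).
Local Notation V := (Valpha C alpha e1).
Local Notation nrm := (Vnorm (N := N) alpha e1).
Hypothesis e10 : 0 < e1.
Variables (q : nat) (D : 'I_q -> set E).
Hypothesis mD : forall i, measurable (D i).

Definition integrals (f : E -> R) : 'rV[R]_q := \row_i \int[m]_(x in D i) f x.

Definition integrals_dist (x : 'rV[R]_q) (Y : set (E -> R)) : R :=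
  inf [set `|x - integrals y| | y in Y].

Local Notation rho := integrals_dist.

Lemma integrals_lin (a : R) f g : m.-integrable setT (EFin \o f) ->
  m.-integrable setT (EFin \o g) ->
  integrals (a *: f + g) = a *: integrals f + integrals g.
Proof. by move=> If Ig; apply/rowP => i; rewrite !mxE Rintegral_lin. Qed.

Lemma integrals_zero : integrals 0 = 0.
Proof. by apply/rowP => i; rewrite !mxE Rintegral_zero. Qed.

Lemma integralsZ (a : R) f : m.-integrable setT (EFin \o f) ->
  integrals (a *: f) = a *: integrals f.
Proof.
move=> If; have := integrals_lin a If (@integrable_zero R N).
by rewrite addr0 integrals_zero addr0.
Qed.

Lemma integralsD f g : m.-integrable setT (EFin \o f) ->
  m.-integrable setT (EFin \o g) -> integrals (f + g) = integrals f + integrals g.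
Proof. by move=> If Ig; rewrite -{1}[f]scale1r integrals_lin// scale1r. Qed.

Lemma integralsB f g : m.-integrable setT (EFin \o f) ->
  m.-integrable setT (EFin \o g) -> integrals (f - g) = integrals f - integrals g.
Proof.
by move=> If Ig; rewrite -scaleN1r addrC integrals_lin// scaleN1r addrC.
Qed.

Lemma norm_integrals_le f : m.-integrable setT (EFin \o f) ->
  (`|integrals f|%:E <= L1norm f)%E.
Proof.
move=> If; have L0 : (0 <= L1norm f)%E by rewrite L1normE integral_ge0.
have Loo : (L1norm f < +oo)%E by rewrite L1normE; case/integrableP : If.
have Lf : L1norm f \is a fin_num by rewrite ge0_fin_numE.
rewrite -(fineK Lf) lee_fin; apply/rV_normP => [|i]; first exact: fine_ge0.
by rewrite mxE -lee_fin fineK// norm_Rintegral_le.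
Qed.

Section one_space.
Variable Y : set (E -> R).
Hypothesis Ysub : Defs.subspace V nrm Y.

Lemma subspace_integrable y : Y y -> m.-integrable setT (EFin \o y).
Proof. by have [YV _ _ _] := Ysub; move=> /YV[[]]. Qed.

Let Y0 : Y 0. Proof. by have [] := Ysub. Qed.

Let lbY x : has_lbound [set `|x - integrals y| | y in Y].
Proof. by exists 0 => _ [y _ <-]. Qed.

Let neY x : [set `|x - integrals y| | y in Y] !=set0.
Proof. by exists `|x - integrals 0|, 0. Qed.

Lemma integrals_dist_le x y : Y y -> rho x Y <= `|x - integrals y|.
Proof. by move=> Yy; apply: ge_inf => //; exists y. Qed.

Lemma integrals_dist_ge0 x : 0 <= rho x Y.
Proof. by apply: lb_le_inf => // _ [y _ <-]. Qed.

Lemma integrals_dist_le_norm x : rho x Y <= `|x|.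
Proof. by have := integrals_dist_le x Y0; rewrite integrals_zero subr0. Qed.

Lemma integrals_dist_lt x c : rho x Y < c -> exists2 y, Y y & `|x - integrals y| < c.
Proof. by move=> /(inf_lt (neY x))[_ [y Yy <-]]; exists y. Qed.

Lemma integrals_dist_approx x (e : R) : 0 < e ->
  exists2 y, Y y & `|x - integrals y| < rho x Y + e.
Proof. by move=> e0; apply: integrals_dist_lt; rewrite ltrDl. Qed.

Lemma integrals_dist_shift x x' : rho x Y <= rho x' Y + `|x - x'|.
Proof.
apply/ler_addgt0Pr => e e0; have [y Yy xy] := integrals_dist_approx x' e0.
have := integrals_dist_le x Yy; have := ler_distD x' x (integrals y); lra.
Qed.

Lemma integrals_distD x x' : rho (x + x') Y <= rho x Y + rho x' Y.
Proof.
apply/ler_addgt0Pr => e e0; have e2 : 0 < e / 2 by rewrite divr_gt0.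
have [y Yy xy] := integrals_dist_approx x e2.
have [y' Yy' xy'] := integrals_dist_approx x' e2.
have Yyy : Y (y + y').
  by have [_ _ lin _] := Ysub; have := lin 1 y y' Yy Yy'; rewrite scale1r.
have := integrals_dist_le (x + x') Yyy.
rewrite (integralsD (subspace_integrable Yy) (subspace_integrable Yy')).
rewrite opprD addrACA => h.
by have := ler_normD (x - integrals y) (x' - integrals y'); lra.
Qed.

Lemma integrals_distZ x (a : R) : 0 <= a -> rho (a *: x) Y <= a * rho x Y.
Proof.
move=> a0; apply/ler_addgt0Pr => e e0.
have a1 : 0 < a + 1 by rewrite ltr_wpDl.
have [y Yy xy] := integrals_dist_approx x (divr_gt0 e0 a1).
have Yay : Y (a *: y).
  by have [_ _ lin _] := Ysub; have := lin a y 0 Yy Y0; rewrite addr0.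
apply: le_trans (integrals_dist_le _ Yay) _.
rewrite (integralsZ a (subspace_integrable Yy)) -scalerBr normrZ ger0_norm// (le_trans (ler_wpM2l a0 (ltW xy)))//.
rewrite mulrDr lerD2l mulrCA ler_piMr ?(ltW e0)// ler_pdivrMr// mul1r.
by rewrite lerDl.
Qed.

Lemma integrals_dist_mean k (x : nat -> 'rV[R]_q) :
  rho (k.+1%:R^-1 *: \sum_(i < k.+1) x i) Y <= k.+1%:R^-1 * \sum_(i < k.+1) rho (x i) Y.
Proof.
apply: le_trans (integrals_distZ _ _) _; first by rewrite invr_ge0.
rewrite ler_wpM2l ?invr_ge0//.
apply: (big_ind2 (fun (u : 'rV[R]_q) r => rho u Y <= r)) => //.
  by rewrite (le_trans (integrals_dist_le_norm _))// normr0.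
by move=> u r u' r' ur ur'; rewrite (le_trans (integrals_distD _ _))// lerD.
Qed.

End one_space.

(** Semicontinuity in the gap metric: a witness y of [rho x Y < c] is approximated from Y'. The gap
    compares unit balls only, so y is first scaled into the unit ball and the approximant scaled
    back. *)
Lemma integrals_dist_gap Y y x c : Defs.subspace V nrm Y -> Y y ->
  `|x - integrals y| < c -> exists2 e : R, 0 < e &
  forall Y', Defs.subspace V nrm Y' -> (gap nrm Y Y' < e%:E)%E -> rho x Y' < c.
Proof.
move=> Ysub Yy yc; have [YV Y0 lin _] := Ysub.
have Iy := subspace_integrable Ysub Yy.
have [[_ _] oscy] := YV _ Yy.
have ny : nrm y \is a fin_num.
  rewrite ge0_fin_numE ?Vnorm_ge0// /Vnorm lte_add_pinfty//.
  by rewrite L1normE; case/integrableP : Iy.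
(* The 1 keeps t positive even when y has norm 0; below, the slack is divided by t because scaling
   back multiplies the error by t. *)
pose t := fine (nrm y) + 1; have t0 : 0 < t.
  by rewrite ltr_wpDl// fine_ge0// Vnorm_ge0.
pose y1 := t^-1 *: y.
have yE : y = t *: y1 by rewrite scalerA mulfV ?scale1r// gt_eqF.
have Yy1 : Y y1 by have := lin t^-1 y 0 Yy Y0; rewrite addr0.
have Iy1 := subspace_integrable Ysub Yy1.
have ny1 : (nrm y1 <= 1)%E.
  apply: le_trans (VnormZ _ e10 _ _) _; first by rewrite invr_gt0.
  rewrite -(fineK ny) -EFinM lee_fin mulrC ler_pdivrMr// mul1r /t.
  by rewrite lerDl.
pose e := (c - `|x - integrals y|) / t.
have e0 : 0 < e by rewrite divr_gt0// subr_gt0.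
exists e => // Y' Ysub' gapY.
have [YV' Y0' lin' _] := Ysub'.
have [g [Yg _] gy] : exists2 g : E -> R, unit_ball nrm Y' g & (nrm (y1 - g)%R < e%:E)%E.
  have : (ereal_inf [set nrm (y1 - g)%R | g in unit_ball nrm Y'] < e%:E)%E.
    apply: le_lt_trans gapY; rewrite /gap le_max; apply/orP; left.
    by apply: ereal_sup_ubound; exists y1.
  by move=> /ereal_inf_lt[_ [g ug <-]]; exists g.
have Ig := subspace_integrable Ysub' Yg.
have Ytg : Y' (t *: g) by have := lin' t g 0 Yg Y0'; rewrite addr0.
apply: le_lt_trans (integrals_dist_le x Ytg) _.
have Id := integrableB_lin Iy1 Ig.
have dlt : `|integrals (y1 - g)| < e.
  rewrite -lte_fin; apply: le_lt_trans gy.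
  apply: le_trans (norm_integrals_le Id) _; exact: L1norm_le_Vnorm.
have -> : x - integrals (t *: g) = (x - integrals y) + t *: integrals (y1 - g).
  by rewrite integralsB// {1}yE !integralsZ// scalerBr addrA subrK.
apply: le_lt_trans (ler_normD _ _) _.
rewrite normrZ (gtr0_norm t0) -ltrBrDl -ltr_pdivlMl// mulrC; exact: dlt.
Qed.

End distance.

Section distance_measurable.
Context (R : realType) (N : nat) (Om : ptopologicalType).
Local Notation E := 'rV[R]_N.
Variables (C : set E) (alpha e1 : R).
Local Notation V := (Valpha C alpha e1).
Local Notation nrm := (Vnorm (N := N) alpha e1).
Hypothesis e10 : 0 < e1.
Variables (q : nat) (D : 'I_q -> set E).
Hypothesis mD : forall i, measurable (D i).
Variables (G A : set (borel Om)) (Y : borel Om -> set (E -> R)).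
Hypotheses (mG : measurable G) (GA : G `<=` A).
Hypothesis Ysub : forall w, G w -> Defs.subspace V nrm (Y w).
Hypothesis Ycont : P_continuous_on A (fun w w' => gap nrm (Y w) (Y w')).

Local Notation rho x w := (integrals_dist D x (Y w)).

(** On each piece where Y is continuous, the sublevel set is relatively open by
    [integrals_dist_gap]. *)
Lemma measurable_sublevel x c : measurable (G `&` [set w | rho x w < c]).
Proof.
have [F [mF FA Fcont]] := Ycont.
have -> : G `&` [set w | rho x w < c] =
    \bigcup_j (G `&` F j `&` [set w | rho x w < c]).
  apply/seteqP; split=> [w [Gw wc]|w [j _ [[Gw _] wc]]]; last by split.
  have : A w by exact: GA.
  by rewrite -FA => -[j _ Fw]; exists j.
apply: bigcupT_measurable => j.
(* Stating the membership in G and F j as premises makes a relatively open set the trace of an open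
   set of Om. *)
pose O : set Om := interior [set w : Om | G w -> F j w -> rho x w < c].
have -> : G `&` F j `&` [set w | rho x w < c] = G `&` F j `&` O.
  apply/seteqP; split=> [w [[Gw Fw] wc]|w [[Gw Fw] Ow]]; split=> //; last first.
    exact: (interior_subset Ow).
  have [y Yy yc] := integrals_dist_lt (Ysub Gw) wc.
  have [e e0 He] := integrals_dist_gap e10 mD (Ysub Gw) Yy yc.
  have := Fcont j w Fw e e0; rewrite near_withinE => near_gap.
  apply: (@filterS Om _ (nbhs_filter (w : Om)) _ _ _ near_gap) => w' h Gw' Fw'.
  apply: He; first exact: Ysub.
  exact: h.
apply: measurableI; first exact: measurableI.
by apply: sub_sigma_algebra; exact: open_interior.
Qed.

(** The moving vector X w is replaced by rational vectors: the distance is 1-Lipschitz in its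
    vector, so the error is controlled by that of the approximation. *)
Lemma measurable_integrals_dist (X : borel Om -> 'rV[R]_q) :
  measurable_fun setT X -> measurable_fun G (fun w => rho (X w) w : measurableTypeR R).
Proof.
move=> mX _; apply: (measurability _ (RGenInftyO.measurableE R)) => //.
move=> _ [_ [c ->] <-].
pose cq (z : 'rV[rat]_q) : 'rV[R]_q := map_mx ratr z.
have -> : G `&` (fun w => rho (X w) w) @^-1` `]-oo, c[%classic =
    \bigcup_(p : 'rV[rat]_q * nat)
      ((G `&` [set w | rho (cq p.1) w < c - p.2.+1%:R^-1]) `&`
       X @^-1` ball (cq p.1) p.2.+1%:R^-1).
  apply/seteqP; split=> [w [Gw]|w [[z k] _ /= [[Gw wc]]]]; last first.
    rewrite mx_norm_ball /ball_ /= => Xw; split=> //=; rewrite in_itv/=.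
    have := integrals_dist_shift D (Ysub Gw) (X w) (cq z).
    rewrite distrC => /le_lt_trans; apply; rewrite -[ltRHS](subrK (k.+1%:R^-1)).
    exact: ltrD.
  rewrite /= in_itv/= => wc.
  have d0 : 0 < (c - rho (X w) w) / 2 by rewrite divr_gt0// subr_gt0.
  have [k _ /(_ _ (leqnn _)) /= ke] := near_infty_natSinv_lt (PosNum d0).
  have k0 : 0 < k.+1%:R^-1 :> R by rewrite invr_gt0.
  have [z Hz] : {z : 'I_q -> rat & forall i, `|X w ord0 i - ratr (z i)| <= k.+1%:R^-1 / 2}.
    apply: (@choice _ _ (fun i r => `|X w ord0 i - ratr r| <= k.+1%:R^-1 / 2)) => i.
    have k2 : 0 < k.+1%:R^-1 / 2 :> R by rewrite divr_gt0.
    have [y [yX [r _ ry]]] := @dense_rat R (ball (X w ord0 i) (k.+1%:R^-1 / 2))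
      (ex_intro _ _ (ballxx (X w ord0 i) k2)) (ball_open (X w ord0 i) _).
    by exists r; rewrite ry; apply: ltW; exact: yX.
  have zX : `|cq (\row_i z i) - X w| < k.+1%:R^-1.
    rewrite distrC; apply: (@le_lt_trans _ _ (k.+1%:R^-1 / 2)); last first.
      by rewrite ltr_pdivrMr// ltr_pMr// ltr1n.
    apply/rV_normP => [|i]; first by rewrite divr_ge0// ltW.
    by rewrite !mxE; exact: Hz.
  exists (\row_i z i, k) => //=; split; last by rewrite mx_norm_ball.
  split=> //; have := integrals_dist_shift D (Ysub Gw) (cq (\row_i z i)) (X w).
  move=> /le_lt_trans; apply; move: zX ke wc => /=.
  by move: (k.+1%:R^-1) `|_| => r u; lra.
apply: countable_bigcupT_measurable => [|p]; first exact: countableP.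
apply: measurableI; first exact: measurable_sublevel.
rewrite -[X in measurable X]setTI; apply: mX => //.
apply: open_measurable_rV; apply: ball_open; by rewrite invr_gt0.
Qed.

End distance_measurable.

Lemma cvg_succ (X : ptopologicalType) (u : nat -> X) (l : X) :
  u k @[k --> \oo] --> l -> u k.+1 @[k --> \oo] --> l.
Proof. by rewrite -(cvg_shiftS u). Qed.

Section cesaro_ae.
Context d (X : measurableType d) (R : realType) (P : probability X R).
Variables (e : nat -> X -> R) (M : R).
Hypotheses (me : forall k, measurable_fun setT (e k)).
Hypotheses (e0 : forall k w, 0 <= e k w) (eM : forall k w, e k w <= M).
Hypothesis e_cvg : (\int[P]_w (e k w)%:E)%E @[k --> \oo] --> 0%E.

Lemma integrable_bounded (f : X -> R) : measurable_fun setT f ->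
  (forall w, 0 <= f w <= M) -> P.-integrable setT (EFin \o f).
Proof.
move=> mf fM; apply: (@le_integrable _ _ _ P setT measurableT _ (cst M%:E)).
- exact/measurable_EFinP.
- move=> w _; have /andP[f0 f1] := fM w; rewrite /= lee_fin !ger0_norm//.
  exact: le_trans f1.
- exact: finite_measure_integrable_cst.
Qed.

(** The integrals of the averages tend to 0, so the infimum of any tail of averages has integral 0
    and vanishes almost everywhere. This gives small averages at arbitrarily large indices. *)
Lemma cesaro_ae : {ae P, forall w, forall (c : R), 0 < c -> forall N,
  exists2 n, (N <= n)%N & n.+1%:R^-1 * \sum_(i < n.+1) e i w < c}.
Proof.
pose a n w := n.+1%:R^-1 * \sum_(i < n.+1) e i w.
have ma n : measurable_fun setT (a n).
  by apply: measurable_funM => //; apply: measurable_sum => i; exact: me.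
have a0 n w : 0 <= a n w by rewrite mulr_ge0 ?invr_ge0// sumr_ge0.
pose u k := fine (\int[P]_w (e k w)%:E)%E.
have uE k : (\int[P]_w (e k w)%:E = (u k)%:E)%E.
  rewrite /u fineK//; apply: integrable_fin_num => //.
  by apply: integrable_bounded => // w; rewrite e0 eM.
have aE n : (\int[P]_w (a n w)%:E = (arithmetic_mean u n)%:E)%E.
  under eq_integral do rewrite EFinM.
  rewrite ge0_integralZl_EFin ?invr_ge0//; last 2 first.
  - by move=> w _; rewrite lee_fin sumr_ge0.
  - by apply/measurable_EFinP; apply: measurable_sum => i; exact: me.
  under eq_integral do rewrite -sumEFin.
  rewrite ge0_integral_sum//; last 2 first.
  - by move=> i; apply/measurable_EFinP; exact: me.
  - by move=> i w _; rewrite lee_fin.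
  rewrite /arithmetic_mean /series /= big_mkord EFinM -sumEFin; congr (_ * _)%E.
  by apply: eq_bigr => i _; exact: uE.
have u0 : u @ \oo --> 0.
  exact: (fine_cvg e_cvg).
have am0 := cesaro u0.
(* The infimum over indices n >= N; its integral is at most that of each such average. *)
pose g N w := einfs (fun k => (a k w)%:E) N.
have mg N : measurable_fun setT (g N).
  by apply: measurable_fun_einfs => n; apply/measurable_EFinP.
have g0 N w : (0 <= g N w)%E.
  by apply: le_ereal_inf_tmp => _ [k _ <-]; rewrite lee_fin.
have gle N n w : (N <= n)%N -> (g N w <= (a n w)%:E)%E.
  by move=> Nn; apply: ereal_inf_lbound; exists n.
have gint N : (\int[P]_w g N w = 0)%E.
  apply/eqP; rewrite eq_le integral_ge0 ?andbT//.
  apply/lee_addgt0Pr => c c0; rewrite add0e.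
  have [n [Nn amn]] : exists n, (N <= n)%N /\ arithmetic_mean u n <= c.
    have : \forall n \near \oo, `|0 - arithmetic_mean u n| <= c.
      by move/cvgrPdist_le : am0; apply.
    move=> [n1 _ Hn]; exists (maxn N n1); split; first exact: leq_maxl.
    have := Hn (maxn N n1) (leq_maxr _ _) => /=.
    by rewrite sub0r normrN; exact: le_trans (ler_norm _).
  apply: (@le_trans _ _ (\int[P]_w (a n w)%:E)%E); last by rewrite aE lee_fin.
  by apply: le_lower_integral => // w; exact: gle.
have gae N : {ae P, forall w, g N w = 0%E}.
  have : ae_eq P setT (g N) (cst 0%E).
    apply/ae_eq_integral_abs => //; rewrite -[RHS](gint N).
    by apply: eq_integral => w _; rewrite gee0_abs.
  by apply: filterS => w /(_ I).
have : {ae P, forall w N, g N w = 0%E} by apply/ae_foralln.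
apply: filterS => w gw c c0 N.
have : (g N w < c%:E)%E by rewrite gw lte_fin.
by move=> /ereal_inf_lt[_ [n Nn <-]]; rewrite lte_fin; exists n.
Qed.

End cesaro_ae.

Section convergence.
Context (R : realType) (n : nat) (Om : ptopologicalType).
Context (P : probability (borel Om) R).
Local Notation E := 'rV[R]_n.+1.
Local Notation m := (lebesgue_rV R n.+1).
Variables (sigma sigmai : borel Om -> borel Om) (C : set E).
Variables (T : borel Om -> E -> E) (B : branches R n.+1 Om) (alpha e1 : R).
Local Notation V := (Valpha C alpha e1).
Local Notation nrm := (Vnorm (N := n.+1) alpha e1).
Local Notation L := (transfer T B).
Local Notation pullF := (pull (setT `*` C) (skew_map T sigma)).
Local Notation mean w k := (k.+1%:R^-1 *:
  (\sum_(1 <= i < k.+2) cocycle sigma L i (iter i sigmai w) \1_C)).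
Hypotheses (sK : cancel sigma sigmai) (siK : cancel sigmai sigma).
Hypotheses (ms : measurable_fun setT sigma) (msi : measurable_fun setT sigmai).
Hypothesis Ps : forall A, measurable A -> P (sigma @^-1` A) = P A.
Hypotheses (e10 : 0 < e1) (cC : compact C).
Hypothesis mF : measurable_fun (setT `*` C) (skew_map T sigma).
Hypothesis LV : forall w f, V f -> V (L w f).
Hypothesis V1 : V \1_C.
Variables (G A : set (borel Om)) (Y : borel Om -> set (E -> R)) (d : nat).
Hypotheses (mG : measurable G) (PG : P (~` G) = 0%E) (GA : G `<=` A).
Hypothesis Gs : forall w, G w -> G (sigma w).
Hypothesis Gsi : forall w, G w -> G (sigmai w).
Hypothesis Gdual : forall w, G w -> dual_at C T B alpha e1 w.
Hypothesis Gsub : forall w, G w -> Defs.subspace V nrm (Y w).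
Hypothesis Gdim : forall w, G w -> has_dim nrm (Y w) d.
Hypothesis Glead : forall w, G w -> leading_at sigma C T alpha e1 w (Y w).
Hypothesis Gequi : forall w, G w -> forall y, Y w y -> Y (sigma w) (L w y).
Hypothesis Ycont : P_continuous_on A (fun w w' => gap nrm (Y w) (Y w')).

Let mC : measurable C := compact_measurable_rV cC.
Let mZ : measurable ([set: borel Om] `*` C) := measurableX measurableT mC.

Lemma G_iter w k : G w -> G (iter k sigma w).
Proof. by move=> Gw; elim: k => //= k; exact: Gs. Qed.

Lemma G_iter_inv w k : G w -> G (iter k sigmai w).
Proof. by move=> Gw; elim: k => //= k; exact: Gsi. Qed.

Lemma leading_equivariant w k y : G w -> Y w y ->
  Y (iter k sigma w) (cocycle sigma L k w y).
Proof.
move=> Gw Yy; elim: k => [|k IH]; first exact: Yy.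
exact: (Gequi (G_iter k Gw) IH).
Qed.

Section family.
Variables (q : nat) (D : 'I_q -> set E).
Hypothesis mD : forall i, measurable (D i).
Local Notation rho x w := (integrals_dist D x (Y w)).

(** The integrals of the k-th image of the constant 1, as volumes of fibers; this form is measurable
    in w. Intersecting with the cylinder accounts for C when k = 0. *)
Definition orbit_mass k (w : borel Om) : 'rV[R]_q :=
  \row_i fine (m (xsection ((setT `*` C) `&` iter k pullF (setT `*` D i)) w)).

Lemma orbit_massE k w : G w ->
  integrals D (cocycle sigma L k w \1_C) = orbit_mass k w.
Proof.
move=> Gw; apply/rowP => i; rewrite !mxE.
rewrite (cocycle_pulled mC mF LV (fun j => Gdual (G_iter j Gw)))// /Rintegral.
rewrite integral_indic//; last exact: (measurable_pulled mC mF).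
congr (fine (m _)); apply/seteqP; split=> x.
  by rewrite /pulled /xsection /= !inE => -[].
by rewrite /pulled /xsection /= !inE => -[[]].
Qed.

Lemma measurable_orbit_mass k : measurable_fun setT (orbit_mass k).
Proof.
apply: measurable_fun_rV => // i; rewrite (_ : (fun w => _) = fine \o
  (fun w => m (xsection ((setT `*` C) `&` iter k pullF (setT `*` D i)) w))).
  apply: measurableT_comp => //; apply: measurable_fun_xsection.
  apply: measurableI => //; apply: measurable_iter_pull => //.
  exact: measurableX.
by apply/funext => w; rewrite mxE.
Qed.

Lemma norm_orbit_mass k w : `|orbit_mass k w| <= fine (m C).
Proof.
have Coo := compact_lebesgue_lty cC.
apply/rV_normP => [|i]; first exact: fine_ge0.
rewrite mxE ger0_norm ?fine_ge0//.
have mS : measurable (xsection ((setT `*` C) `&` iter k pullF (setT `*` D i)) w).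
  apply: measurable_xsection; apply: measurableI => //.
  by apply: measurable_iter_pull => //; exact: measurableX.
have SC : (m (xsection ((setT `*` C) `&` iter k pullF (setT `*` D i)) w) <= m C)%E.
  by apply: le_measure; rewrite ?inE// => x; rewrite /xsection /= inE => -[[]].
rewrite fine_le// ge0_fin_numE//; exact: le_lt_trans SC Coo.
Qed.

(** Set to 0 off G, where [Y w] need not be a subspace. *)
Let dev k (w : borel Om) : R :=
  ((fun w => rho (orbit_mass k (iter k sigmai w)) w) \_ G) w.

Let devE k w : G w -> dev k w = rho (orbit_mass k (iter k sigmai w)) w.
Proof. by move=> Gw; rewrite /dev patchE mem_set. Qed.

Let dev0 k w : ~ G w -> dev k w = 0.
Proof. by move=> Gw; rewrite /dev patchE memNset. Qed.

Let dev_bound k w : 0 <= dev k w <= fine (m C).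
Proof.
have [Gw|Gw] := pselect (G w); last by rewrite dev0// lexx fine_ge0.
rewrite devE// (integrals_dist_ge0 D (Gsub Gw)).
by rewrite (le_trans (integrals_dist_le_norm D (Gsub Gw) _))// norm_orbit_mass.
Qed.

Let measurable_dev k : measurable_fun setT (dev k).
Proof.
apply/(measurable_restrictT _ mG).
apply: (measurable_integrals_dist e10 mD mG GA Gsub Ycont).
apply: (measurableT_comp (measurable_orbit_mass k)); exact: measurable_iter.
Qed.

(** At sigma^k w the backward orbit of length k leads to w, so only the forward estimate at w
    enters; by equivariance the image of its approximant y lies in the leading space at sigma^k
    w. *)
Let dev_orbit_cvg w : dev k (iter k sigma w) @[k --> \oo] --> 0.
Proof.
have [Gw|Gw] := pselect (G w); last first.
  rewrite (_ : (fun k => _) = cst 0); first exact: cvg_cst.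
  apply/funext => k; rewrite dev0// => Gk; apply: Gw.
  by rewrite -(iter_cancel k sK w); exact: G_iter_inv.
apply/cvgrPdist_le => e e0; have [y Yy [k0 Hk]] := Glead Gw V1 e0.
exists k0 => // k /= k0k; have Gk := G_iter k Gw.
rewrite sub0r normrN ger0_norm; last by have /andP[] := dev_bound k (iter k sigma w).
rewrite devE// (iter_cancel k sK) -orbit_massE//.
apply: le_trans (integrals_dist_le D _ (leading_equivariant k Gw Yy)) _.
apply/rV_normP => [|i]; first exact: ltW.
have dualw j := Gdual (G_iter j Gw).
have Vy : V y by have [YV _ _ _] := Gsub Gw; exact: YV.
have E1 := cocycle_pulled mC mF LV dualw k V1 (mD i).
have E2 := cocycle_pulled mC mF LV dualw k Vy (mD i).
have -> : (integrals D (cocycle sigma L k w \1_C) -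
    integrals D (cocycle sigma L k w y)) ord0 i =
    \int[m]_(x in D i) (cocycle sigma L k w \1_C x) -
    \int[m]_(x in D i) (cocycle sigma L k w y x) by rewrite !mxE.
by rewrite E1 E2; exact: Hk.
Qed.

Let integral_dev_cvg : (\int[P]_w (dev k w)%:E)%E @[k --> \oo] --> 0%E.
Proof.
have mdev k : measurable_fun setT (fun w => (dev k (iter k sigma w))%:E).
  apply/measurable_EFinP; apply: (measurableT_comp (measurable_dev k)).
  exact: measurable_iter.
have cdev : {ae P, forall w, setT w ->
    (dev k (iter k sigma w))%:E @[k --> \oo] --> cst 0%E w}.
  by apply: aeW => w _; apply: cvg_EFin; [exact: nearW|exact: dev_orbit_cvg].
have bdev : {ae P, forall w k, setT w ->
    (`|(dev k (iter k sigma w))%:E| <= cst (fine (m C))%:E w)%E}.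
  apply: aeW => w k _; have /andP[h0 h1] := dev_bound k (iter k sigma w).
  by rewrite /= lee_fin ger0_norm.
have iM : P.-integrable setT (cst (fine (m C))%:E).
  exact: finite_measure_integrable_cst.
have [_ _] := dominated_convergence measurableT mdev (measurable_cst 0%E) cdev iM bdev.
rewrite integral0; apply: cvg_trans; apply: near_eq_cvg; apply: nearW => k.
apply: (integral_preserving_iter ms Ps (f := fun w => (dev k w)%:E)).
  exact/measurable_EFinP.
by move=> w; rewrite lee_fin; have /andP[] := dev_bound k w.
Qed.

Lemma limit_integrals_dist : {ae P, forall w, G w -> forall h : E -> R, V h ->
  (L1norm (mean w k - h)) @[k --> \oo] --> 0%E ->
  rho (integrals D h) w <= 0}.
Proof.
(* The averages defining h start at k = 1, hence the shift. *)
have c1 : (\int[P]_w (dev k.+1 w)%:E)%E @[k --> \oo] --> 0%E.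
  exact: (cvg_succ integral_dev_cvg).
have b1 k w : 0 <= dev k.+1 w by have /andP[] := dev_bound k.+1 w.
have b2 k w : dev k.+1 w <= fine (m C) by have /andP[] := dev_bound k.+1 w.
apply: filterS (cesaro_ae (fun k => measurable_dev k.+1) b1 b2 c1) => w Hw Gw h Vh hcvg.
apply/ler_addgt0Pr => c c0; rewrite add0r.
have c2 : 0 < c / 2 by rewrite divr_gt0.
have near_h : \forall k \near \oo, (L1norm (mean w k - h)%R < (c / 2)%:E)%E.
  have c2E : (0 < (c / 2)%:E)%E by rewrite lte_fin.
  exact: (hcvg _ (open_ereal_lt' c2E)).
(* One index beyond N with a small average is enough, since the L^1 estimate holds at every index
   beyond N. *)
have [N _ HN] := near_h; have [k Nk Hk] := Hw _ c2 N.
have := HN k Nk => /=; rewrite big_add1 big_mkord /=.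
set S := \sum_(i < k.+1) _ => hk.
have If i : m.-integrable setT
    (EFin \o cocycle sigma L i.+1 (iter i.+1 sigmai w) \1_C).
  exact: (Valpha_integrable (cocycle_V sigma LV (iter i.+1 sigmai w) i.+1 V1)).
have IS : m.-integrable setT (EFin \o S).
  have := integrable_sum_lin (fun=> 1) (fun i : 'I_k.+1 => If i).
  by under eq_bigr do rewrite scale1r.
have Ih := Valpha_integrable Vh.
have IkS : m.-integrable setT (EFin \o (k.+1%:R^-1 *: S)).
  exact: integrableZ_lin.
have SE : integrals D (k.+1%:R^-1 *: S) =
    k.+1%:R^-1 *: \sum_(i < k.+1) orbit_mass i.+1 (iter i.+1 sigmai w).
  rewrite (integralsZ mD _ IS); congr (_ *: _); apply/rowP => j; rewrite mxE summxE /S.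
  have := Rintegral_sum_lin (fun=> 1) (mD j) (fun i : 'I_k.+1 => If i).
  under eq_bigr do rewrite scale1r.
  move=> ->; apply: eq_bigr => i _; rewrite mul1r.
  rewrite -orbit_massE; last exact: G_iter_inv.
  by rewrite mxE.
apply: le_trans (integrals_dist_shift D (Gsub Gw) _ (integrals D (k.+1%:R^-1 *: S))) _.
rewrite [leRHS](splitr c); apply: lerD.
  rewrite SE; apply: le_trans (ltW Hk).
  apply: le_trans (integrals_dist_mean mD (Gsub Gw) k
    (fun i => orbit_mass i.+1 (iter i.+1 sigmai w))) _.
  rewrite ler_wpM2l ?invr_ge0//; apply: ler_sum => i _.
  by rewrite devE.
rewrite distrC -(integralsB mD IkS Ih).
rewrite -lee_fin; apply: le_trans (ltW hk); apply: norm_integrals_le => //.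
exact: integrableB_lin.
Qed.

End family.

Lemma limit_in_leading : {ae P, forall w, forall h : E -> R, V h ->
  (L1norm (mean w k - h)) @[k --> \oo] --> 0%E ->
  Y w h}.
Proof.
pose cube i : set E := if unpickle i is Some p then dcube p.1 p.2 else set0.
have mcube i : measurable (cube i).
  by rewrite /cube; case: unpickle => // p; exact: measurable_dcube.
have aeG : {ae P, forall w, G w}.
  by exists (~` G); split=> //; exact: measurableC.
(* A countable intersection over q: for almost every w all initial segments of the list of cubes are
   treated at once. *)
have aeD : {ae P, forall w q, G w -> forall h : E -> R, V h ->
    (L1norm (mean w k - h)) @[k --> \oo] --> 0%E ->
    integrals_dist (fun i : 'I_q => cube i) (integrals (fun i : 'I_q => cube i) h)
      (Y w) <= 0}.
  by apply/ae_foralln => q; exact: limit_integrals_dist.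
apply: filterS2 aeG aeD => w Gw Hq h Vh hcvg.
have [YV Y0 lin Ycl] := Gsub Gw; have [b [Yb bfree bspan]] := Gdim Gw.
have Ib p : m.-integrable setT (EFin \o b p) by exact/Valpha_integrable/YV/Yb.
have Ih := Valpha_integrable Vh.
have Ysum (a : 'I_d -> R) : Y w (\sum_p a p *: b p).
  apply: (big_ind (Y w)) => // [f g Yf Yg|p _].
    by have := lin 1 f g Yf Yg; rewrite scale1r.
  by have := lin (a p) (b p) 0 (Yb p) Y0; rewrite addr0.
have cube0 g : m.-integrable setT (EFin \o g) ->
    (forall i, \int[m]_(x in cube i) g x = 0) -> nrm g = 0%E.
  move=> Ig g0; apply: Vnorm_ae0 => //; apply: ae0_dcube => // l k.
  by have := g0 (pickle (l, k)); rewrite /cube pickleK.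
pose phi i p := \int[m]_(x in cube i) b p x.
have phiE (a : 'I_d -> R) i :
    \int[m]_(x in cube i) (\sum_p a p *: b p) x = \sum_p a p * phi i p.
  exact: Rintegral_sum_lin.
(* The coordinates are the integrals over the enumerated cubes: [Hq] gives the approximation on
   finitely many of them and [bfree] the separation. *)
have [k c c0|a a0|a ha] := @exact_solution R d phi (fun i => \int[m]_(x in cube i) h x).
- have hlt := le_lt_trans (Hq k Gw h Vh hcvg) c0.
  have [y Yy yh] := integrals_dist_lt (Gsub Gw) hlt.
  have [a ya] := bspan y Yy; exists a => i ik.
  rewrite -phiE -(eq_Rintegral_Vnorm e10 (mcube i) _ _ ya); last 2 first.
  - exact/Valpha_integrable/YV.
  - exact: integrable_sum_lin.
  have := rV_norm_coord (integrals (fun i : 'I_k => cube i) h -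
    integrals (fun i : 'I_k => cube i) y) (Ordinal ik).
  by rewrite !mxE => /le_trans; apply; exact: ltW.
- apply: bfree; apply: cube0; first exact: integrable_sum_lin.
  by move=> i; rewrite phiE.
- apply: (Ycl _ _ (Ysum a) Vh); apply: cube0.
    by apply: integrableB_lin => //; exact: integrable_sum_lin.
  move=> i; rewrite RintegralB_lin//; last exact: integrable_sum_lin.
  by rewrite ha phiE subrr.
Qed.

End convergence.

Theorem corollary5p4 (R : realType) (N : nat) (Om : ptopologicalType)
    (P : probability (borel Om) R) (sigma sigmai : borel Om -> borel Om)
    (C : set 'rV[R]_N) (T : borel Om -> 'rV[R]_N -> 'rV[R]_N)
    (B : branches R N Om) (alpha S : R) (s : borel Om -> R)
    (hN : (1 < N)%N)
    (hsigma : ergodic_base P sigma sigmai)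
    (hC : compact C) (hCint : closure (interior C) !=set0)
    (hT : random_saussol P C T B alpha S s)
    (hskew : measurable_fun (setT `*` C) (skew_map T sigma)) :
  exists2 estar : R, 0 < estar & forall e0 : R, 0 < e0 < estar ->
    let V := Valpha C alpha (S * e0) in
    let nrm := Vnorm (N := N) alpha (S * e0) in
    let L := transfer T B in
    forall (h1 : V \1_C)
      (hLcont : P_continuous_cocycle V nrm L)
      (hLint : (\int[P]_w ((fun w => lne (opnorm V nrm (L w))) ^\+ w) < +oo)%E)
      (lstar : R) (kstar : \bar R) (l : option nat) (lam : nat -> R)
      (d : nat -> nat) (Y : nat -> borel Om -> set ('rV[R]_N -> R))
      (W : borel Om -> set ('rV[R]_N -> R))
      (hspl : oseledets_splitting P V nrm sigma L lstar kstar l lam d Y W)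
      (hlstar : lstar = 0),
    {ae P, forall w, forall h : 'rV[R]_N -> R, V h ->
       (L1norm (n.+1%:R^-1 *: (\sum_(1 <= k < n.+2)
          cocycle sigma L k (iter k sigmai w) \1_C) - h))
         @[n --> \oo] --> 0%E ->
       Y 0%N w h}
    /\
    exists (r : nat) (mu : 'I_r -> probability (borel Om * 'rV[R]_N)%type R),
      [/\ (r <= d 0)%N,
          (forall i, skew_acip P C T sigma (mu i) /\
                     skew_ergodic C T sigma (mu i)),
          (forall i j, (forall A, measurable A -> mu i A = mu j A) -> i = j) &
          (forall nu : probability (borel Om * 'rV[R]_N)%type R,
             skew_acip P C T sigma nu -> skew_ergodic C T sigma nu ->
             exists i, forall A, measurable A -> nu A = mu i A)].
Proof.
case: N C T B hN hC hCint hT hskew => [//|n] C T B hN hC hCint hT hskew.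
have [sK siK ms msi Ps _] := hsigma.
have [TC wf a01 S0 [estar estar0 small]] := hT.
exists estar => // e0 /[dup] /andP[e00 _] /small[_ pe2 [pe3 _] pe4 _].
move=> V nrm L h1 [Lbounded _] _ lstar kstar l lam d Y W hspl lstar0.
have e10 : 0 < S * e0 by rewrite mulr_gt0.
have mC := compact_measurable_rV hC.
have LV w f : V f -> V (L w f) by have [LV _ _] := Lbounded w; exact: LV.
have [_ _ l0 top dec gtk dim grass _ dsum equi inv rate slow contY _] := hspl.
have lam0 j : (0 < j)%N -> below l j -> lam j < 0.
  by move=> j0 lj; rewrite -lstar0 -top; exact: dec.
have kstar0 : (kstar < 0)%E by have := gtk 0%N l0; rewrite top lstar0.
have [A PA contA] := contY 0%N l0.
have aedual : {ae P, forall w, dual_at C T B alpha (S * e0) w}.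
  apply: filterS3 pe2 pe3 pe4 => w w2 w3 w4.
  exact: (dual_atP mC hskew LV wf e00 w2 w3 w4).
(* Duality is iterated along the forward orbit, so it has to hold at all of its points. *)
have aedualk : {ae P, forall w k, dual_at C T B alpha (S * e0) (iter k sigma w)}.
  have [G [mG PG GQ Gs _]] := invariant_core sK siK ms msi Ps aedual.
  exists (~` G); split=> [||w nw Gw]; [exact: measurableC|exact: PG|].
  apply: nw => /= k; apply: GQ.
  by elim: k => //= k; exact: Gs.
have aelead : {ae P, forall w, leading_at sigma C T alpha (S * e0) w (Y 0%N w)}.
  apply: filterS (filterI aedualk (filterI (filterI dim grass) (filterI dsum
    (filterI rate slow)))) => w [wdual [[wdim [wcl _]] [wsum [wrate wslow]]]] f e Vf ep.
  apply: (leading_part e10 mC hskew LV wdual kstar0 lam0 l0 _ wcl.1 wsum wrate wslow) => //.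
  by move=> j lj; have [] := wdim j lj.
have aeA : {ae P, forall w, A w}.
  have [F [mF FA _]] := contA.
  by exists (~` A); split => //; rewrite -FA; apply: measurableC; exact: bigcupT_measurable.
pose good w := [/\ dual_at C T B alpha (S * e0) w,
  Defs.subspace V nrm (Y 0%N w), has_dim nrm (Y 0%N w) (d 0%N),
  leading_at sigma C T alpha (S * e0) w (Y 0%N w) &
  A w /\ forall y, Y 0%N w y -> Y 0%N (sigma w) (L w y)].
have aegood : {ae P, forall w, good w}.
  apply: filterS (filterI aedual (filterI dim (filterI aelead (filterI aeA equi)))).
  move=> w [wdual [wdim [wlead [wA weq]]]].
  have [wsub wd] := wdim 0%N l0; have [weq0 _] := weq 0%N l0.
  by split.
have [G [mG PG GQ Gs Gsi]] := invariant_core sK siK ms msi Ps aegood.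
split.
  have GA : G `<=` A by move=> w /GQ[_ _ _ _ []].
  have Gdual w : G w -> dual_at C T B alpha (S * e0) w by move=> /GQ[].
  have Gsub w : G w -> Defs.subspace V nrm (Y 0%N w) by move=> /GQ[].
  have Gdim w : G w -> has_dim nrm (Y 0%N w) (d 0%N) by move=> /GQ[].
  have Glead w : G w -> leading_at sigma C T alpha (S * e0) w (Y 0%N w) by move=> /GQ[].
  have Gequi w : G w -> forall y, Y 0%N w y -> Y 0%N (sigma w) (L w y).
    by move=> /GQ[_ _ _ _ []].
  exact: (limit_in_leading sK ms msi Ps e10 hC hskew LV h1 mG PG GA Gs Gsi
    Gdual Gsub Gdim Glead Gequi contA).
have aebound : {ae P, forall w, [/\ leading_at sigma C T alpha (S * e0) w (Y 0%N w),
    Y 0%N w `<=` V & has_dim nrm (Y 0%N w) (d 0%N)]}.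
  by apply: filterS aegood => w [_ [YV _ _ _] ? ? _].
(* Equivalence is equality on measurable sets; the dimension bounds every family of distinct ergodic
   measures, so a largest family lists them all. *)
have [r [mu [rd Hmu inj exh]]] := @maximal_family (probability (borel Om * 'rV[R]_n.+1)%type R)
  (fun mu => skew_acip P C T sigma mu /\ skew_ergodic C T sigma mu)
  (fun mu nu => forall A, measurable A -> mu A = nu A) (d 0%N)
  (fun mu nu h A mA => esym (h A mA))
  (fun r mu => acip_card_le_dim a01 e10 hC hskew h1 TC aebound).
by exists r, mu; split=> // nu nu1 nu2; exact: exh.
Qed.
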